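(* Let $n\ge 2$, let $\Omega\subset\mathbb{R}^n$ be a bounded open set, let $1<p<n$, $p'=\frac{p}{p-1}$, $0<\alpha<\frac{1}{p'}$, and $q=\frac{np(1-\alpha)}{n-\alpha p}$. Let $\beta_1,\dots,\beta_5$ be positive real constants. Let $b:\Omega\to\mathbb{R}$ be measurable with $\beta_2\le b(x)\le\beta_3$ for almost every $x\in\Omega$, and let $$a(x,s)=\frac{\beta_1}{(b(x)+|s|)^{\alpha p}}\qquad\text{for a.e. }x\in\Omega\text{ and every }s\in\mathbb{R}.$$ Let $j:\mathbb{R}^n\to\mathbb{R}$ be a convex function with $j(0)=0$ and $\beta_4|\xi|^p\le j(\xi)\le\beta_5(1+|\xi|^p)$ for every $\xi\in\mathbb{R}^n$. Let $f\in M^r(\Omega)$ with $r\ge\frac{n}{p}$, and let $u\in W_0^{1,q}(\Omega)$ be a minimum of the functional $\mathcal{I}$ on $W_0^{1,q}(\Omega)$, i.e. $\mathcal{I}(u)\le\mathcal{I}(v)$ for all $v\in W_0^{1,q}(\Omega)$, where $\mathcal{I}$ is the extended functional (defined in the context) associated with $$\mathcal{J}(v)=\int_\Omega a(x,v)\,j(\nabla v)\,dx-\int_\Omega f v\,dx .$$ Then: (i) if $r=\frac{n}{p}$, there exists $\lambda>0$ such that $e^{\lambda|u|^{1-p'\alpha}}\in L^1(\Omega)$; (ii) if $r>\frac{n}{p}$, there exists $L>0$ such that $|u|\le 2L$ almost everywhere in $\Omega$.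
   Context: For $r>0$, the Marcinkiewicz space $M^r(\Omega)$ is the set of all measurable functions $f:\Omega\to\mathbb{R}$ for which there is a constant $c>0$ such that $|\{x\in\Omega:|f(x)|>t\}|\le \frac{c}{t^r}$ for every $t>0$, where $|E|$ denotes the Lebesgue measure of $E$. The functional $\mathcal{I}:W_0^{1,q}(\Omega)\to\mathbb{R}\cup\{+\infty\}$ is defined by $\mathcal{I}(v)=\mathcal{J}(v)$ if $\mathcal{J}(v)$ is finite, and $\mathcal{I}(v)=+\infty$ otherwise. Here $q<p$, and for $v\in W_0^{1,q}(\Omega)$ and $f\in M^r(\Omega)$ with $r\ge\frac np$ the integral $\int_\Omega fv\,dx$ is well-defined and finite by the Sobolev embedding. *)

(* Defs.v *)
From HB Require Import structures.
From mathcomp Require Import all_boot all_order all_algebra.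
From mathcomp Require Import all_classical all_reals all_analysis.

Set Implicit Arguments.
Unset Strict Implicit.
Unset Printing Implicit Defensive.

Import Order.TTheory GRing.Theory Num.Theory.
Import numFieldNormedType.Exports.

Local Open Scope classical_set_scope.
Local Open Scope ring_scope.

Definition borel_rV (R : realType) (n : nat) : Type := 'rV[R]_n.

Section borel_rV.
Context {R : realType} (n : nat).

Let coord (i : 'I_n) (x : 'rV[R]_n) : measurableTypeR R := x ord0 i.

Let borel_rV0 : g_sigma_preimage coord set0.
Proof. exact: sigma_algebra0. Qed.

Let borel_rVC A : g_sigma_preimage coord A -> g_sigma_preimage coord (~` A).
Proof. exact: sigma_algebraC. Qed.

Let borel_rV_bigcup (F : (set 'rV[R]_n)^nat) :
  (forall i, g_sigma_preimage coord (F i)) ->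
  g_sigma_preimage coord (\bigcup_i F i).
Proof. exact: sigma_algebra_bigcup. Qed.

HB.instance Definition _ := Pointed.on (borel_rV R n).
HB.instance Definition _ :=
  @isMeasurable.Build (measure_tuple_display default_measure_display)
    (borel_rV R n) (g_sigma_preimage coord)
    borel_rV0 borel_rVC borel_rV_bigcup.

End borel_rV.

(* R^n * R -> R^(n+1), the last factor becoming the last coordinate *)
Definition rcons_rV {R : realType} {n : nat}
    (p : borel_rV R n * measurableTypeR R) : borel_rV R n.+1 :=
  \row_(i < n.+1) if unlift ord_max i is Some k
                  then (p.1 : 'rV[R]_n) ord0 k else p.2.

Lemma measurable_coord_rV {R : realType} n (i : 'I_n) :
  measurable_fun [set: borel_rV R n]
    (fun x : borel_rV R n => (x : 'rV[R]_n) ord0 i : measurableTypeR R).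
Proof.
move=> _ Y mY; rewrite setTI; apply: sub_sigma_algebra => /=.
rewrite -bigcup_seq/=; exists i => /=; first by rewrite mem_index_enum.
by exists Y => //; rewrite setTI.
Qed.

Lemma measurable_rcons_rV {R : realType} n :
  measurable_fun setT (@rcons_rV R n).
Proof.
move=> _ Y mY; rewrite setTI.
pose c (i : 'I_n.+1) (x : 'rV[R]_n.+1) : measurableTypeR R := x ord0 i.
have : preimage_set_system setT (@rcons_rV R n) (g_sigma_preimage c)
         (rcons_rV @^-1` Y) by exists Y => //; rewrite setTI.
rewrite -(g_sigma_preimage_comp c (@rcons_rV R n)).
move: (rcons_rV @^-1` Y); apply: smallest_sub.
  exact: sigma_algebra_measurable.
rewrite -bigcup_seq; apply: bigcup_sub => i _ A [B mB <-].
rewrite setTI.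
case: (unliftP ord_max i) => [k ->|->].
- rewrite (_ : c _ \o _ = (fun x : borel_rV R n => (x : 'rV[R]_n) ord0 k) \o fst);
    last by apply/funext => p /=; rewrite /c mxE liftK.
  rewrite -[X in measurable X]setTI.
  by apply: (measurableT_comp (@measurable_coord_rV R n k) measurable_fst).
- rewrite (_ : c _ \o _ = snd);
    last by apply/funext => p /=; rewrite /c mxE unlift_none.
  rewrite -[X in measurable X]setTI.
  exact: measurable_snd.
Qed.

Fixpoint borel_lebesgue (R : realType) (n : nat) :
    {measure set (borel_rV R n) -> \bar R} :=
  if n is k.+1 then
    measure_function_pushforward__canonical__measure_function_Measure
      (borel_lebesgue R k \x (@lebesgue_measure R))%E (@measurable_rcons_rV R k)
  else dirac ((0 : 'rV[R]_0) : borel_rV R 0).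

Lemma measurable_rect {R : realType} n (A : 'I_n -> set (measurableTypeR R)) :
  (forall i, measurable (A i)) ->
  measurable ([set x | forall i, A i ((x : 'rV[R]_n) ord0 i)]
    : set (borel_rV R n)).
Proof.
move=> mA; rewrite (_ : mkset _ = \bigcap_(i in [set: 'I_n])
    ((fun x : borel_rV R n => (x : 'rV[R]_n) ord0 i) @^-1` A i)).
  apply: fin_bigcap_measurable => // i _.
  by rewrite -[X in measurable X]setTI; exact: measurable_coord_rV.
by apply/seteqP; split=> x /= h; [move=> i _; exact: h|move=> i; exact: (h i)].
Qed.

Lemma borel_lebesgue_rect {R : realType} n
    (A : 'I_n -> set (measurableTypeR R)) :
  (forall i, measurable (A i)) ->
  borel_lebesgue R n [set x | forall i, A i ((x : 'rV[R]_n) ord0 i)] =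
    (\prod_(i < n) lebesgue_measure (A i))%E.
Proof.
elim: n A => [|n IHn] A mA.
  by rewrite big_ord0 /= /dirac indicE mem_set// => -[].
rewrite /= /pushforward.
rewrite (_ : rcons_rV @^-1` _ =
    [set x : borel_rV R n | forall k, A (lift ord_max k) ((x : 'rV[R]_n) ord0 k)]
      `*` A ord_max); last first.
  apply/seteqP; split=> [x /= h|x /= [h1 h2] i].
    split=> [k|].
      by have := h (lift ord_max k); rewrite mxE liftK.
    by have := h ord_max; rewrite mxE unlift_none.
  by rewrite mxE; case: unliftP => [k ->|->].
rewrite product_measure1E//; last first.
  exact: (measurable_rect (A := fun k => A (lift ord_max k))).
rewrite (IHn (fun k => A (lift ord_max k)))// big_ord_recr /=; congr (_ * _)%E.
apply: eq_bigr => i _; congr (lebesgue_measure (A _)).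
by apply/val_inj; rewrite /= /bump leqNgt ltn_ord.
Qed.

(* R^n with the Lebesgue sigma-algebra, i.e. the completion of the product
   sigma-algebra for the n-fold product of the Lebesgue measure on R. *)
Definition lebesgue_rV (R : realType) (n : nat) :=
  caratheodory_type (borel_lebesgue R n)^*%mu.
HB.instance Definition _ R n := Measurable.on (lebesgue_rV R n).

Definition leb {R : realType} {n : nat} :
    {measure set (lebesgue_rV R n) -> \bar R} :=
  @completed_measure_extension _ _ R (borel_lebesgue R n).

Lemma leb_rect {R : realType} n (A : 'I_n -> set (measurableTypeR R)) :
  (forall i, measurable (A i)) ->
  leb [set x | forall i, A i ((x : 'rV[R]_n) ord0 i)] =
    (\prod_(i < n) lebesgue_measure (A i))%E.
Proof.
move=> mA; rewrite -borel_lebesgue_rect//.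
by have /measurable_mu_extE := measurable_rect mA; exact.
Qed.

(* The norm `|x| of the library on 'rV[R]_n is the sup norm. *)
Definition enorm {R : realType} {n : nat} (x : 'rV[R]_n) : R :=
  Num.sqrt (\sum_(i < n) x ord0 i ^+ 2).

Definition marcinkiewicz {R : realType} {n : nat} (Omega : set 'rV[R]_n)
    (r : R) (f : 'rV[R]_n -> R) : Prop :=
  measurable_fun (Omega : set (lebesgue_rV R n)) f /\
  exists2 c : R, 0 < c & forall t : R, 0 < t ->
    (leb (Omega `&` [set x | (t < `|f x|)%R]) <= (c / t `^ r)%:E)%E.

Definition partial {R : realType} {n : nat} (i : 'I_n) (phi : 'rV[R]_n -> R)
    (x : 'rV[R]_n) : R :=
  'D_(delta_mx ord0 i) phi x.

Fixpoint Ck {R : realType} {n : nat} (k : nat) (phi : 'rV[R]_n -> R) : Prop :=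
  continuous phi /\
  if k is l.+1 then
    forall i : 'I_n,
      (forall x, derivable phi x (delta_mx ord0 i)) /\ Ck l (partial i phi)
  else True.

(* C_c^oo(Omega); such functions are extended by 0 to the whole of R^n *)
Definition test_function {R : realType} {n : nat} (Omega : set 'rV[R]_n)
    (phi : 'rV[R]_n -> R) : Prop :=
  [/\ forall k, Ck k phi,
      compact (closure [set x | phi x != 0]) &
      closure [set x | phi x != 0] `<=` Omega].

Section sobolev.
Context {R : realType} {n : nat} (Omega : set 'rV[R]_n) (q : R).
Implicit Types (v : 'rV[R]_n -> R) (G : 'rV[R]_n -> 'rV[R]_n).

Definition norm_Lq v : \bar R :=
  'N[@leb R n]_(q%:E)[EFin \o (v \_ Omega)]%E.

Definition in_Lq v : Prop :=
  measurable_fun (Omega : set (lebesgue_rV R n)) v /\ (norm_Lq v < +oo)%E.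

Definition weak_gradient v G : Prop :=
  forall phi, test_function Omega phi -> forall i : 'I_n,
    (\int[@leb R n]_(x in Omega) (v x * partial i phi x)%:E =
     - \int[@leb R n]_(x in Omega) (G x ord0 i * phi x)%:E)%E.

Definition norm_W1q v G : \bar R :=
  (norm_Lq v + \sum_(i < n) norm_Lq (fun x => G x ord0 i))%E.

Definition in_W1q v G : Prop :=
  [/\ in_Lq v, forall i : 'I_n, in_Lq (fun x => G x ord0 i) &
      weak_gradient v G].

(* closure of C_c^oo(Omega) in W^{1,q}(Omega) *)
Definition in_W1q0 v G : Prop :=
  in_W1q v G /\
  forall e : R, 0 < e -> exists2 phi, test_function Omega phi &
    (norm_W1q (fun x => v x - phi x)%R
              (fun x => G x - \row_i partial i phi x)%R < e%:E)%E.

(* An element of W_0^{1,q}(Omega), bundled with its weak gradient, which is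
   unique up to a null set; values outside Omega are irrelevant. *)
Record W1q0 : Type := MkW1q0 {
  W1q0_fun :> 'rV[R]_n -> R ;
  grad : 'rV[R]_n -> 'rV[R]_n ;
  W1q0P : in_W1q0 W1q0_fun grad }.

End sobolev.

Section functional.
Context {R : realType} {n : nat} (Omega : set 'rV[R]_n) (q : R).
Context (a : 'rV[R]_n -> R -> R) (j : 'rV[R]_n -> R) (f : 'rV[R]_n -> R).
Local Open Scope ereal_scope.

Definition J_functional (v : W1q0 Omega q) : \bar R :=
  \int[@leb R n]_(x in Omega) (a x (v x) * j (grad v x))%:E -
  \int[@leb R n]_(x in Omega) (f x * v x)%:E.

Definition I_functional (v : W1q0 Omega q) : \bar R :=
  if J_functional v \is a fin_num then J_functional v else +oo.

End functional.

(* Main.v *)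
(** Comparing [u] with [0] shows that the energy of [u] is finite; comparing it
    with its truncation at level [k], whose energy density is that of [u] on
    [{|u| <= k}] and [0] elsewhere, gives the Caccioppoli-type estimate
      [\int_{|u| > k} a(x, u) j(grad u) <= \int |f| (|u| - k)^+].
    Since [q* (p - q) = alpha p q], Hoelder's inequality trades the degenerate
    weight [(b + |u|)^(- alpha p)] for the [q*]-norm of [(|u| - k)^+], which the
    Sobolev inequality in turn bounds by the [q]-norm of the gradient. With the
    Marcinkiewicz bound on [f] this closes up to
      [|{|u| > h}| <= C ((beta_3 + k)^theta / (h - k))^q* |{|u| > k}|^(1 + eta)],
    where [theta = p' alpha < 1], and [eta > 0] if [r > n/p] while [eta = 0] if
    [r = n/p]. Iteration along [k_i = 2 L - L / 2^i] gives boundedness in the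
    first case, along [k_i = (i B)^(1 / (1 - theta))] geometric decay in the
    second. *)

From HB Require Import structures.
Require Import Defs.
From mathcomp Require Import all_boot all_order all_algebra.
From mathcomp Require Import all_classical all_reals all_analysis.
From mathcomp Require Import measurable_realfun ring lra.
Import Order.TTheory GRing.Theory Num.Theory.
Import numFieldNormedType.Exports.
Local Open Scope classical_set_scope.
Local Open Scope ring_scope.

Set Implicit Arguments.
Unset Strict Implicit.
Unset Printing Implicit Defensive.

(** Three obstacles shape the proof. Since [W1q0] is a closure of test functions, each fact about it
    must survive an [L^q] limit: truncations enter it through smooth approximations of [trunc], and
    the Sobolev inequality, proved for [C^1] functions of compact support by slicing, passes to the
    limit through a capped, hence Lipschitz, power. The energy density is treated as possibly
    non-measurable: its integral is a supremum over simple functions, only superadditive, so it is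
    bounded below at once by the measurable [b1 * b4 * |d_i u|^p / (b3 + |u|)^m] with [m = alpha p].
    Finally, with [s] the Sobolev exponent of [q], the estimate has its unknown [Y], the integral of
    [((|u| - k)^+)^s], on both sides: the right one carries [Y^(1/p)] and
    [((b3 + k)^s |{|u| > k}| + Y)^(m/p)]. It can be solved for [Y] because [1/p + m/p < 1], which is
    [alpha < 1/p']. Solving creates [theta = m / (p - 1)], and [eta = s (p/n - 1/r) / (p - 1)] since
    [s (1 - p/n) = p (1 - alpha)]; hence the threshold [r = n/p]. *)

Section ereal_hoelder.

(** * Hölder's inequality for nonnegative extended-valued functions *)

Local Open Scope ereal_scope.
Context d (T : measurableType d) (R : realType) (mu : {measure set T -> \bar R}).
Implicit Types f g : T -> \bar R.

Lemma lee_poweR (x y : \bar R) (a : R) :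
  (0 <= a)%R -> 0 <= x -> x <= y -> x `^ a <= y `^ a.
Proof.
move=> a0 x0 xy; apply: gt0_ler_poweR => //; rewrite in_itv/= leey andbT//.
exact: le_trans xy.
Qed.

(** Young's inequality for [x / A] and [y / B]. The free scales will be the integrals of the two
    functions, which normalises both to integral one. *)
Lemma young_poweR (x y : \bar R) (a b A B : R) : 0 <= x -> 0 <= y ->
  (0 < a)%R -> (0 < b)%R -> (a + b = 1)%R -> (0 < A)%R -> (0 < B)%R ->
  x `^ a * y `^ b <=
  (A `^ a * B `^ b)%:E * ((a / A)%:E * x + (b / B)%:E * y).
Proof.
move=> x0 y0 a0 b0 ab A0 B0.
have AB0 : (0 < A `^ a * B `^ b)%R by rewrite mulr_gt0// powR_gt0.
case: x x0 => [x x0|_|//]; last first.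
  rewrite gt0_muley ?lte_fin ?divr_gt0// addye; last first.
    by rewrite gt_eqF// (@lt_le_trans _ _ 0)// mule_ge0// lee_fin divr_ge0// ltW.
  by rewrite gt0_muley ?lte_fin// leey.
case: y y0 => [y y0|_|//]; last first.
  rewrite gt0_muley ?lte_fin ?divr_gt0// addey//.
  by rewrite gt0_muley ?lte_fin// leey.
rewrite !lee_fin in x0 y0.
rewrite !poweR_EFin -!EFinM lee_fin.
have -> : (x `^ a * y `^ b = (A `^ a * B `^ b) * ((x / A) `^ a * (y / B) `^ b))%R.
  rewrite mulrACA -!powRM ?divr_ge0// ?ltW//.
  by rewrite [(A * _)%R]mulrC divfK ?gt_eqF// [(B * _)%R]mulrC divfK ?gt_eqF.
rewrite ler_pM2l//.
have xA : (0 <= x / A)%R by rewrite divr_ge0// ltW.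
have yB : (0 <= y / B)%R by rewrite divr_ge0// ltW.
have := @conjugate_powR R ((x / A) `^ a)%R ((y / B) `^ b)%R a^-1%R b^-1%R
  (powR_ge0 _ _) (powR_ge0 _ _).
rewrite !invr_gt0 !invrK => /(_ a0 b0 ab).
rewrite -!powRrM !mulfV ?gt_eqF// !powRr1// => /le_trans; apply.
by rewrite le_eqVlt; apply/orP; left; apply/eqP; ring.
Qed.

Lemma integral_eq0_mul_poweR f g (a b : R) :
  measurable_fun setT f -> measurable_fun setT g ->
  (forall x, 0 <= f x) -> (0 < a)%R -> \int[mu]_x f x = 0 ->
  \int[mu]_x (f x `^ a * g x `^ b) = 0.
Proof.
move=> mf mg f0 a0 i0.
rewrite (ae_eq_integral (cst 0))//; first by rewrite integral0.
  apply: emeasurable_funM.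
    exact: (measurableT_comp (measurable_poweR _) mf).
  exact: (measurableT_comp (measurable_poweR _) mg).
have /(ae_eq_integral_abs mu measurableT mf) : \int[mu]_x `|f x| = 0.
  by rewrite -[RHS]i0; apply: eq_integral => x _; rewrite gee0_abs.
by apply: filterS => x /= /[apply] ->; rewrite poweR0r ?gt_eqF// mul0e.
Qed.

(** A vanishing integral kills the left side; if both are nonzero and one is infinite, so is the
    right side; otherwise [young_poweR] with the two integrals as scales integrates to the factor
    [a + b = 1]. *)
Lemma ge0_hoelder f g (a b : R) :
  measurable_fun setT f -> measurable_fun setT g ->
  (forall x, 0 <= f x) -> (forall x, 0 <= g x) ->
  (0 < a)%R -> (0 < b)%R -> (a + b = 1)%R ->
  \int[mu]_x (f x `^ a * g x `^ b) <=
  (\int[mu]_x f x) `^ a * (\int[mu]_x g x) `^ b.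
Proof.
move=> mf mg f0 g0 a0 b0 ab.
have [i0|i0] := eqVneq (\int[mu]_x f x) 0.
  by rewrite integral_eq0_mul_poweR// i0 poweR0r ?gt_eqF// mul0e.
have [j0|j0] := eqVneq (\int[mu]_x g x) 0.
  under eq_integral do rewrite muleC.
  by rewrite integral_eq0_mul_poweR// j0 poweR0r ?gt_eqF// mule0.
have ip : 0 < \int[mu]_x f x by rewrite lt0e i0 integral_ge0.
have jp : 0 < \int[mu]_x g x by rewrite lt0e j0 integral_ge0.
have [ioo|ioo] := eqVneq (\int[mu]_x f x) +oo.
  by rewrite ioo poweRyr ?gt_eqF// gt0_mulye ?leey// poweR_gt0.
have [joo|joo] := eqVneq (\int[mu]_x g x) +oo.
  by rewrite joo poweRyr ?gt_eqF// gt0_muley ?leey// poweR_gt0.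
set I := \int[mu]_x f x in ip ioo *; set J := \int[mu]_x g x in jp joo *.
have Ifin : I \is a fin_num by rewrite gt0_fin_numE// ltey.
have Jfin : J \is a fin_num by rewrite gt0_fin_numE// ltey.
have A0 : (0 < fine I)%R by rewrite fine_gt0// ip ltey.
have B0 : (0 < fine J)%R by rewrite fine_gt0// jp ltey.
pose c := (fine I `^ a * fine J `^ b)%R.
have mc (k : R) (h : T -> \bar R) : measurable_fun setT h -> measurable_fun setT (fun x => k%:E * h x).
  by move=> mh; exact: emeasurable_funM.
have ca : (0 <= a / fine I)%R by rewrite divr_ge0// ltW.
have cb : (0 <= b / fine J)%R by rewrite divr_ge0// ltW.
apply: (@le_trans _ _ (\int[mu]_x (c%:E *
    ((a / fine I)%:E * f x + (b / fine J)%:E * g x)))).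
  apply: ge0_le_integral => //.
  - by move=> x _; rewrite mule_ge0// poweR_ge0.
  - apply: emeasurable_funM.
      exact: (measurableT_comp (measurable_poweR _) mf).
    exact: (measurableT_comp (measurable_poweR _) mg).
  - by apply: (mc); apply: emeasurable_funD; apply: (mc).
  - by move=> x _; exact: young_poweR.
rewrite ge0_integralZl//; last 3 first.
- by apply: emeasurable_funD; apply: (mc).
- by move=> x _; rewrite adde_ge0// mule_ge0.
- by rewrite lee_fin mulr_ge0// powR_ge0.
rewrite ge0_integralD//; last 4 first.
- by move=> x _; rewrite mule_ge0.
- by apply: (mc).
- by move=> x _; rewrite mule_ge0.
- by apply: (mc).
rewrite !ge0_integralZl// -/I -/J -(fineK Ifin) -(fineK Jfin) -!EFinM.
rewrite !divfK ?gt_eqF// ab mulr1.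
by rewrite le_eqVlt /c eqxx.
Qed.

Lemma emeasurable_prod n (f : 'I_n -> T -> \bar R) :
  (forall i, measurable_fun setT (f i)) ->
  measurable_fun setT (fun x => \prod_(i < n) f i x).
Proof.
elim: n f => [|n IHn] f mf.
  by under eq_fun do rewrite big_ord0; exact: measurable_cst.
under eq_fun do rewrite big_ord_recr/=.
by apply: emeasurable_funM => //; exact: IHn.
Qed.

Lemma poweR_prod n (f : 'I_n -> \bar R) (a : R) : (forall i, 0 <= f i) ->
  (\prod_(i < n) f i) `^ a = \prod_(i < n) f i `^ a.
Proof.
move=> f0; apply: (proj2 (A := 0 <= \prod_(i < n) f i) _).
apply: (big_ind2 (fun y z => 0 <= y /\ y `^ a = z)).
- by rewrite poweR1r.
- move=> y1 z1 y2 z2 [z10 <-] [z20 <-]; split; first exact: mule_ge0.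
  by rewrite poweRM.
- by [].
Qed.

(** Two-factor Hölder splits off the last function with weight [1 / (n + 2)]. The other factors
    together are the power [(n + 1) / (n + 2)] of the product in the induction hypothesis. *)
Lemma ge0_hoelder_prod n (f : 'I_n.+1 -> T -> \bar R) :
  (forall i, measurable_fun setT (f i)) -> (forall i x, 0 <= f i x) ->
  \int[mu]_x (\prod_(i < n.+1) f i x `^ n.+1%:R^-1) <=
  \prod_(i < n.+1) (\int[mu]_x f i x) `^ n.+1%:R^-1.
Proof.
elim: n f => [|n IHn] f mf f0.
  rewrite big_ord_recl big_ord0 invr1 mule1 poweRe1 ?integral_ge0//.
  by under eq_integral do rewrite big_ord_recl big_ord0 mule1 poweRe1//.
pose N := n.+1%:R : R; pose a := (N / n.+2%:R)%R : R.
have N0 : (0 < N)%R by rewrite ltr0n.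
have N2 : n.+2%:R = (N + 1)%R :> R by rewrite /N natr1.
have aE : (n.+2%:R^-1 = N^-1 * a)%R.
  by rewrite /a mulrA mulVf ?gt_eqF// mul1r.
have a0 : (0 < a)%R by rewrite divr_gt0// ltr0n.
have prodE (h : 'I_n.+1 -> \bar R) :
    \prod_(i < n.+1) h i `^ n.+2%:R^-1 = (\prod_(i < n.+1) h i `^ N^-1) `^ a.
  rewrite poweR_prod => [|i]; last exact: poweR_ge0.
  by apply: eq_bigr => i _; rewrite aE poweRrM.
have mprod : measurable_fun setT
    (fun x => \prod_(i < n.+1) f (widen_ord (leqnSn _) i) x `^ N^-1).
  apply: emeasurable_prod => i.
  by apply: (measurableT_comp (measurable_poweR _)).
under eq_integral do rewrite big_ord_recr/= prodE.
rewrite big_ord_recr/= prodE.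
apply: (le_trans (ge0_hoelder _ (mf ord_max) _ (f0 ord_max) a0 _ _)) => //.
- move=> x; apply: prode_ge0 => i _; exact: poweR_ge0.
- by rewrite /a -[X in (_ + X)%R]mul1r -mulrDl -N2 mulfV// pnatr_eq0.
apply: lee_wpmul2r; first exact: poweR_ge0.
apply: lee_poweR; [exact: ltW| |exact: IHn].
by apply: integral_ge0 => x _; apply: prode_ge0 => i _; exact: poweR_ge0.
Qed.
End ereal_hoelder.

(** * Tonelli on [R^n] and the slicing induction *)

Section sigma_finite_alias.
Context d (T : measurableType d) (R : realType).

(** A copy of [m] carrying its proof of sigma-finiteness as a structure. The recursively defined
    [borel_lebesgue] has only the proof, while Tonelli asks for the structure. *)
Definition sigma_finite_alias (m : {measure set T -> \bar R})
  (sm : sigma_finite setT m) : set T -> \bar R := m.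

Context (m : {measure set T -> \bar R}) (sm : sigma_finite setT m).

HB.instance Definition _ := Measure.copy (sigma_finite_alias sm) m.
HB.instance Definition _ :=
  Measure_isSigmaFinite.Build _ _ _ (sigma_finite_alias sm) sm.

End sigma_finite_alias.

Lemma sigma_finite_tonelli1 d1 d2 (T1 : measurableType d1) (T2 : measurableType d2)
    (R : realType) (m1 : {measure set T1 -> \bar R})
    (m2 : {sigma_finite_measure set T2 -> \bar R}) (f : T1 * T2 -> \bar R) :
  sigma_finite setT m1 -> measurable_fun setT f -> (forall z, 0 <= f z)%E ->
  (\int[m1 \x m2]_z f z = \int[m1]_x \int[m2]_y f (x, y))%E.
Proof.
by move=> sm1 mf f0; exact: (fubini_tonelli1 (m1 := sigma_finite_alias sm1) f).
Qed.

Section borel_rV_facts.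
Context {R : realType}.
Local Notation leb1 := (@lebesgue_measure R).

Lemma measurable_fun_rV d (T : measurableType d) n (g : T -> borel_rV R n) :
  (forall i, measurable_fun setT
    (fun x => (g x : 'rV[R]_n) ord0 i : measurableTypeR R)) ->
  measurable_fun setT g.
Proof.
move=> mg _ Y mY; rewrite setTI.
pose c (i : 'I_n) (x : 'rV[R]_n) : measurableTypeR R := x ord0 i.
have : preimage_set_system setT g (g_sigma_preimage c) (g @^-1` Y).
  by exists Y => //; rewrite setTI.
rewrite -(g_sigma_preimage_comp c g).
move: (g @^-1` Y); apply: smallest_sub.
  exact: sigma_algebra_measurable.
rewrite -bigcup_seq; apply: bigcup_sub => i _ A [B mB <-].
by rewrite setTI -[X in measurable X]setTI; exact: mg.
Qed.

(** The line through [x] parallel to the [i]-th axis, parametrised by the coordinate itself rather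
    than by a displacement, so that integrals over [t] do not depend on the [i]-th coordinate of
    [x]. *)
Definition subst_coord n (x : 'rV[R]_n) (i : 'I_n) (t : R) : 'rV[R]_n :=
  \row_k if k == i then t else x ord0 k.

Lemma measurable_subst_coord n (i : 'I_n) :
  measurable_fun setT (fun z : borel_rV R n * measurableTypeR R =>
    subst_coord (z.1 : 'rV[R]_n) i z.2 : borel_rV R n).
Proof.
apply: measurable_fun_rV => k.
have [->|ki] := eqVneq k i.
  rewrite (_ : (fun _ => _) = snd); first exact: measurable_snd.
  by apply/funext => z; rewrite mxE eqxx.
rewrite (_ : (fun _ => _) =
    (fun x : borel_rV R n => (x : 'rV[R]_n) ord0 k : measurableTypeR R) \o fst).
  exact: measurableT_comp (measurable_coord_rV k) measurable_fst.
by apply/funext => z; rewrite /= mxE (negbTE ki).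
Qed.

Lemma subst_coord_rcons_max n (x : 'rV[R]_n) (y t : R) :
  subst_coord (rcons_rV (x, y)) ord_max t = rcons_rV (x, t).
Proof.
apply/rowP => k; rewrite !mxE; case: unliftP => [l ->|->] /=.
  by rewrite eq_sym (negbTE (neq_lift _ _)).
by rewrite eqxx.
Qed.

Lemma subst_coord_rcons_lift n (x : 'rV[R]_n) (i : 'I_n) (y t : R) :
  subst_coord (rcons_rV (x, y)) (lift ord_max i) t =
  rcons_rV (subst_coord x i t, y).
Proof.
apply/rowP => k; rewrite !mxE; case: (unliftP ord_max k) => [l ->|->] /=.
  by rewrite (inj_eq lift_inj) mxE.
by rewrite (negbTE (neq_lift _ _)).
Qed.

Lemma sigma_finite_borel_lebesgue n : sigma_finite setT (borel_lebesgue R n).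
Proof.
pose A k : set (measurableTypeR R) := `[- k%:R, k%:R]%classic.
exists (fun k => [set x | forall i : 'I_n, A k ((x : 'rV[R]_n) ord0 i)]).
  apply/esym/seteqP; split=> // x _.
  exists (Num.truncn (\sum_(i < n) `|(x : 'rV[R]_n) ord0 i|)).+1 => //= i.
  rewrite /A/= in_itv/= -ler_norml (le_trans _ (ltW (truncnS_gt _)))//.
  by rewrite (bigD1 i)//= lerDl sumr_ge0.
move=> k; split; first by apply: (measurable_rect (A := fun=> A k)) => i; exact: measurable_itv.
rewrite (borel_lebesgue_rect (A := fun=> A k)); last first.
  by move=> i; exact: measurable_itv.
suff: ((0 : \bar R) <= \prod_(i < n) leb1 (A k) < +oo)%E by case/andP.
apply: (big_ind (fun y : \bar R => 0 <= y < +oo)%E) => [|x y|i _].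
- by rewrite lee01 ltry.
- move=> /andP[x0 xoo] /andP[y0 yoo]; rewrite mule_ge0//=.
  by rewrite lte_mul_pinfty// ge0_fin_numE.
- by rewrite measure_ge0/= lebesgue_measure_itv/=; case: ifP => _; rewrite ltry.
Qed.

Lemma ge0_integral_borel_lebesgueS n (f : borel_rV R n.+1 -> \bar R) :
  measurable_fun setT f -> (forall x, 0 <= f x)%E ->
  (\int[borel_lebesgue R n.+1]_x f x =
   \int[borel_lebesgue R n]_x \int[leb1]_t f (rcons_rV (x, t)))%E.
Proof.
move=> mf f0.
transitivity (\int[pushforward (borel_lebesgue R n \x leb1)%E (@rcons_rV R n)]_x f x)%E => //.
rewrite (ge0_integral_pushforward (@measurable_rcons_rV R n))// preimage_setT.
pose F (z : borel_rV R n * measurableTypeR R) := f (rcons_rV z).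
apply: (sigma_finite_tonelli1 leb1 (m1 := borel_lebesgue R n) (f := F)).
  exact: sigma_finite_borel_lebesgue.
  exact: measurableT_comp mf (@measurable_rcons_rV R n).
by move=> z; exact: f0.
Qed.

Lemma measurable_int_subst_coord n (i : 'I_n) (f : borel_rV R n -> \bar R) :
  measurable_fun setT f -> (forall x, 0 <= f x)%E ->
  measurable_fun setT
    (fun x : borel_rV R n => \int[leb1]_t f (subst_coord x i t))%E.
Proof.
move=> mf f0.
pose F (z : borel_rV R n * measurableTypeR R) :=
  f (subst_coord (z.1 : 'rV[R]_n) i z.2).
apply: (measurable_fun_fubini_tonelli_F (m2 := leb1) F).
  exact: measurableT_comp mf (measurable_subst_coord i).
by move=> z; exact: f0.
Qed.

Lemma measurable_int_rcons n (f : borel_rV R n.+1 -> \bar R) :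
  measurable_fun setT f -> (forall x, 0 <= f x)%E ->
  measurable_fun setT
    (fun x : borel_rV R n => \int[leb1]_t f (rcons_rV (x, t)))%E.
Proof.
move=> mf f0.
pose F (z : borel_rV R n * measurableTypeR R) := f (rcons_rV z).
apply: (measurable_fun_fubini_tonelli_F (m2 := leb1) F).
  exact: measurableT_comp mf (@measurable_rcons_rV R n).
by move=> z; exact: f0.
Qed.

Lemma measurable_rcons_r n (x : borel_rV R n) :
  measurable_fun setT (fun t : measurableTypeR R => rcons_rV (x, t) : borel_rV R n.+1).
Proof.
exact: measurableT_comp (@measurable_rcons_rV R n) (measurable_pair1 _).
Qed.

Lemma measurable_subst_coord_r n (i : 'I_n) (x : borel_rV R n) :
  measurable_fun setT (fun t : measurableTypeR R => subst_coord x i t : borel_rV R n).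
Proof.
exact: measurableT_comp (measurable_subst_coord i) (measurable_pair1 x).
Qed.

(** Tonelli in the plane of the coordinate [i] and the last one; it lets line integrals commute with
    the integration that an induction on the dimension peels off. *)
Lemma int_rcons_subst_coord n (i : 'I_n) (f : borel_rV R n.+1 -> \bar R)
    (x : borel_rV R n) :
  measurable_fun setT f -> (forall x, 0 <= f x)%E ->
  (\int[leb1]_y \int[leb1]_t f (subst_coord (rcons_rV (x, y)) (lift ord_max i) t) =
   \int[leb1]_t \int[leb1]_y f (rcons_rV (subst_coord x i t, y)))%E.
Proof.
move=> mf f0.
pose F (z : measurableTypeR R * measurableTypeR R) :=
  f (rcons_rV (subst_coord x i z.1, z.2)).
transitivity (\int[leb1]_y \int[leb1]_t F (t, y))%E.
  by apply: eq_integral => y _; apply: eq_integral => t _; rewrite subst_coord_rcons_lift.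
apply/esym/(fubini_tonelli (m1 := leb1) (m2 := leb1) F) => [|z]; last exact: f0.
apply: measurableT_comp mf _.
apply: measurableT_comp (@measurable_rcons_rV R n) _.
apply: measurable_fun_pair => /=; last exact: measurable_snd.
exact: measurableT_comp (measurable_subst_coord_r i x) measurable_fst.
Qed.

(* For h = w^(n/(n-1)) and w <= int f_i dx_i this is the Gagliardo-Nirenberg
   inequality; the free factor h makes the induction on n close. *)
Lemma loomis_whitney n (h : borel_rV R n.+1 -> \bar R)
    (f : 'I_n.+1 -> borel_rV R n.+1 -> \bar R) :
  measurable_fun setT h -> (forall i, measurable_fun setT (f i)) ->
  (forall x, 0 <= h x)%E -> (forall i x, 0 <= f i x)%E ->
  (\int[borel_lebesgue R n.+1]_x (h x `^ n.+1%:R^-1 *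
     \prod_(i < n.+1) (\int[leb1]_t f i (subst_coord x i t)) `^ n.+1%:R^-1) <=
   (\int[borel_lebesgue R n.+1]_x h x) `^ n.+1%:R^-1 *
   \prod_(i < n.+1) (\int[borel_lebesgue R n.+1]_x f i x) `^ n.+1%:R^-1)%E.
Proof.
elim: n h f => [|n IHn] h f mh mf h0 f0.
  rewrite big_ord_recl big_ord0 invr1 mule1 !poweRe1 ?integral_ge0//.
  have F0 x : (\int[leb1]_t f ord0 (subst_coord x ord0 t) =
      \int[borel_lebesgue R 1]_x f ord0 x)%E.
    rewrite ge0_integral_borel_lebesgueS//= integral_dirac//; last first.
      exact: (measurable_int_rcons (f := f ord0)).
    rewrite diracT mul1e; apply: eq_integral => t _; congr (f ord0 _).
    apply/rowP => k; rewrite !mxE ord1 eqxx.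
    by rewrite (_ : 0 = ord_max) ?unlift_none//; exact: val_inj.
  under eq_integral do rewrite big_ord_recl big_ord0 mule1 F0 !poweRe1 ?integral_ge0//.
  by rewrite ge0_integralZr// integral_ge0.
set N := n.+2; pose c := N%:R^-1 : R.
have c0 : 0 < c by rewrite invr_gt0 ltr0n.
have c'0 : 0 < n.+1%:R * c by rewrite mulr_gt0// ltr0n.
have cE : n.+1%:R^-1 * (n.+1%:R * c) = c by rewrite mulrA mulVf ?mul1r// pnatr_eq0.
pose K x := (\int[leb1]_t f ord_max (rcons_rV (x : borel_rV R n.+1, t)))%E.
pose H x := (\int[leb1]_t h (rcons_rV (x : borel_rV R n.+1, t)))%E.
pose f' (k : 'I_n.+1) x :=
  (\int[leb1]_t f (lift ord_max k) (rcons_rV (x : borel_rV R n.+1, t)))%E.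
pose F' (k : 'I_n.+1) (x : borel_rV R n.+1) := (\int[leb1]_t f' k (subst_coord x k t))%E.
have mK : measurable_fun setT K by exact: measurable_int_rcons.
have mH : measurable_fun setT H by exact: measurable_int_rcons.
have mf' k : measurable_fun setT (f' k) by exact: measurable_int_rcons.
have K0 x : (0 <= K x)%E by exact: integral_ge0.
have H0 x : (0 <= H x)%E by exact: integral_ge0.
have f'0 k x : (0 <= f' k x)%E by exact: integral_ge0.
have mF' k : measurable_fun setT (F' k) by exact: measurable_int_subst_coord.
have F'0 k x : (0 <= F' k x)%E by exact: integral_ge0.
pose F i (x : borel_rV R N) := (\int[leb1]_t f i (subst_coord x i t))%E.
have mF i : measurable_fun setT (F i) by exact: measurable_int_subst_coord.
have F0 i x : (0 <= F i x)%E by exact: integral_ge0.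
have mp (g : 'I_N -> \bar R) : (\prod_(i < N) g i =
    (\prod_(i < n.+1) g (lift ord_max i)) * g ord_max)%E.
  rewrite big_ord_recr/=; congr (_ * _)%E; apply: eq_bigr => i _; congr g.
  by apply/val_inj; rewrite /= /bump leqNgt ltn_ord.
have mpoweR d (T : measurableType d) (g : T -> \bar R) e : measurable_fun setT g ->
    measurable_fun setT (fun x => g x `^ e)%E.
  by move=> mg; exact: (measurableT_comp (measurable_poweR _) mg).
have mG : measurable_fun setT (fun x => h x `^ c * \prod_(i < N) F i x `^ c)%E.
  apply: emeasurable_funM; first exact: mpoweR.
  by apply: emeasurable_prod => i; exact: mpoweR.
rewrite ge0_integral_borel_lebesgueS//; last first.
  by move=> x; rewrite mule_ge0 ?poweR_ge0 ?prode_ge0// => i _; exact: poweR_ge0.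
(* This is the integrand of the induction hypothesis, with [K] as the free factor and [f'] as the
   family. Hölder along the last coordinate brings out [P], and a second Hölder in the other
   variables, with weights [1 / (n + 2)] and [(n + 1) / (n + 2)], isolates its integral. *)
pose P x := (K x `^ n.+1%:R^-1 * \prod_(k < n.+1) F' k x `^ n.+1%:R^-1)%E.
have P0 x : (0 <= P x)%E.
  by rewrite mule_ge0 ?poweR_ge0 ?prode_ge0// => i _; exact: poweR_ge0.
have mP : measurable_fun setT P.
  apply: emeasurable_funM; first exact: mpoweR.
  by apply: emeasurable_prod => i; exact: mpoweR.
apply: (@le_trans _ _ (\int[borel_lebesgue R n.+1]_x
    (H x `^ c * P x `^ (n.+1%:R * c)))%E).
  apply: ge0_le_integral => //.
  - move=> x _; apply: integral_ge0 => t _.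
    by rewrite mule_ge0 ?poweR_ge0 ?prode_ge0// => i _; exact: poweR_ge0.
  - apply: (measurable_int_rcons mG) => x.
    by rewrite mule_ge0 ?poweR_ge0 ?prode_ge0// => i _; exact: poweR_ge0.
  - by apply: emeasurable_funM; exact: mpoweR.
  move=> x _.
  (* Along a slice the last line integral is the constant [K x] and leaves the integral; [h] takes
     the free slot [ord_max], so that again exactly [n + 2] factors enter [ge0_hoelder_prod]. *)
  pose g (i : 'I_N) (y : R) := if unlift ord_max i is Some k
    then F (lift ord_max k) (rcons_rV (x, y)) else h (rcons_rV (x, y)).
  have mg i : measurable_fun setT (g i : measurableTypeR R -> \bar R).
    rewrite /g; case: unliftP => [k _|_].
      exact: measurableT_comp (mF _) (measurable_rcons_r x).
    exact: measurableT_comp mh (measurable_rcons_r x).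
  have g0 i y : (0 <= g i y)%E by rewrite /g; case: unliftP.
  have KE t : F ord_max (rcons_rV (x, t)) = K x.
    by apply: eq_integral => s _; rewrite subst_coord_rcons_max.
  rewrite (_ : (\int[leb1]_t _)%E =
      (\int[leb1]_t (K x `^ c * \prod_(i < N) g i t `^ c))%E); last first.
    apply: eq_integral => t _.
    rewrite -[LHS]/(h (rcons_rV (x, t)) `^ c * \prod_(i < N) F i (rcons_rV (x, t)) `^ c)%E.
    rewrite !mp KE /g unlift_none.
    under [in RHS]eq_bigr do rewrite liftK.
    by rewrite muleA muleC; congr (_ * _)%E; rewrite muleC.
  rewrite ge0_integralZl ?poweR_ge0//; last 2 first.
    by apply: emeasurable_prod => i; exact: mpoweR.
    by move=> t _; apply: prode_ge0 => i _; exact: poweR_ge0.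
  apply: (@le_trans _ _ (K x `^ c * \prod_(i < N) (\int[leb1]_t g i t) `^ c)%E).
    by apply: lee_wpmul2l; [exact: poweR_ge0|exact: ge0_hoelder_prod].
  rewrite mp {2}/g; under eq_integral do rewrite unlift_none.
  rewrite -/(H x) poweRM ?poweR_ge0 ?prode_ge0//; last by move=> i _; exact: poweR_ge0.
  rewrite -poweRrM cE poweR_prod; last by move=> i; exact: poweR_ge0.
  rewrite muleA [leRHS]muleC le_eqVlt; apply/orP; left; apply/eqP.
  congr (_ * _ * _)%E; apply: eq_bigr => k _; rewrite -poweRrM cE; congr (_ `^ _)%E.
  under eq_integral do rewrite /g liftK.
  exact: int_rcons_subst_coord.
apply: (le_trans (ge0_hoelder _ mH mP H0 P0 c0 c'0 _)).
  by rewrite -[X in X + _]mul1r -mulrDl nat1r mulfV// pnatr_eq0.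
rewrite -ge0_integral_borel_lebesgueS//.
apply: lee_wpmul2l; first exact: poweR_ge0.
apply: (@le_trans _ _ (((\int[borel_lebesgue R n.+1]_x K x) `^ n.+1%:R^-1 *
   \prod_(k < n.+1) (\int[borel_lebesgue R n.+1]_x f' k x) `^ n.+1%:R^-1)
   `^ (n.+1%:R * c))%E).
  apply: lee_poweR; [exact: ltW| |exact: IHn].
  by apply: integral_ge0 => x _; exact: P0.
rewrite poweRM ?poweR_ge0 ?prode_ge0//; last by move=> i _; exact: poweR_ge0.
rewrite -poweRrM cE poweR_prod; last by move=> i; exact: poweR_ge0.
rewrite mp muleC le_eqVlt; apply/orP; left; apply/eqP; congr (_ * _)%E.
  apply: eq_bigr => k _; rewrite -poweRrM cE; congr (_ `^ _)%E.
  by rewrite [RHS]ge0_integral_borel_lebesgueS.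
by congr (_ `^ _)%E; rewrite [RHS]ge0_integral_borel_lebesgueS.
Qed.

End borel_rV_facts.

(** * The Gagliardo-Nirenberg inequality, and the passage from Borel to Lebesgue *)

Section borel_rV_facts2.
Context {R : realType}.
Local Notation leb1 := (@lebesgue_measure R).

(** The measure is built by appending a last coordinate, so a general direction [i] is reached by
    induction: either it is the last one, or the last one is integrated out first. Applied to the
    positive and negative parts of a derivative, this spares a Fubini theorem for signed
    functions. *)
Lemma ge0_integral_eq_slices n (i : 'I_n) (f g : borel_rV R n -> \bar R) :
  measurable_fun setT f -> measurable_fun setT g ->
  (forall x, 0 <= f x)%E -> (forall x, 0 <= g x)%E ->
  (forall x, \int[leb1]_t f (subst_coord x i t) =
             \int[leb1]_t g (subst_coord x i t))%E ->
  (\int[borel_lebesgue R n]_x f x = \int[borel_lebesgue R n]_x g x)%E.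
Proof.
elim: n i f g => [[]//|n IHn] i f g mf mg f0 g0 fg.
rewrite !ge0_integral_borel_lebesgueS//.
case: (unliftP ord_max i) fg => [k ->|->] fg.
  apply: (IHn k) => [| |x|x|x].
  - exact: measurable_int_rcons.
  - exact: measurable_int_rcons.
  - exact: integral_ge0.
  - exact: integral_ge0.
  - rewrite -!int_rcons_subst_coord//.
    by apply: eq_integral => y _; exact: fg.
apply: eq_integral => x _; have := fg (rcons_rV (x, 0)).
by under eq_integral do rewrite subst_coord_rcons_max;
  under [X in _ = X -> _]eq_integral do rewrite subst_coord_rcons_max.
Qed.

(** Division by [I ^ a], legitimate because [I] is finite; for [I = +oo] the premise could hold
    trivially. *)
Lemma poweR_cancel (I P : \bar R) (a b : R) : 0 < b -> a + b = 1 ->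
  (0 <= I -> I < +oo -> 0 <= P -> I <= I `^ a * P -> I `^ b <= P)%E.
Proof.
move=> b0 ab; case: I => [I||//]; last by rewrite ltxx.
rewrite lee_fin le_eqVlt => /predU1P[<-|I0] _ P0.
  by move=> _; rewrite poweR0r// gt_eqF.
have E : (I%:E = I%:E `^ a * I%:E `^ b)%E.
  rewrite !poweR_EFin -EFinM -powRD ?ab ?powRr1 ?(ltW I0)//.
  by rewrite (gt_eqF I0) implybT.
by rewrite {1}E lee_pmul2l// ?poweR_gt0// fin_num_poweR.
Qed.

(** With [N = n + 1] and [h = w ^ (N / n)], one has [h = h ^ (1 / N) * w], and [w] is the product of
    [N] copies of [w ^ (1 / N)], one for each line integral. [loomis_whitney] then bounds the
    integral of [h] by its own power [1 / N] times the product, and [poweR_cancel] absorbs that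
    power. *)
Lemma gagliardo_nirenberg n (w : borel_rV R n.+1 -> R)
    (f : 'I_n.+1 -> borel_rV R n.+1 -> \bar R) : (0 < n)%N ->
  measurable_fun setT w -> (forall i, measurable_fun setT (f i)) ->
  (forall x, 0 <= w x) -> (forall i x, 0 <= f i x)%E ->
  (forall i x, (w x)%:E <= \int[leb1]_t f i (subst_coord x i t))%E ->
  (\int[borel_lebesgue R n.+1]_x (w x `^ (n.+1%:R / n%:R))%:E < +oo)%E ->
  ((\int[borel_lebesgue R n.+1]_x (w x `^ (n.+1%:R / n%:R))%:E)
     `^ (n%:R / n.+1%:R) <=
   \prod_(i < n.+1) (\int[borel_lebesgue R n.+1]_x f i x) `^ n.+1%:R^-1)%E.
Proof.
move=> n0 mw mf w0 f0 wf.
set I := (\int[_]_x _)%E => Ioo.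
pose N := n.+1%:R : R; pose h x := (w x `^ (N / n%:R))%:E.
have N0 : 0 < N by rewrite ltr0n.
have nR0 : 0 < n%:R :> R by rewrite ltr0n.
have h0 x : (0 <= h x)%E by rewrite lee_fin powR_ge0.
have mh : measurable_fun setT h.
  apply/measurable_EFinP.
  exact: (measurableT_comp (measurable_powR _) mw).
have P0 : (0 <= \prod_(i < n.+1) (\int[borel_lebesgue R n.+1]_x f i x) `^ N^-1)%E.
  by apply: prode_ge0 => i _; exact: poweR_ge0.
have I0 : (0 <= I)%E by apply: integral_ge0 => x _; exact: h0.
have key : (I <= I `^ N^-1 *
    \prod_(i < n.+1) (\int[borel_lebesgue R n.+1]_x f i x) `^ N^-1)%E.
  apply: le_trans (loomis_whitney mh mf h0 f0).
  apply: ge0_le_integral => //.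
  - by move=> x _; exact: h0.
  - apply: emeasurable_funM.
      exact: (measurableT_comp (measurable_poweR _) mh).
    apply: emeasurable_prod => i.
    apply: (measurableT_comp (measurable_poweR _)).
    exact: measurable_int_subst_coord.
  - move=> x _.
    rewrite -/(h x) [leLHS](_ : _ = h x `^ N^-1 * \prod_(i < n.+1) (w x)%:E `^ N^-1)%E; last first.
      rewrite -(poweR_prod (f := fun=> (w x)%:E)); last by move=> i; rewrite lee_fin.
      rewrite /h prodEFin prodr_const card_ord -powR_mulrn//.
      have e1 : N / n%:R * N^-1 = n%:R^-1 by field; rewrite !gt_eqF.
      rewrite !poweR_EFin -!powRrM e1 mulfV ?gt_eqF//.
      rewrite -EFinM -powRD; last by rewrite gt_eqF// addr_gt0// invr_gt0.
      by congr ((_ `^ _)%:E); rewrite /N -natr1; field; rewrite gt_eqF.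
    apply: lee_wpmul2l; first exact: poweR_ge0.
    apply: (proj2 (A := 0 <= \prod_(i < n.+1) (w x)%:E `^ N^-1)%E _).
    apply: (big_ind2 (fun a b => 0 <= a /\ a <= b)%E) => [|a b a' b'|i _].
    - by rewrite lee01.
    - by move=> [a0 ab] [b0 ab']; rewrite mule_ge0// lee_pmul.
    - rewrite poweR_ge0; split=> //; apply: lee_poweR; last exact: wf.
        by rewrite invr_ge0 ltW.
      by rewrite lee_fin.
apply: (poweR_cancel _ _ I0 Ioo P0 key); first by rewrite divr_gt0.
by rewrite /N -natr1; field; rewrite natr1 pnatr_eq0.
Qed.

(** The sigma-algebra is generated by coordinates and the topology by the sup norm. They meet in
    half-open lattice cubes of side [1 / (k + 1)]: an open set is the union of the countably many
    that it contains. *)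
Lemma open_measurable_rV n (U : set 'rV[R]_n) :
  open U -> measurable (U : set (borel_rV R n)).
Proof.
move=> oU.
pose Q (k : nat) (z : {ffun 'I_n -> int}) : set 'rV[R]_n :=
  [set x | forall i, `[(z i)%:~R / k.+1%:R, (z i + 1)%:~R / k.+1%:R[%classic (x ord0 i)].
have -> : U = \bigcup_(kz : nat * {ffun 'I_n -> int})
    (if `[< Q kz.1 kz.2 `<=` U >] then Q kz.1 kz.2 else set0).
  apply/seteqP; split=> [x Ux|x [[k z] _ /=]]; last by case: asboolP => // + Qx; exact.
  have [e /= e0 eU] : nbhs_ball x U by apply/nbhs_ballP; exact: open_nbhs_nbhs.
  have [k ke] : exists k, k.+1%:R^-1 < e.
    have /filter_ex[k] := near_infty_natSinv_lt (PosNum e0).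
    by exists k.
  have k0 : 0 < k.+1%:R :> R by rewrite ltr0n.
  pose z := [ffun i : 'I_n => Num.floor (x ord0 i * k.+1%:R)].
  exists (k, z) => //=; rewrite asboolT.
    move=> i; rewrite /= in_itv/= ffunE.
    by rewrite ler_pdivrMr// ltr_pdivlMr// floor_le floorD1_gt.
  move=> y Qy; apply: eU; split=> // i1 i; rewrite (ord1 i1) /ball/= (lt_trans _ ke)//.
  have /= := Qy i; rewrite in_itv/= ffunE => /andP[y1 y2].
  have x1 := floor_le (x ord0 i * k.+1%:R); have x2 := floorD1_gt (x ord0 i * k.+1%:R).
  rewrite ler_pdivrMr// in y1; rewrite ltr_pdivlMr// in y2.
  rewrite -(ltr_pM2r k0) mulVf ?gt_eqF// -[X in _ * X]gtr0_norm// -normrM.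
  rewrite ltr_norml mulrBl; rewrite intrD in x2 y2; lra.
apply: countable_bigcupT_measurable; first exact: countableP.
move=> -[k z] /=; case: ifPn => _; last exact: measurable0.
apply: (measurable_rect (A := fun i =>
  `[(z i)%:~R / k.+1%:R, (z i + 1)%:~R / k.+1%:R[%classic)) => i.
exact: measurable_itv.
Qed.

Lemma continuous_measurable_rV n (phi : 'rV[R]_n -> R) :
  continuous phi -> measurable_fun setT (phi : borel_rV R n -> R).
Proof.
move=> cphi; apply: (measurability _ (RGenOInfty.measurableE R)).
move=> _ [_ [a ->] <-]; rewrite setTI; apply: open_measurable_rV.
by apply: open_comp => //; exact: interval_open.
Qed.

Lemma measurable_lebesgue_rV n (A : set 'rV[R]_n) :
  measurable (A : set (borel_rV R n)) -> measurable (A : set (lebesgue_rV R n)).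
Proof. exact: caratheodory_measurable_mu_ext. Qed.

Lemma leb_borelE n (A : set 'rV[R]_n) :
  measurable (A : set (borel_rV R n)) ->
  leb (A : set (lebesgue_rV R n)) = borel_lebesgue R n A.
Proof. exact: measurable_mu_extE. Qed.

Lemma measurable_fun_lebesgue_rV n d (T : measurableType d) (f : 'rV[R]_n -> T) :
  measurable_fun setT (f : borel_rV R n -> T) ->
  measurable_fun setT (f : lebesgue_rV R n -> T).
Proof.
move=> mf _ Y mY; rewrite setTI; apply: measurable_lebesgue_rV.
by rewrite -[X in measurable X]setTI; exact: mf.
Qed.

(** The theorem lives on the completed measure [leb], Tonelli on [borel_lebesgue]. The latter is the
    image of the former under the identity, which transfers integrals of Borel functions. *)
Lemma ge0_integral_leb n (f : 'rV[R]_n -> \bar R) :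
  measurable_fun setT (f : borel_rV R n -> \bar R) -> (forall x, 0 <= f x)%E ->
  (\int[@leb R n]_x f x = \int[borel_lebesgue R n]_x f x)%E.
Proof.
move=> mf f0.
have mid : measurable_fun setT (idfun : lebesgue_rV R n -> borel_rV R n).
  by move=> _ Y mY; rewrite setTI; exact: measurable_lebesgue_rV.
transitivity (\int[pushforward (@leb R n) (idfun : _ -> borel_rV R n)]_x f x)%E.
  by rewrite (ge0_integral_pushforward mid).
by apply: eq_measure_integral => A mA _; exact: leb_borelE.
Qed.

End borel_rV_facts2.

(** * One-variable calculus: signed powers and the fundamental theorem *)

Section real_calculus.
Context {R : realType}.
Implicit Types (g : R -> R) (M : R).
Local Notation leb1 := (@lebesgue_measure R).

(** The odd continuation of the power: [c * spow (c - 1)] is the derivative of [|s| ^ c] for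
    [c > 1], including at [s = 0]. *)
Definition spow (d s : R) : R := Num.sg s * `|s| `^ d.

Lemma spowN d s : spow d (- s) = - spow d s.
Proof. by rewrite /spow sgrN normrN mulNr. Qed.

Lemma normr_spow d s : 0 < d -> `|spow d s| = `|s| `^ d.
Proof.
move=> d0; rewrite /spow normrM (ger0_norm (powR_ge0 _ _)) normr_sg.
have [->|s0] := eqVneq s 0; last by rewrite mul1r.
by rewrite normr0 powR0 ?gt_eqF// mulr0.
Qed.

Lemma spow_gt0 d s : 0 < s -> spow d s = s `^ d.
Proof. by move=> s0; rewrite /spow gtr0_sg// mul1r gtr0_norm. Qed.

Lemma continuous_spow d : 0 < d -> continuous (spow d).
Proof.
move=> d0.
have pos (x : R) : 0 < x -> {for x, continuous (spow d)}.
  move=> x0; apply: differentiable_continuous; apply/derivable1_diffP.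
  refine (@near_eq_derivable _ _ _ (fun y => powR y d) _ _ _ _ _).
    by near=> y; rewrite spow_gt0//; near: y; exact: lt_nbhsr.
  by case: (is_derive1_powR d x0).
move=> x; have [x0|/pos//|->] := ltgtP x 0.
  have -> : spow d = -%R \o spow d \o -%R by apply/funext => s /=; rewrite spowN opprK.
  apply: continuous_comp; first exact: opp_continuous.
  apply: continuous_comp; last exact: opp_continuous.
  by apply: pos; rewrite oppr_gt0.
apply/cvgrPdist_lt => e e0; rewrite /spow sgr0 mul0r.
have : \forall y \near (0 : R), `|y| < e `^ d^-1 by apply: nbhs0_lt; rewrite powR_gt0.
apply: filterS => y ye; rewrite sub0r normrN -/(spow d y) normr_spow//.
rewrite (_ : e = (e `^ d^-1) `^ d); last first.
  by rewrite -powRrM mulVf ?gt_eqF// powRr1// ltW.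
by rewrite gt0_ltr_powR ?nnegrE ?powR_ge0.
Unshelve. all: by end_near. Qed.

Lemma is_derive_norm_powR (c s : R) : 1 < c ->
  is_derive s (1 : R) (fun y => `|y| `^ c) (c * spow (c - 1) s).
Proof.
move=> c1.
have pos (x : R) : 0 < x ->
    is_derive x (1 : R) (fun y => `|y| `^ c) (c * spow (c - 1) x).
  move=> x0; rewrite spow_gt0//.
  refine (@near_eq_is_derive _ _ _ (fun y => powR y c) _ _ _ _ _ _).
    by near=> y; rewrite gtr0_norm//; near: y; exact: lt_nbhsr.
  exact: is_derive1_powR.
have [s0|/pos//|->] := ltgtP s 0.
  have -> : (fun y : R => `|y| `^ c) = (fun y => `|y| `^ c) \o -%R.
    by apply/funext => y /=; rewrite normrN.
  have -> : c * spow (c - 1) s = (c * spow (c - 1) (- s)) * (-1).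
    by rewrite spowN; ring.
  by apply: is_derive1_comp; apply: pos; rewrite oppr_gt0.
have d0 : 0 < c - 1 by rewrite subr_gt0.
have h : (fun h : R => h^-1 *: (((fun y : R => `|y| `^ c) \o shift (0 : R)) (h *: (1 : R)) - `|0 : R| `^ c))
    @ (0 : R)^' --> (c * spow (c - 1) 0 : R).
  rewrite /spow sgr0 mul0r mulr0.
  apply: (@cvg_trans _ (spow (c - 1) h @[h --> (0 : R)^'])).
    apply: near_eq_cvg; near=> h.
    rewrite /= addr0 normr0 powR0 ?gt_eqF ?(lt_trans ltr01)// subr0.
    rewrite /GRing.scale/= mulr1 /spow.
    have h0 : h != 0 by near: h; exact: nbhs_dnbhs_neq.
    rewrite (_ : `|h| `^ c = `|h| * `|h| `^ (c - 1)).
      by rewrite mulrA; congr (_ * _); rewrite normrEsg mulrCA mulVf// mulr1.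
    rewrite -{2}(powRr1 (normr_ge0 h)) -powRD ?normr_eq0 ?h0 ?implybT//.
    by congr (_ `^ _); ring.
  have := @continuous_spow _ d0 0; rewrite /continuous_at {2}/spow sgr0 mul0r.
  exact: cvg_within_filter.
apply: DeriveDef; first by apply/cvg_ex; eexists; exact: h.
exact: cvg_lim h.
Unshelve. all: by end_near. Qed.

Section compact_support.
Variables (g g' : R -> R) (M : R).
Hypotheses (dg : forall t : R, is_derive t (1 : R) g (g' t)) (cg' : continuous g').
Hypothesis g0 : forall t, M <= `|t| -> g t = 0.

Let mg' : measurable_fun setT (g' : measurableTypeR R -> R).
Proof. exact: continuous_measurable_fun. Qed.

Lemma integral_derive a b : a < b ->
  (\int[leb1]_(t in `[a, b]) (g' t)%:E = (g b - g a)%:E)%E.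
Proof.
move=> ab; have cg : continuous g.
  by move=> t; apply/differentiable_continuous/derivable1_diffP; case: (dg t).
rewrite (continuous_FTC2 (F := g) ab) ?EFinB//.
- by apply: continuous_subspaceT.
- split=> [t _||]; first by case: (dg t).
    exact/cvg_at_right_filter/cg.
  exact/cvg_at_left_filter/cg.
- by move=> t _; rewrite derive1E; case: (dg t).
Qed.

Lemma le_integral_derive t0 :
  (`|g t0|%:E <= \int[leb1]_t `|g' t|%:E)%E.
Proof.
have [t0M|t0M] := leP t0 (- M).
  rewrite g0 ?normr0 ?integral_ge0//.
  have := ler_norm (- t0); rewrite normrN; lra.
have [M0|M0] := leP M 0.
  by rewrite g0 ?normr0 ?integral_ge0// (le_trans M0).
rewrite -abse_EFin; have := integral_derive t0M.
rewrite (g0 (t := - M)) ?normrN ?ler_norm// subr0 => <-.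
have mt : measurable_fun `[- M, t0] (fun x : measurableTypeR R => (g' x)%:E).
  by apply/measurable_EFinP; exact: measurable_funTS.
apply: (le_trans (le_abse_integral leb1 (measurable_itv _) mt)).
apply: ge0_subset_integral => //.
apply/measurable_EFinP; exact: measurableT_comp.
Qed.

Lemma derive_outside t : M < `|t| -> g' t = 0.
Proof.
move=> Mt; have [_ <-] := dg t.
rewrite (@near_eq_derive _ _ _ g (cst 0)) ?derive_cst//.
near=> y; apply: g0; apply/ltW; near: y.
by move/cvgr_gt: (@norm_continuous _ R t); apply.
Unshelve. all: by end_near. Qed.

(** This is the statement that [g'] has integral zero, in the form that slicing by Tonelli can
    use. *)
Lemma integral_derive_pos_neg :
  (\int[leb1]_t ((EFin \o g')^\+ t) = \int[leb1]_t ((EFin \o g')^\- t))%E.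
Proof.
(* Strictly beyond [M], so that [g'] vanishes off [D] as [g] does; the absolute value keeps the
   interval nondegenerate when [M] is negative. *)
pose N := `|M| + 1; pose D : set (measurableTypeR R) := `[- N, N]%classic.
have N0 : 0 < N by rewrite ltr_pwDr.
have MN : M < N by rewrite (le_lt_trans (ler_norm M))// ltrDl.
have mD : measurable D by exact: measurable_itv.
have out t : ~ D t -> g' t = 0.
  move=> Dt; apply: derive_outside; rewrite (lt_le_trans MN)//.
  rewrite leNgt; apply/negP => tN; apply: Dt; rewrite /D/= in_itv/= -ler_norml.
  exact: ltW.
have res (h : R -> \bar R) : (forall t, ~ D t -> h t = 0%E) ->
    (\int[leb1]_t h t = \int[leb1]_(t in D) h t)%E.
  move=> h0; rewrite [RHS]integral_mkcond; apply: eq_integral => t _.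
  by rewrite patchE; case: ifPn => // /negP; rewrite inE => /h0.
rewrite !res; last 2 first.
  by move=> t /out; rewrite funenegE /= => ->; rewrite oppr0 maxxx.
  by move=> t /out; rewrite funeposE /= => ->; rewrite maxxx.
have ig : leb1.-integrable D (EFin \o g').
  apply: continuous_compact_integrable; first exact: segment_compact.
  exact: continuous_subspaceT.
have : (\int[leb1]_(t in D) (EFin \o g') t = 0)%E.
  rewrite integral_derive; last by rewrite gtrN.
  by rewrite !g0 ?subrr// ?normrN (ltW (lt_le_trans MN (ler_norm _))).
rewrite integralE => /eqP; rewrite sube_eq ?add0e => [/eqP //||].
  exact: integrable_pos_fin_num.
by rewrite fin_num_adde_defl// integrable_neg_fin_num.
Qed.

End compact_support.

End real_calculus.

(** * Functions of class [C^1] with compact support *)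

Section compactly_supported.
Context {R : realType} {n : nat}.
Implicit Types (phi psi : 'rV[R]_n -> R) (x : 'rV[R]_n) (i : 'I_n).
Local Notation leb1 := (@lebesgue_measure R).

Lemma subst_coordE x i t :
  subst_coord x i t = subst_coord x i 0 + t *: delta_mx ord0 i.
Proof.
apply/rowP => k; rewrite !mxE eqxx/= eq_sym.
by have [_|_] := eqVneq k i; rewrite ?mulr1 ?add0r ?mulr0 ?addr0.
Qed.

Lemma subst_coord_id x i : subst_coord x i (x ord0 i) = x.
Proof. by apply/rowP => k; rewrite mxE; case: eqVneq => [->|]. Qed.

Lemma is_derive_slice phi x i t :
  derivable phi (subst_coord x i t) (delta_mx ord0 i) ->
  is_derive t (1 : R) (fun t => phi (subst_coord x i t))
    (partial i phi (subst_coord x i t)).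
Proof.
have E : (fun h : R => h^-1 *: (((fun t => phi (subst_coord x i t)) \o shift t)
      (h *: (1 : R)) - phi (subst_coord x i t))) =
    (fun h : R => h^-1 *: ((phi \o shift (subst_coord x i t))
      (h *: (delta_mx ord0 i : 'rV[R]_n)) - phi (subst_coord x i t))).
  apply/funext => h /=; congr (_ *: (phi _ - _)).
  rewrite (_ : h *: (1 : R) = h); last exact: mulr1.
  by rewrite subst_coordE [in RHS]subst_coordE scalerDl addrCA.
by move=> d; apply: DeriveDef; rewrite /derivable /partial /derive /= E.
Qed.

Lemma continuous_slice psi x i :
  continuous psi -> continuous (fun t => psi (subst_coord x i t)).
Proof.
move=> cpsi t; apply: continuous_comp; last exact: cpsi.
rewrite (_ : subst_coord x i =
  (fun t => subst_coord x i 0 + t *: delta_mx ord0 i)); last first.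
  by apply/funext => s; exact: subst_coordE.
by apply: cvgD; [exact: cvg_cst|apply: cvgZl; exact: cvg_id].
Qed.

Lemma le_coord_norm x i : `|x ord0 i| <= `|x|.
Proof.
by rewrite [leRHS]/Num.norm/= mx_normrE; apply/bigmax_geP; right => /=; exists (ord0, i).
Qed.

Lemma bounded_set_coord (A : set 'rV[R]_n) : bounded_set A ->
  exists2 M : R, 0 < M & forall x, A x -> forall i, `|x ord0 i| <= M.
Proof.
move=> /pinfty_ex_gt0[M M0 AM]; exists M => // x Ax i.
exact: le_trans (le_coord_norm x i) (AM _ Ax).
Qed.

Lemma leb_bounded_lty (A : set (lebesgue_rV R n)) :
  measurable A -> bounded_set (A : set 'rV[R]_n) -> (leb A < +oo)%E.
Proof.
move=> mA /bounded_set_coord[M M0 AM].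
pose I : set (measurableTypeR R) := `[- M, M]%classic.
have mI : measurable I by exact: measurable_itv.
have mB : measurable ([set x | forall i, I ((x : 'rV[R]_n) ord0 i)]
    : set (lebesgue_rV R n)).
  by apply: measurable_lebesgue_rV; exact: (measurable_rect (A := fun=> I)).
apply: (@le_lt_trans _ _ (leb [set x | forall i, I ((x : 'rV[R]_n) ord0 i)])).
  apply: le_measure; rewrite ?inE//.
  by move=> x Ax i; rewrite /I/= in_itv/= -ler_norml; exact: AM.
rewrite (leb_rect (A := fun=> I))//.
suff: ((0 : \bar R) <= \prod_(i < n) leb1 I < +oo)%E by case/andP.
apply: (big_ind (fun y : \bar R => 0 <= y < +oo)%E) => [|x y|i _].
- by rewrite lee01 ltry.
- move=> /andP[x0 xoo] /andP[y0 yoo]; rewrite mule_ge0//=.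
  by rewrite lte_mul_pinfty// ge0_fin_numE.
- by rewrite measure_ge0/= /I lebesgue_measure_itv/=; case: ifP => _; rewrite ltry.
Qed.

Definition closed_support phi : set 'rV[R]_n := closure [set x | phi x != 0].

Lemma support_outside phi x : ~ closed_support phi x -> phi x = 0.
Proof. by move=> nx; apply: contra_notP nx => /eqP; exact: (@subset_closure _ [set y | phi y != 0]). Qed.

Lemma partial_outside phi i x : ~ closed_support phi x -> partial i phi x = 0.
Proof.
move=> nx; rewrite /partial (@near_eq_derive _ _ _ phi (cst 0)) ?derive_cst//.
have : nbhs x (~` closed_support phi).
  by apply: open_nbhs_nbhs; split=> //; apply: closed_openC; exact: closed_closure.
by apply: filterS => y; exact: support_outside.
Qed.

Definition C1c phi := Ck 1 phi /\ compact (closed_support phi).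

Lemma C1c_continuous phi : C1c phi -> continuous phi.
Proof. by case=> -[]. Qed.

Lemma C1c_derivable phi i x : C1c phi -> derivable phi x (delta_mx ord0 i).
Proof. by case=> -[_ /(_ i)[]]. Qed.

Lemma C1c_partial_continuous phi i : C1c phi -> continuous (partial i phi).
Proof. by case=> -[_ /(_ i)[_ []]]. Qed.

Lemma compact_support_bounded psi (K : set 'rV[R]_n) : continuous psi ->
  compact K -> (forall x, ~ K x -> psi x = 0) ->
  exists2 B : R, 0 < B & forall x, `|psi x| <= B.
Proof.
move=> cpsi cK K0.
have /compact_bounded/pinfty_ex_gt0[M M0 KM] : compact (psi @` K).
  by apply: continuous_compact => //; exact: continuous_subspaceT.
exists M => // x.
have [Kx|/K0 ->] := pselect (K x); last by rewrite normr0 ltW.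
by apply: KM; exists x.
Qed.

Lemma integrable_compact_support psi (K : set 'rV[R]_n) : continuous psi ->
  compact K -> (forall x, ~ K x -> psi x = 0) ->
  (@leb R n).-integrable setT (EFin \o psi).
Proof.
move=> cpsi cK K0; have [B B0 psiB] := compact_support_bounded cpsi cK K0.
have mK : measurable (K : set (lebesgue_rV R n)).
  apply: measurable_lebesgue_rV; rewrite -(setCK K); apply: measurableC.
  apply: open_measurable_rV; apply: closed_openC.
  by apply: compact_closed => //; exact: norm_hausdorff.
have Koo : (leb (K : set (lebesgue_rV R n)) < +oo)%E.
  by apply: leb_bounded_lty => //; exact: compact_bounded.
have mpsi : measurable_fun setT (psi : lebesgue_rV R n -> R).
  by apply: measurable_fun_lebesgue_rV; exact: continuous_measurable_rV.
apply: (@le_integrable _ _ _ (@leb R n) setT measurableT (EFin \o psi)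
  (fun x => (B * \1_K x)%:E)).
- exact/measurable_EFinP.
- move=> x _ /=; rewrite lee_fin [leRHS]ger0_norm; last by rewrite mulr_ge0// ltW.
  rewrite indicE; have [Kx|/K0 ->] := pselect (K x); first by rewrite mem_set// mulr1.
  by rewrite normr0 mulr_ge0// ltW.
- under eq_fun do rewrite EFinM.
  apply: integrableZl => //; apply/integrableP; split.
    by apply/measurable_EFinP; exact: measurable_indic.
  under eq_integral do rewrite gee0_abs ?lee_fin//.
  by rewrite integral_indic// setIT.
Qed.

Lemma C1c_slice0 phi : C1c phi -> exists M : R, forall x i t,
  M <= `|t| -> phi (subst_coord x i t) = 0.
Proof.
move=> [_ /compact_bounded/bounded_set_coord[M M0 KM]]; exists (M + 1) => x i t Mt.
apply: support_outside => /KM/(_ i); rewrite mxE eqxx; lra.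
Qed.

(** On every line in direction [i] the positive and negative parts of the derivative have equal
    integrals, hence so they do on the whole space. Compact support makes both finite, so that they
    may be subtracted. *)
Lemma integral_partial phi i : C1c phi ->
  (\int[@leb R n]_x (partial i phi x)%:E = 0)%E.
Proof.
move=> phi1.
have cp := C1c_partial_continuous (i := i) phi1.
have mp := continuous_measurable_rV cp.
have ip : (@leb R n).-integrable setT (EFin \o partial i phi).
  apply: (integrable_compact_support cp phi1.2) => x; exact: partial_outside.
rewrite integralE.
have -> : (\int[@leb R n]_x (EFin \o partial i phi)^\+ x =
    \int[@leb R n]_x (EFin \o partial i phi)^\- x)%E.
  rewrite !ge0_integral_leb//; last 2 first.
    by apply: measurable_funeneg; exact/measurable_EFinP.
    by apply: measurable_funepos; exact/measurable_EFinP.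
  apply: (ge0_integral_eq_slices (i := i)) => //.
    by apply: measurable_funepos; exact/measurable_EFinP.
    by apply: measurable_funeneg; exact/measurable_EFinP.
  move=> x; have [M phiM] := C1c_slice0 phi1.
  have := @integral_derive_pos_neg R (fun t => phi (subst_coord x i t))
    (fun t => partial i phi (subst_coord x i t)) M _ _ _.
  move=> H; transitivity (\int[leb1]_t
      (EFin \o (fun t => partial i phi (subst_coord x i t)))^\+ t)%E.
    by apply: eq_integral => t _; rewrite !funeposE.
  apply: etrans; first apply: H; last first.
    by apply: eq_integral => t _; rewrite !funenegE.
  - by move=> t; exact: phiM.
  - exact: continuous_slice.
  - by move=> t; apply: is_derive_slice; exact: C1c_derivable.
rewrite subee//; exact: integrable_neg_fin_num.
Qed.

End compactly_supported.

(** * The Sobolev inequality for [C^1] functions of compact support *)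

Section sobolev_C1c.
Context {R : realType} {n : nat}.
Implicit Types (phi : 'rV[R]_n.+1 -> R).
Local Notation leb1 := (@lebesgue_measure R).
Local Notation N := (n.+1%:R : R).

(** [gagliardo_nirenberg] is applied to [|phi| ^ c], where [c = q n / (N - q)] is chosen so that
    [c N / n] is the Sobolev exponent [s = q N / (N - q)]. The derivative
    [c |phi| ^ (c - 1) |d_i phi|] is split by Hölder, and [(c - 1) q / (q - 1) = s] makes the same
    integral reappear on the right. The factor [c] is the Sobolev constant. *)
Lemma sobolev_C1c phi (q K : R) : (0 < n)%N -> 1 < q -> q < N -> C1c phi -> 0 <= K ->
  (forall i, \int[@leb R n.+1]_x (`|partial i phi x| `^ q)%:E <= (K `^ q)%:E)%E ->
  (\int[@leb R n.+1]_x (`|phi x| `^ (q * N / (N - q)))%:E <=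
    ((q * n%:R / (N - q) * K) `^ (q * N / (N - q)))%:E)%E.
Proof.
move=> n0 q1 qN phi1 K0 HK.
have nR0 : 0 < n%:R :> R by rewrite ltr0n.
have NE : N = n%:R + 1 by rewrite -natr1.
pose s := q * N / (N - q); pose c := q * n%:R / (N - q).
have q0 : 0 < q by rewrite (lt_trans ltr01).
have Nq : 0 < N - q by rewrite subr_gt0.
have s0 : 0 < s by rewrite divr_gt0// mulr_gt0// ltr0n.
have c1 : 1 < c.
  rewrite /c ltr_pdivlMr// mul1r NE ltrBlDr.
  have : 0 < (q - 1) * n%:R by rewrite mulr_gt0// subr_gt0.
  lra.
have c0 : 0 < c by rewrite (lt_trans ltr01).
have c10 : 0 < c - 1 by rewrite subr_gt0.
have Nq' : n%:R + 1 - q != 0 by rewrite -NE gt_eqF.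
pose a := 1 - q^-1 : R.
have a0 : 0 < a by rewrite subr_gt0 invf_lt1.
have sa : s * a = c - 1.
  by rewrite /s /a /c NE; field; rewrite Nq' (gt_eqF q0).
have cN : c * (N / n%:R) = s.
  by rewrite /c /s NE; field; rewrite Nq' (gt_eqF nR0).
rewrite -/s -/c.
have cphi := C1c_continuous phi1.
have mphi := continuous_measurable_rV cphi.
have mnphi : measurable_fun setT (fun x : borel_rV R n.+1 => `|phi x|).
  exact: measurableT_comp.
have mdphi i : measurable_fun setT (fun x : borel_rV R n.+1 => `|partial i phi x|).
  apply: measurableT_comp => //.
  exact: continuous_measurable_rV (C1c_partial_continuous phi1).
pose w (x : borel_rV R n.+1) := `|phi x| `^ c.
pose f i (x : borel_rV R n.+1) := (`|phi x| `^ (c - 1) * `|partial i phi x|)%:E.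
have mpow (h : borel_rV R n.+1 -> R) e : measurable_fun setT h ->
    measurable_fun setT (fun x => h x `^ e).
  by move=> mh; exact: (measurableT_comp (measurable_powR _) mh).
have mf i : measurable_fun setT (f i).
  by apply/measurable_EFinP; apply: measurable_funM => //; exact: mpow.
have f0 i x : (0 <= f i x)%E by rewrite lee_fin mulr_ge0// powR_ge0.
have wN x : w x `^ (n.+1%:R / n%:R) = `|phi x| `^ s.
  by rewrite /w -powRrM cN.
pose I := (\int[borel_lebesgue R n.+1]_x (`|phi x| `^ s)%:E)%E.
have IE : (\int[@leb R n.+1]_x (`|phi x| `^ s)%:E = I)%E.
  by rewrite ge0_integral_leb//; apply/measurable_EFinP; exact: mpow.
have I0 : (0 <= I)%E by apply: integral_ge0 => x _; rewrite lee_fin powR_ge0.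
(* Finite by compact support. Both absorptions rest on it, the one inside [gagliardo_nirenberg] and
   the final division by [J ^ a]. *)
have Ioo : (I < +oo)%E.
  have cs : continuous (fun x => spow s (phi x)).
    by move=> x; apply: continuous_comp; [exact: cphi|exact: continuous_spow].
  have /integrableP[_] : (@leb R n.+1).-integrable setT (EFin \o (fun x => spow s (phi x))).
    apply: (integrable_compact_support cs phi1.2) => x /support_outside ->.
    by rewrite /spow sgr0 mul0r.
  by rewrite -IE; under eq_integral do rewrite /= normr_spow//.
have fI i : (\int[borel_lebesgue R n.+1]_x f i x <= I `^ a * K%:E)%E.
  have -> : (\int[borel_lebesgue R n.+1]_x f i x = \int[borel_lebesgue R n.+1]_x
      ((`|phi x| `^ s)%:E `^ a * (`|partial i phi x| `^ q)%:E `^ q^-1))%E.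
    apply: eq_integral => x _; rewrite !poweR_EFin -!powRrM mulfV ?gt_eqF//.
    by rewrite powRr1// sa.
  apply: le_trans (ge0_hoelder _ _ _ _ _ _ _ _) _ => //.
  - by apply/measurable_EFinP; exact: mpow.
  - by apply/measurable_EFinP; exact: mpow.
  - by rewrite invr_gt0.
  - by rewrite /a subrK.
  apply: lee_wpmul2l; first exact: poweR_ge0.
  rewrite [leRHS](_ : _ = (K `^ q)%:E `^ q^-1)%E; last first.
    by rewrite poweR_EFin -powRrM mulfV ?gt_eqF// powRr1.
  apply: lee_poweR; first by rewrite invr_ge0 ltW.
    by apply: integral_ge0 => x _; rewrite lee_fin powR_ge0.
  by rewrite -ge0_integral_leb//; apply/measurable_EFinP; exact: mpow.
have cf0 i x : (0 <= c%:E * f i x)%E by rewrite mule_ge0// lee_fin ltW.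
have mcf i : measurable_fun setT (fun x => c%:E * f i x)%E.
  by apply: emeasurable_funM.
have GN : (I `^ (n%:R / n.+1%:R) <= \prod_(i < n.+1)
    (\int[borel_lebesgue R n.+1]_x (c%:E * f i x)) `^ N^-1)%E.
  have wI : (\int[borel_lebesgue R n.+1]_x (w x `^ (n.+1%:R / n%:R))%:E = I)%E.
    by apply: eq_integral => x _; rewrite wN.
  have := @gagliardo_nirenberg R n w (fun i x => c%:E * f i x)%E n0.
  rewrite wI.
  apply => //.
  - exact: mpow.
  - by move=> x; exact: powR_ge0.
  move=> i x; have [M phiM] := C1c_slice0 phi1.
  have := @le_integral_derive R (fun t => `|phi (subst_coord x i t)| `^ c)
    (fun t => c * spow (c - 1) (phi (subst_coord x i t)) * partial i phi (subst_coord x i t))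
    M _ _ _ ((x : 'rV[R]_n.+1) ord0 i).
  rewrite subst_coord_id ger0_norm ?powR_ge0// => H.
  apply: le_trans (H _ _ _) _.
  - move=> t; apply: (is_derive1_comp (f := fun y => `|y| `^ c)
      (g := fun t => phi (subst_coord x i t))).
      exact: is_derive_norm_powR.
    by apply: is_derive_slice; exact: C1c_derivable.
  - have cp := continuous_slice (x := x) (i := i) (C1c_partial_continuous (i := i) phi1).
    have cs := continuous_slice (x := x) (i := i) cphi.
    move=> t; apply: cvgM; last exact: cp.
    apply: cvgM; first exact: cvg_cst.
    by apply: continuous_comp; [exact: cs|exact: continuous_spow].
  - by move=> t Mt; rewrite phiM// normr0 powR0// gt_eqF.
  rewrite le_eqVlt; apply/orP; left; apply/eqP; apply: eq_integral => t _.
  by rewrite /f -EFinM 2!normrM normr_spow// (gtr0_norm c0) mulrA.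
have cK0 : 0 <= c * (fine I `^ a * K).
  exact: mulr_ge0 (ltW c0) (mulr_ge0 (powR_ge0 _ _) K0).
have {GN} : (I `^ (n%:R / n.+1%:R) <= c%:E * (I `^ a * K%:E))%E.
  apply: (le_trans GN).
  apply: (@le_trans _ _ (\prod_(i < n.+1) (c%:E * (I `^ a * K%:E)) `^ N^-1)%E).
    apply: (proj2 (A := 0 <= \prod_(i < n.+1)
      (\int[borel_lebesgue R n.+1]_x (c%:E * f i x)) `^ N^-1)%E _).
    apply: (big_ind2 (fun a b => 0 <= a /\ a <= b)%E) => [|x b a' b'|i _].
    - by rewrite lee01.
    - by move=> [x0 xb] [b0 ab']; rewrite mule_ge0// lee_pmul.
    - rewrite poweR_ge0; split=> //; apply: lee_poweR; first by rewrite invr_ge0.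
        exact: integral_ge0.
      rewrite ge0_integralZl//; last by rewrite lee_fin ltW.
      by apply: lee_wpmul2l; rewrite ?lee_fin ?(ltW c0).
  rewrite -(poweR_prod (f := fun=> (c%:E * (I `^ a * K%:E))%E)); last first.
    by move=> i; rewrite mule_ge0 ?lee_fin ?(ltW c0)// mule_ge0// poweR_ge0.
  rewrite -(fineK (x := I)) ?ge0_fin_numE// !poweR_EFin -!EFinM prodEFin prodr_const card_ord.
  rewrite poweR_EFin -powR_mulrn ?cK0//.
  by rewrite -powRrM mulfV ?pnatr_eq0// powRr1// cK0.
rewrite IE -(fineK (x := I)) ?ge0_fin_numE// !poweR_EFin -!EFinM !lee_fin.
set J := fine I => HJ.
have J0 : 0 <= J by exact: fine_ge0.
move: J0; rewrite le_eqVlt => /predU1P[<-|J0]; first exact: powR_ge0.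
have {1}-> : J = (J `^ s^-1) `^ s by rewrite -powRrM mulVf ?gt_eqF// powRr1// ltW.
apply: ge0_ler_powR; [exact: ltW| |exact: (mulr_ge0 (ltW c0))|].
  exact: powR_ge0.
(* Since [a + 1 / s = n / (n + 1)], removing the common factor [J ^ a] leaves exactly the [s]-th
   root of [J]. *)
rewrite -(ler_pM2l (powR_gt0 a J0)) -powRD ?(gt_eqF J0) ?implybT//.
rewrite (_ : a + s^-1 = n%:R / n.+1%:R); first by move: HJ; rewrite mulrCA mulrC.
rewrite /a /s NE; field.
by rewrite Nq' (gt_eqF q0) -NE pnatr_eq0.
Qed.

End sobolev_C1c.

(** * A smooth approximation of truncation *)

Section smooth_truncation.
Context {R : realType}.
Implicit Types (d e k s t y : R).

Definition sqrt_reg e y : R := Num.sqrt (y ^+ 2 + e).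

Lemma sqrt_reg_gt0 e y : 0 < e -> 0 < sqrt_reg e y.
Proof. by move=> e0; rewrite sqrtr_gt0 ltr_wpDl// sqr_ge0. Qed.

Lemma sqrt_regK e y : 0 < e -> sqrt_reg e y ^+ 2 = y ^+ 2 + e.
Proof. by move=> e0; rewrite sqr_sqrtr// addr_ge0 ?sqr_ge0 ?ltW. Qed.

Lemma sqrt_regN e y : sqrt_reg e (- y) = sqrt_reg e y.
Proof. by rewrite /sqrt_reg sqrrN. Qed.

Lemma norm_le_sqrt_reg e y : 0 < e -> `|y| <= sqrt_reg e y.
Proof. by move=> e0; rewrite -sqrtr_sqr ler_wsqrtr// lerDl ltW. Qed.

Lemma sqrt_reg_le e y : 0 < e -> sqrt_reg (e ^+ 2) y <= `|y| + e.
Proof.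
move=> e0; have h : 0 <= `|y| + e by rewrite addr_ge0// ltW.
rewrite -(ger0_norm h) -sqrtr_sqr ler_wsqrtr// sqrrD real_normK ?num_real//.
by rewrite -addrA lerD2l lerDr mulrn_wge0// mulr_ge0// ltW.
Qed.

Lemma sqrt_reg_lip e y t : 0 < e -> `|sqrt_reg e y - sqrt_reg e t| <= `|y - t|.
Proof.
move=> e0; have Q0 := sqrt_reg_gt0 y e0; have Q1 := sqrt_reg_gt0 t e0.
have S0 : 0 < sqrt_reg e y + sqrt_reg e t by rewrite addr_gt0.
rewrite -(ler_pM2r S0) -{1}(gtr0_norm S0) -normrM.
rewrite -subr_sqr !sqrt_regK// opprD addrACA subrr addr0 subr_sqr normrM.
rewrite ler_wpM2l// (le_trans (ler_normD _ _))// lerD// norm_le_sqrt_reg//.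
Qed.

Lemma is_derive_sqrt_reg e y : 0 < e ->
  is_derive y (1 : R) (sqrt_reg e) (y / sqrt_reg e y).
Proof.
move=> e0; have P0 : 0 < y ^+ 2 + e by rewrite ltr_wpDl// sqr_ge0.
have -> : y / sqrt_reg e y = (2 * Num.sqrt (y ^+ 2 + e))^-1 * (2 * y).
  by rewrite /sqrt_reg; field; rewrite gt_eqF// sqrtr_gt0.
apply: (is_derive1_comp (f := Num.sqrt) (g := fun y => y ^+ 2 + e)).
  exact: is_derive1_sqrt.
have h : is_derive y (1 : R) ((id : R -> R) * id + cst e) (y *: (1 : R) + y *: (1 : R) + 0).
  exact: is_deriveD.
rewrite addr0 /GRing.scale/= !mulr1 in h.
by rewrite mulr_natl mulr2n.
Qed.

Lemma is_derive_sqrt_regV e y : 0 < e ->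
  is_derive y (1 : R) (fun y => (sqrt_reg e y)^-1) (- (y * (sqrt_reg e y)^-1 ^+ 3)).
Proof.
move=> e0; have Q0 := sqrt_reg_gt0 y e0.
have h := is_derive_sqrt_reg y e0.
have := is_deriveV (lt0r_neq0 Q0) h; rewrite (_ : _ *: _ = - (y * (sqrt_reg e y)^-1 ^+ 3))//.
by rewrite /GRing.scale/=; field; rewrite gt_eqF.
Qed.

Definition slope_reg e y : R := y / sqrt_reg e y.

Lemma slope_regN e y : slope_reg e (- y) = - slope_reg e y.
Proof. by rewrite /slope_reg sqrt_regN mulNr. Qed.

Lemma norm_slope_reg e y : 0 < e -> `|slope_reg e y| <= 1.
Proof.
move=> e0; have Q0 := sqrt_reg_gt0 y e0.
by rewrite normrM normfV (gtr0_norm Q0) ler_pdivrMr// mul1r norm_le_sqrt_reg.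
Qed.

Lemma slope_reg_lip e y t : 0 < e ->
  `|slope_reg e y - slope_reg e t| <= 2 / Num.sqrt e * `|y - t|.
Proof.
move=> e0; have Q0 := sqrt_reg_gt0 y e0; have Q1 := sqrt_reg_gt0 t e0.
have se : 0 < Num.sqrt e by rewrite sqrtr_gt0.
have eQ z : Num.sqrt e <= sqrt_reg e z by rewrite ler_wsqrtr// lerDr sqr_ge0.
rewrite /slope_reg (_ : _ - _ = (y - t) / sqrt_reg e y +
  t / sqrt_reg e t * ((sqrt_reg e t - sqrt_reg e y) / sqrt_reg e y)); last first.
  by field; rewrite !gt_eqF.
have i1 : (sqrt_reg e y)^-1 <= (Num.sqrt e)^-1 by rewrite lef_pV2// posrE.
rewrite (le_trans (ler_normD _ _))// [leRHS](_ : _ = `|y - t| / Num.sqrt e +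
  `|y - t| / Num.sqrt e); last by ring.
apply: lerD; first by rewrite normrM normfV (gtr0_norm Q0) ler_wpM2l.
rewrite normrM -[leRHS]mul1r ler_pM//; first exact: norm_slope_reg.
rewrite normrM normfV (gtr0_norm Q0); apply: ler_pM => //.
  by rewrite invr_ge0 ltW.
by rewrite distrC sqrt_reg_lip.
Qed.

(** The fourth power is what makes this work: the regularised modulus is at most [y + d ^ 2], and
    [y / (y + d ^ 2)] is at least [1 - d] as soon as [y >= d]. *)
Lemma slope_reg_near1 d y : 0 < d -> d <= y -> 1 - d <= slope_reg (d ^+ 4) y <= 1.
Proof.
move=> d0 dy; have y0 : 0 < y by rewrite (lt_le_trans d0).
have d4 : 0 < d ^+ 4 by rewrite exprn_gt0.
apply/andP; split; last by rewrite (le_trans (ler_norm _))// norm_slope_reg.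
have Q0 := sqrt_reg_gt0 y d4.
rewrite /slope_reg ler_pdivlMr//.
have := @sqrt_reg_le (d ^+ 2) y; rewrite exprn_gt0// -exprM gtr0_norm// => /(_ isT) h.
have [d1|d1] := leP 1 d.
  by rewrite (le_trans _ (ltW y0))// mulr_le0_ge0 ?subr_le0// (ltW Q0).
apply: le_trans (_ : (1 - d) * (y + d ^+ 2) <= _).
  by rewrite ler_wpM2l// subr_ge0 ltW.
have : d * d <= d * y by rewrite ler_wpM2l// ltW.
have : 0 <= d ^+ 3 by rewrite exprn_ge0// ltW.
rewrite expr2 exprS expr2; nra.
Qed.

(** Truncation at level [k] is [(|s + k| - |s - k|) / 2]; here the moduli are replaced by smooth
    ones and [k] by [k + d]. Thanks to the shift the derivative tends to [1] on all of [|s| <= k];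
    unshifted, it would tend to [1 / 2] at [|s| = k] for [k > 0]. *)
Definition trunc_reg k d s : R :=
  (sqrt_reg (d ^+ 4) (s + (k + d)) - sqrt_reg (d ^+ 4) (s - (k + d))) / 2.

Definition dtrunc_reg k d s : R :=
  (slope_reg (d ^+ 4) (s + (k + d)) - slope_reg (d ^+ 4) (s - (k + d))) / 2.

Definition trunc k s : R := Num.max (- k) (Num.min s k).

Lemma trunc_reg0 k d : trunc_reg k d 0 = 0.
Proof. by rewrite /trunc_reg add0r sub0r sqrt_regN subrr mul0r. Qed.

Lemma is_derive_trunc_reg k d s : 0 < d ->
  is_derive s (1 : R) (trunc_reg k d) (dtrunc_reg k d s).
Proof.
move=> d0; have d4 : 0 < d ^+ 4 by rewrite exprn_gt0.
have h c : is_derive s (1 : R) (fun s => sqrt_reg (d ^+ 4) (s + c))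
    (slope_reg (d ^+ 4) (s + c)).
  rewrite -[slope_reg _ _]mulr1.
  apply: (is_derive1_comp (f := sqrt_reg (d ^+ 4)) (g := fun s => s + c)).
    exact: is_derive_sqrt_reg.
  by rewrite -[1 in X in is_derive _ _ _ X]addr0; exact: is_deriveD.
have hh := is_deriveZ 2^-1 (is_deriveB (h (k + d)) (h (- (k + d)))).
rewrite (_ : trunc_reg k d = 2^-1 *: ((fun s => sqrt_reg (d ^+ 4) (s + (k + d))) -
  (fun s => sqrt_reg (d ^+ 4) (s + - (k + d))))); last first.
  by apply/funext => t; rewrite /trunc_reg mulrC.
by rewrite (_ : dtrunc_reg k d s = 2^-1 *: (slope_reg (d ^+ 4) (s + (k + d)) -
  slope_reg (d ^+ 4) (s + - (k + d))))// /dtrunc_reg mulrC.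
Qed.

Lemma trunc_reg_lip k d s t : 0 < d ->
  `|trunc_reg k d s - trunc_reg k d t| <= `|s - t|.
Proof.
move=> d0; have d4 : 0 < d ^+ 4 by rewrite exprn_gt0.
rewrite /trunc_reg -mulrBl normrM [X in _ * X]gtr0_norm ?invr_gt0//.
rewrite ler_pdivrMr// mulr_natr mulr2n.
have := sqrt_reg_lip (s + (k + d)) (t + (k + d)) d4.
have := sqrt_reg_lip (t - (k + d)) (s - (k + d)) d4.
rewrite (_ : t - (k + d) - (s - (k + d)) = - (s - t)); last by ring.
rewrite (_ : s + (k + d) - (t + (k + d)) = s - t) ?normrN; last by ring.
move=> h1 h2; rewrite (le_trans _ (lerD h2 h1))// (le_trans _ (ler_normD _ _))//.
by rewrite le_eqVlt; apply/orP; left; apply/eqP; congr `|_|; ring.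
Qed.

Lemma norm_dtrunc_reg k d s : 0 < d -> `|dtrunc_reg k d s| <= 1.
Proof.
move=> d0; have d4 : 0 < d ^+ 4 by rewrite exprn_gt0.
rewrite /dtrunc_reg normrM [X in _ * X]gtr0_norm ?invr_gt0//.
rewrite ler_pdivrMr// mul1r (le_trans (ler_normB _ _))//.
by rewrite (_ : 2 = 1 + 1)// lerD// norm_slope_reg.
Qed.

Lemma dtrunc_reg_lip k d : 0 < d -> exists2 L : R, 0 < L &
  forall s t, `|dtrunc_reg k d s - dtrunc_reg k d t| <= L * `|s - t|.
Proof.
move=> d0; have d4 : 0 < d ^+ 4 by rewrite exprn_gt0.
exists (2 / Num.sqrt (d ^+ 4)); first by rewrite divr_gt0// sqrtr_gt0.
move=> s t; rewrite /dtrunc_reg -mulrBl normrM [X in _ * X]gtr0_norm ?invr_gt0//.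
rewrite ler_pdivrMr// mulr_natr mulr2n.
have := slope_reg_lip (s + (k + d)) (t + (k + d)) d4.
have := slope_reg_lip (s - (k + d)) (t - (k + d)) d4.
rewrite (_ : s - (k + d) - (t - (k + d)) = s - t); last by ring.
rewrite (_ : s + (k + d) - (t + (k + d)) = s - t); last by ring.
move=> h1 h2; apply: le_trans (lerD h2 h1).
rewrite -(normrN (slope_reg _ (s - _) - slope_reg _ (t - _))) (le_trans _ (ler_normD _ _))//.
by rewrite le_eqVlt; apply/orP; left; apply/eqP; congr `|_|; ring.
Qed.

Lemma trunc_reg_approx k d s : 0 <= k -> 0 < d -> d <= 1 ->
  `|trunc k s - trunc_reg k d s| <= 2 * d.
Proof.
move=> k0 d0 d1; have d4 : 0 < d ^+ 4 by rewrite exprn_gt0.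
have d2 : 0 < d ^+ 2 by rewrite exprn_gt0.
have h y : `|y| <= sqrt_reg (d ^+ 4) y <= `|y| + d ^+ 2.
  by rewrite norm_le_sqrt_reg//= (_ : d ^+ 4 = (d ^+ 2) ^+ 2) ?sqrt_reg_le// -exprM.
have /andP[h1 h2] := h (s + (k + d)); have /andP[h3 h4] := h (s - (k + d)).
have dd : d ^+ 2 <= d by rewrite expr2 ler_piMr// ltW.
move: h1 h2 h3 h4; rewrite /trunc_reg.
set A := sqrt_reg _ (s + _); set B := sqrt_reg _ (s - _) => h1 h2 h3 h4.
have n1 := ler_norm (s + (k + d)); have n2 := ler_norm (- (s + (k + d))).
have n3 := ler_norm (s - (k + d)); have n4 := ler_norm (- (s - (k + d))).
rewrite !normrN in n2 n4.
have up y c : - c <= y -> y <= c -> `|y| <= c by move=> *; rewrite ler_norml; apply/andP.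
have mk : Num.max (- k) k = k by apply: max_r; lra.
rewrite /trunc; apply: (up).
  case: (leP s k) => sk; last first.
    have := up (s - (k + d)) (s - k + d) ltac:(lra) ltac:(lra).
    have := up (s + (k + d)) (s + k + d) ltac:(lra) ltac:(lra).
    by rewrite mk; lra.
  have [sk'|sk'] := leP (- k) s; last first.
    have := up (s - (k + d)) (k + d - s) ltac:(lra) ltac:(lra).
    have := up (s + (k + d)) (- s - k + d) ltac:(lra) ltac:(lra); lra.
  have := up (s - (k + d)) (k + d - s) ltac:(lra) ltac:(lra).
  have := up (s + (k + d)) (k + d + s) ltac:(lra) ltac:(lra); lra.
case: (leP s k) => sk; last first.
  have := up (s - (k + d)) (s - k + d) ltac:(lra) ltac:(lra).
  have := up (s + (k + d)) (s + k + d) ltac:(lra) ltac:(lra).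
  by rewrite mk; lra.
have [sk'|sk'] := leP (- k) s; last first.
  have := up (s - (k + d)) (k + d - s) ltac:(lra) ltac:(lra).
    have := up (s + (k + d)) (- s - k + d) ltac:(lra) ltac:(lra); lra.
have := up (s - (k + d)) (k + d - s) ltac:(lra) ltac:(lra).
have := up (s + (k + d)) (k + d + s) ltac:(lra) ltac:(lra); lra.
Qed.

(** In both cases [s + (k + d)] and [s - (k + d)] have modulus at least [d], so [slope_reg_near1]
    applies to each. The excluded window shrinks with [d], hence every fixed [s] eventually leaves
    it. *)
Lemma dtrunc_reg_approx k d s : 0 <= k -> 0 < d -> `|s| <= k \/ k + 2 * d <= `|s| ->
  `|(if `|s| <= k then 1 else 0) - dtrunc_reg k d s| <= d.
Proof.
move=> k0 d0 H.
have pos y : d <= y -> 1 - d <= slope_reg (d ^+ 4) y <= 1 by exact: slope_reg_near1.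
have neg y : y <= - d -> - 1 <= slope_reg (d ^+ 4) y <= d - 1.
  move=> yd; have /andP[] : 1 - d <= slope_reg (d ^+ 4) (- y) <= 1.
    by apply: pos; rewrite lerNr.
  rewrite slope_regN; lra.
rewrite /dtrunc_reg; case: ifPn => [|/negP sk].
  rewrite ler_norml => /andP[s1 s2].
  have /andP[p1 p2] : 1 - d <= slope_reg (d ^+ 4) (s + (k + d)) <= 1 by apply: pos; lra.
  have /andP[n1 n2] : - 1 <= slope_reg (d ^+ 4) (s - (k + d)) <= d - 1 by apply: neg; lra.
  by rewrite ler_norml; lra.
case: H => // H; have [s0|s0] := leP 0 s.
  rewrite ger0_norm// in H.
  have /andP[p1 p2] : 1 - d <= slope_reg (d ^+ 4) (s + (k + d)) <= 1 by apply: pos; lra.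
  have /andP[n1 n2] : 1 - d <= slope_reg (d ^+ 4) (s - (k + d)) <= 1 by apply: pos; lra.
  by rewrite ler_norml; lra.
rewrite ltr0_norm// in H.
have /andP[p1 p2] : - 1 <= slope_reg (d ^+ 4) (s + (k + d)) <= d - 1 by apply: neg; lra.
have /andP[n1 n2] : - 1 <= slope_reg (d ^+ 4) (s - (k + d)) <= d - 1 by apply: neg; lra.
by rewrite ler_norml; lra.
Qed.

End smooth_truncation.

(** * Stability of [Ck] and of test functions under smooth truncation *)

Section Ck_facts.
Context {R : realType} {n : nat}.
Implicit Types (phi psi : 'rV[R]_n -> R) (x v : 'rV[R]_n) (i : 'I_n).

Lemma is_derive_dirP phi x v (b : R) :
  is_derive x v phi b <-> is_derive (0 : R) (1 : R) (fun t => phi (t *: v + x)) b.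
Proof.
have E : (fun h : R => h^-1 *: (((fun t => phi (t *: v + x)) \o shift (0 : R))
      (h *: (1 : R)) - phi (0 *: v + x))) =
    (fun h : R => h^-1 *: ((phi \o shift x) (h *: v) - phi x)).
  apply/funext => h /=; rewrite (_ : h *: (1 : R) = h); last exact: mulr1.
  by rewrite addr0 scale0r add0r.
by split=> -[]; rewrite /derivable /derive /= => d e; apply: DeriveDef;
  rewrite /derivable /derive /= ?E// -?E.
Qed.

Lemma is_derive_comp_dir (F : R -> R) phi x v (a b : R) :
  is_derive (phi x) (1 : R) F a -> is_derive x v phi b ->
  is_derive x v (F \o phi) (a * b).
Proof.
move=> dF /is_derive_dirP dphi; apply/is_derive_dirP.
apply: (is_derive1_comp (f := F) (g := fun t => phi (t *: v + x))) => //.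
by rewrite scale0r add0r.
Qed.

Lemma continuousD_rV phi psi : continuous phi -> continuous psi ->
  continuous (fun x => phi x + psi x).
Proof. by move=> cf cg x; exact: (cvgD (cf x) (cg x)). Qed.

Lemma continuousM_rV phi psi : continuous phi -> continuous psi ->
  continuous (fun x => phi x * psi x).
Proof. by move=> cf cg x; exact: (cvgM (cf x) (cg x)). Qed.

Lemma CkS k phi : Ck k.+1 phi -> Ck k phi.
Proof.
elim: k phi => [|k IHk] phi; first by case.
move=> [cphi H]; split=> // i; have [d Hi] := H i; split=> //.
exact: IHk.
Qed.

Lemma Ck_continuous k phi : Ck k phi -> continuous phi.
Proof. by case: k => [|k] []. Qed.

Lemma Ck_cst k (c : R) : Ck k (fun _ : 'rV[R]_n => c).
Proof.
elim: k c => [|k IHk] c; split=> //; try exact: cst_continuous.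
move=> i; split=> [x|]; first exact: derivable_cst.
rewrite (_ : partial i _ = fun=> 0); first exact: IHk.
by apply/funext => x; rewrite /partial derive_cst.
Qed.

Lemma Ck_add k phi psi : Ck k phi -> Ck k psi -> Ck k (fun x => phi x + psi x).
Proof.
elim: k phi psi => [|k IHk] phi psi [cf Hf] [cg Hg].
  by split=> //; exact: continuousD_rV.
split=> [|i]; first exact: continuousD_rV.
have [df Hfi] := Hf i; have [dg Hgi] := Hg i.
split=> [x|]; first exact: derivableD.
rewrite (_ : partial i _ = fun x => partial i phi x + partial i psi x); first exact: IHk.
by apply/funext => x; rewrite /partial deriveD.
Qed.

Lemma partialM i phi psi x : derivable phi x (delta_mx ord0 i) ->
  derivable psi x (delta_mx ord0 i) ->
  partial i (fun x => phi x * psi x) x = phi x * partial i psi x + partial i phi x * psi x.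
Proof.
move=> df dg; rewrite /partial (deriveM df dg); congr (_ + _); exact: mulrC.
Qed.

Lemma Ck_mul k phi psi : Ck k phi -> Ck k psi -> Ck k (fun x => phi x * psi x).
Proof.
elim: k phi psi => [|k IHk] phi psi Hphi Hpsi;
    have cphi := Ck_continuous Hphi; have cpsi := Ck_continuous Hpsi.
  by split=> //; exact: continuousM_rV.
have Hphi' := CkS Hphi; have Hpsi' := CkS Hpsi.
case: Hphi => _ Hf; case: Hpsi => _ Hg.
split=> [|i]; first exact: continuousM_rV.
have [df Hfi] := Hf i; have [dg Hgi] := Hg i.
split=> [x|]; first exact: derivableM.
rewrite (_ : partial i _ = fun x => phi x * partial i psi x + partial i phi x * psi x).
  by apply: Ck_add; exact: IHk.
by apply/funext => x; exact: partialM.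
Qed.

Lemma partial_comp i (F F' : R -> R) phi x :
  (forall s, is_derive s (1 : R) F (F' s)) -> derivable phi x (delta_mx ord0 i) ->
  derivable (fun x => F (phi x)) x (delta_mx ord0 i) /\
  partial i (fun x => F (phi x)) x = F' (phi x) * partial i phi x.
Proof.
move=> dF /derivableP dphi.
by have [d1 d2] := is_derive_comp_dir (dF (phi x)) dphi.
Qed.

(** The reciprocal comes before the root because the induction closes on it: with [rho] the
    reciprocal, [d_i rho = - phi rho^3 d_i phi] is again a product of [phi], [rho] and [d_i phi].
    The root itself is [(phi^2 + e) rho]. *)
Lemma Ck_sqrt_regV k e phi : 0 < e -> Ck k phi ->
  Ck k (fun x => (sqrt_reg e (phi x))^-1).
Proof.
move=> e0.
have cV : continuous (fun s : R => (sqrt_reg e s)^-1).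
  move=> s; apply/differentiable_continuous/derivable1_diffP.
  by case: (is_derive_sqrt_regV s e0).
elim: k phi => [|k IHk] phi Hphi; have cphi := Ck_continuous Hphi.
  by split=> // x; exact: (continuous_comp (cphi x) (cV (phi x))).
have Hphi' := CkS Hphi; case: Hphi => _ Hf.
split=> [x|i]; first exact: (continuous_comp (cphi x) (cV (phi x))).
have [df Hfi] := Hf i.
have pc x := partial_comp (fun s => is_derive_sqrt_regV s e0) (df x).
split=> [x|]; first exact: (pc x).1.
pose rho x := (sqrt_reg e (phi x))^-1.
rewrite (_ : partial i _ =
    fun x => (-1) * (phi x * (rho x * (rho x * rho x)) * partial i phi x)).
  apply: Ck_mul; first exact: Ck_cst.
  apply: Ck_mul => //; apply: Ck_mul => //.
  by apply: Ck_mul; [exact: IHk|apply: Ck_mul; exact: IHk].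
by apply/funext => x; rewrite (pc x).2 /rho; ring.
Qed.

Lemma Ck_sqrt_reg k e phi : 0 < e -> Ck k phi -> Ck k (fun x => sqrt_reg e (phi x)).
Proof.
move=> e0 Hphi.
rewrite (_ : (fun x => _) =
    fun x => (phi x * phi x + e) * (sqrt_reg e (phi x))^-1).
  apply: Ck_mul; last exact: Ck_sqrt_regV.
  by apply: Ck_add; [exact: Ck_mul|exact: Ck_cst].
apply/funext => x; rewrite -expr2 -sqrt_regK// expr2 mulfK//.
by rewrite gt_eqF// sqrt_reg_gt0.
Qed.

Lemma Ck_trunc_reg m k d phi : 0 < d -> Ck m phi ->
  Ck m (fun x => trunc_reg k d (phi x)).
Proof.
move=> d0 Hphi; have d4 : 0 < d ^+ 4 by rewrite exprn_gt0.
rewrite (_ : (fun x => _) = fun x => (sqrt_reg (d ^+ 4) (phi x + (k + d)) +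
    (-1) * sqrt_reg (d ^+ 4) (phi x + - (k + d))) * 2^-1); last first.
  by apply/funext => x; rewrite /trunc_reg mulN1r.
apply: Ck_mul; last exact: Ck_cst.
apply: Ck_add.
  by apply: Ck_sqrt_reg => //; apply: Ck_add => //; exact: Ck_cst.
apply: Ck_mul; first exact: Ck_cst.
by apply: Ck_sqrt_reg => //; apply: Ck_add => //; exact: Ck_cst.
Qed.

Lemma support_subset phi psi : (forall x, phi x = 0 -> psi x = 0) ->
  closed_support psi `<=` closed_support phi.
Proof.
move=> H; apply: closure_subset => x /=; apply: contra => /eqP/H ->.
exact/eqP.
Qed.

Lemma compact_support_subset phi psi : (forall x, phi x = 0 -> psi x = 0) ->
  compact (closed_support phi) -> compact (closed_support psi).
Proof.
move=> H cphi; apply: subclosed_compact cphi (support_subset H).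
exact: closed_closure.
Qed.

Lemma test_trunc_reg (Omega : set 'rV[R]_n) k d phi : 0 < d ->
  test_function Omega phi -> test_function Omega (fun x => trunc_reg k d (phi x)).
Proof.
move=> d0 [Hphi cphi sphi].
have H x : phi x = 0 -> trunc_reg k d (phi x) = 0 by move=> ->; exact: trunc_reg0.
split=> [m||]; first by apply: Ck_trunc_reg.
  exact: compact_support_subset cphi.
exact: subset_trans (support_subset H) sphi.
Qed.

Lemma partial_trunc_reg (Omega : set 'rV[R]_n) k d phi i x : 0 < d ->
  test_function Omega phi ->
  partial i (fun x => trunc_reg k d (phi x)) x = dtrunc_reg k d (phi x) * partial i phi x.
Proof.
move=> d0 [/(_ 1%N)[_ /(_ i)[df _]] _ _].
by have [_ ->] := partial_comp (fun s => is_derive_trunc_reg k s d0) (df x).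
Qed.

Lemma test_C1c (Omega : set 'rV[R]_n) phi : test_function Omega phi -> C1c phi.
Proof. by case=> H c _; split=> //; exact: H. Qed.

Lemma integral_partialM phi psi i : C1c phi -> C1c psi ->
  (\int[@leb R n]_x (phi x * partial i psi x)%:E =
   - \int[@leb R n]_x (partial i phi x * psi x)%:E)%E.
Proof.
move=> Hphi Hpsi.
have cM : C1c (fun x => phi x * psi x).
  split; first by apply: Ck_mul; [exact: Hphi.1|exact: Hpsi.1].
  by apply: compact_support_subset Hphi.2 => x ->; rewrite mul0r.
have Lphi : (@leb R n).-integrable setT (EFin \o (fun x => phi x * partial i psi x)).
  apply: (integrable_compact_support _ Hphi.2) => [|x /support_outside ->].
    by apply: continuousM_rV; [exact: C1c_continuous|exact: C1c_partial_continuous].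
  by rewrite mul0r.
have Lpsi : (@leb R n).-integrable setT (EFin \o (fun x => partial i phi x * psi x)).
  apply: (integrable_compact_support _ Hpsi.2) => [|x /support_outside ->].
    by apply: continuousM_rV; [exact: C1c_partial_continuous|exact: C1c_continuous].
  by rewrite mulr0.
have := integral_partial i cM.
rewrite (_ : (\int[_]_x _)%E = (\int[@leb R n]_x
    ((phi x * partial i psi x)%:E + (partial i phi x * psi x)%:E))%E); last first.
  apply: eq_integral => x _.
  by rewrite partialM; [|exact: C1c_derivable|exact: C1c_derivable].
rewrite integralD// => H.
have := H; rewrite -(fineK (integrable_fin_num measurableT Lphi)).
rewrite -(fineK (integrable_fin_num measurableT Lpsi)) -EFinD -EFinN => -[h].
by congr (_%:E); lra.
Qed.

End Ck_facts.

(** * The [L^q] norm on a set of finite measure *)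

Section Lq_norm_on.
Context d (T : measurableType d) (R : realType) (mu : {measure set T -> \bar R}).
Context (D : set T) (q : R).
Hypothesis mD : measurable D.
Hypothesis Doo : (mu D < +oo)%E.
Hypothesis q1 : 1 <= q.
Implicit Types v w : T -> R.

(** The same expression as [norm_Lq], over an arbitrary measure; results proved here apply to
    [norm_Lq] by conversion. *)
Definition Lq_norm_on v : \bar R := ('N[mu]_(q%:E)[EFin \o (v \_ D)])%E.

Definition Lq_on v := measurable_fun D v /\ (Lq_norm_on v < +oo)%E.

Let q0 : 0 < q. Proof. exact: lt_le_trans q1. Qed.

Let mpow v : measurable_fun D v ->
  measurable_fun D (fun x => (`|v x| `^ q)%:E).
Proof.
move=> mv; apply/measurable_EFinP; apply: (measurableT_comp (measurable_powR q)).
exact: measurableT_comp.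
Qed.

Lemma Lq_norm_onE v :
  Lq_norm_on v = ((\int[mu]_(x in D) (`|v x| `^ q)%:E) `^ q^-1)%E.
Proof.
rewrite /Lq_norm_on unlock /Lnorm; apply: (congr1 (fun I => I `^ q^-1)%E).
rewrite [RHS]integral_mkcond; apply: eq_integral => x _ /=.
rewrite !patchE; case: ifPn => _ //.
by rewrite normr0 powR0// gt_eqF.
Qed.

Lemma Lq_norm_on_ge0 v : (0 <= Lq_norm_on v)%E.
Proof. exact: Lnorm_ge0. Qed.

Lemma integral_Lq_norm_onE v :
  (\int[mu]_(x in D) (`|v x| `^ q)%:E = (Lq_norm_on v) `^ q)%E.
Proof.
rewrite Lq_norm_onE -poweRrM mulVf ?gt_eqF// poweRe1//.
by apply: integral_ge0 => x _; rewrite lee_fin powR_ge0.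
Qed.

Lemma eq_Lq_norm_on v w : (forall x, D x -> v x = w x) ->
  Lq_norm_on v = Lq_norm_on w.
Proof.
move=> vw; rewrite 2!Lq_norm_onE; apply: (congr1 (fun I => I `^ q^-1)%E).
by apply: eq_integral => x; rewrite inE => /vw ->.
Qed.

Lemma Lq_norm_onD v w : measurable_fun D v ->
  measurable_fun D w ->
  (Lq_norm_on (fun x => v x + w x)%R <= Lq_norm_on v + Lq_norm_on w)%E.
Proof.
move=> mv mw; rewrite /Lq_norm_on.
have -> : ((fun x => v x + w x) \_ D)%R = ((v \_ D) \+ (w \_ D))%R.
  by apply/funext => x; rewrite /= !patchE; case: ifP => //; rewrite addr0.
by apply: minkowski_EFin => //; exact/(measurable_restrictT _ mD).
Qed.

Lemma le_Lq_norm_on v w : measurable_fun D v ->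
  measurable_fun D w ->
  (forall x, D x -> `|v x| <= `|w x|) ->
  (Lq_norm_on v <= Lq_norm_on w)%E.
Proof.
move=> mv mw vw; rewrite 2!Lq_norm_onE; apply: lee_poweR.
- by rewrite invr_ge0 ltW.
- by apply: integral_ge0 => x _; rewrite lee_fin powR_ge0.
apply: ge0_le_integral => //.
- exact: mpow.
- exact: mpow.
- move=> x Dx; rewrite lee_fin; apply: ge0_ler_powR; rewrite ?nnegrE//.
    exact: ltW.
  exact: vw.
Qed.

Lemma Lq_norm_onN v : Lq_norm_on (fun x => - v x) = Lq_norm_on v.
Proof. by rewrite 2!Lq_norm_onE; under eq_integral do rewrite normrN. Qed.

Lemma Lq_norm_onZ (c : R) v : measurable_fun D v ->
  Lq_norm_on (fun x => c * v x) = (`|c|%:E * Lq_norm_on v)%E.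
Proof.
move=> mv; rewrite 2!Lq_norm_onE.
rewrite (_ : (\int[_]_(x in _) _)%E =
    ((`|c| `^ q)%:E * \int[mu]_(x in D) (`|v x| `^ q)%:E)%E).
  rewrite poweRM ?lee_fin ?powR_ge0//; last first.
    by apply: integral_ge0 => x _; rewrite lee_fin powR_ge0.
  by rewrite poweR_EFin -powRrM mulfV ?gt_eqF// powRr1.
rewrite -ge0_integralZl//; last exact: mpow.
by apply: eq_integral => x _; rewrite normrM powRM// EFinM.
Qed.

Lemma Lq_norm_on_bounded v (B : R) : 0 <= B -> measurable_fun D v ->
  (forall x, D x -> `|v x| <= B) -> (Lq_norm_on v < +oo)%E.
Proof.
move=> B0 mv vB.
apply: (@le_lt_trans _ _ (Lq_norm_on (fun=> B))).
  apply: le_Lq_norm_on => // x Dx.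
  by rewrite (ger0_norm B0); exact: vB.
rewrite Lq_norm_onE; apply: poweR_lty; rewrite integral_cst//.
by rewrite lte_mul_pinfty// lee_fin powR_ge0.
Qed.

Lemma Lq_onD v w : Lq_on v -> Lq_on w ->
  Lq_on (fun x => v x + w x).
Proof.
move=> [mv v_oo] [mw w_oo]; split; first exact: measurable_funD.
by apply: (le_lt_trans (Lq_norm_onD mv mw)); exact: lte_add_pinfty.
Qed.

Lemma Lq_norm_on_cvg0 (v : nat -> T -> R) w (e : R) :
  (forall N, measurable_fun D (v N)) -> Lq_on w ->
  (forall N x, D x -> `|v N x| <= `|w x|) ->
  (forall x, D x -> v ^~ x @ \oo --> (0 : R)) -> 0 < e ->
  \forall N \near \oo, (Lq_norm_on (v N) < e%:E)%E.
Proof.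
move=> mv [mw woo] vw v0 e0.
have iw : mu.-integrable D (fun x => (`|w x| `^ q)%:E).
  apply/integrableP; split; first exact: mpow.
  under eq_integral do rewrite gee0_abs ?lee_fin ?powR_ge0//.
  by rewrite integral_Lq_norm_onE poweR_lty.
have cv : {ae mu, forall x, D x -> (fun N => (`|v N x| `^ q)%:E) @ \oo --> (cst 0%E x : \bar R)}.
  apply/aeW => x Dx; apply: cvg_EFin; first by apply: nearW.
  have h : spow q (v N x) @[N --> \oo] --> spow q 0.
    exact: (cvg_comp _ _ (v0 x Dx) (continuous_spow q0 (x := 0))).
  rewrite (_ : fine \o _ = (fun N => `|spow q (v N x)|)); last first.
    by apply/funext => N /=; rewrite normr_spow.
  rewrite [X in _ --> X](_ : _ = `|spow q 0|); first exact: cvg_norm.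
  by rewrite normr_spow// normr0 powR0// gt_eqF.
have dom : {ae mu, forall x N, D x -> (`|(`|v N x| `^ q)%:E| <= (`|w x| `^ q)%:E)%E}.
  apply/aeW => x N Dx; rewrite gee0_abs ?lee_fin ?powR_ge0//.
  by apply: ge0_ler_powR; rewrite ?nnegrE ?(ltW q0)//; exact: vw.
have [_ _] := @dominated_convergence _ T R mu D mD _ _ _
  (fun N => mpow (mv N)) (measurable_cst _) cv iw dom.
rewrite integral0 => /fine_cvgP[fin /cvgr0_norm_lt H].
have eq0 : 0 < e `^ q by rewrite powR_gt0.
near=> N.
rewrite Lq_norm_onE.
have finN : (\int[mu]_(x in D) (`|v N x| `^ q)%:E)%E \is a fin_num by near: N.
rewrite -(fineK finN) poweR_EFin lte_fin.
rewrite (_ : e = (e `^ q) `^ q^-1); last by rewrite -powRrM mulfV ?gt_eqF// powRr1// ltW.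
apply: gt0_ltr_powR; rewrite ?invr_gt0 ?nnegrE ?powR_ge0//.
  by apply: fine_ge0; apply: integral_ge0 => x _; rewrite lee_fin powR_ge0.
apply: (le_lt_trans (ler_norm _)); near: N; exact: H.
Unshelve. all: by end_near. Qed.

Lemma Lq_on_bounded v (B : R) : 0 <= B -> measurable_fun D v ->
  (forall x, D x -> `|v x| <= B) -> Lq_on v.
Proof. by move=> B0 mv vB; split=> //; exact: Lq_norm_on_bounded vB. Qed.

Lemma integral_norm_le v : measurable_fun D v ->
  (\int[mu]_(x in D) `|v x|%:E <=
   (fine (mu D) `^ (1 - q^-1))%:E * Lq_norm_on v)%E.
Proof.
move=> mv; move: q1; rewrite le_eqVlt => /predU1P[qE|q1'].
  rewrite -qE invr1 subrr powRr0 mul1e Lq_norm_onE -qE invr1.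
  under [in leRHS]eq_integral do rewrite powRr1//.
  by rewrite poweRe1// integral_ge0.
have a0 : 0 < 1 - q^-1 by rewrite subr_gt0 invf_lt1.
have i0 : 0 < q^-1 by rewrite invr_gt0.
have m1 : measurable_fun setT ((fun=> 1%E : \bar R) \_ D).
  by apply/(measurable_restrictT _ mD); exact: measurable_cst.
have m2 : measurable_fun setT ((fun x => (`|v x| `^ q)%:E) \_ D).
  by apply/(measurable_restrictT _ mD); exact: mpow.
have := @ge0_hoelder _ T R mu _ _ (1 - q^-1) q^-1 m1 m2 _ _ a0 i0 _.
have -> : (\int[mu]_x (((fun=> 1%E : \bar R) \_ D) x `^ (1 - q^-1) *
    ((fun x => (`|v x| `^ q)%:E) \_ D) x `^ q^-1) =
    \int[mu]_(x in D) `|v x|%:E)%E.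
  rewrite [RHS]integral_mkcond; apply: eq_integral => x _; rewrite !patchE.
  case: ifPn => _; last by rewrite poweR0r ?mul0e// gt_eqF.
  by rewrite poweR1r mul1e poweR_EFin -powRrM mulfV ?gt_eqF// powRr1.
rewrite -integral_mkcond integral_cst// mul1e -integral_mkcond.
rewrite Lq_norm_onE -poweR_EFin fineK ?ge0_fin_numE//; apply.
- by move=> x; rewrite patchE; case: ifP.
- by move=> x; rewrite patchE; case: ifP => // _; rewrite lee_fin powR_ge0.
- by rewrite subrK.
Qed.

(** Pairing with a bounded function is continuous for the [L^q] norm. This carries the defining
    identity of weak gradients to limits. *)
Lemma integral_mul_le v w (B : R) : 0 <= B -> Lq_on v ->
  measurable_fun D w -> (forall x, `|w x| <= B) ->
  mu.-integrable D (fun x => (v x * w x)%:E) /\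
  (`|\int[mu]_(x in D) (v x * w x)%:E| <=
    (B * fine (mu D) `^ (1 - q^-1))%:E * Lq_norm_on v)%E.
Proof.
move=> B0 Lv mw wB; have [mv voo] := Lv.
have mvw : measurable_fun D (fun x => (v x * w x)%:E).
  by apply/measurable_EFinP; exact: measurable_funM.
have mnv : measurable_fun D (fun x => `|v x|%:E).
  by apply/measurable_EFinP; exact: measurableT_comp.
have le : (\int[mu]_(x in D) `|(v x * w x)%:E| <=
    (B * fine (mu D) `^ (1 - q^-1))%:E * Lq_norm_on v)%E.
  apply: (@le_trans _ _ (B%:E * \int[mu]_(x in D) `|v x|%:E)%E).
    rewrite -ge0_integralZl//; apply: ge0_le_integral => //.
    - exact: measurableT_comp.
    - exact: emeasurable_funM.
    - by move=> x _; rewrite abse_EFin -EFinM lee_fin normrM mulrC ler_wpM2r.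
  rewrite EFinM -muleA; apply: lee_wpmul2l; first by rewrite lee_fin.
  exact: integral_norm_le.
split; last exact: (le_trans (le_abse_integral mu mD mvw)).
apply/integrableP; split=> //; apply: (le_lt_trans le).
by rewrite lte_mul_pinfty// lee_fin mulr_ge0// powR_ge0.
Qed.

End Lq_norm_on.

(** * The space [W_0^{1,q}] as a closure *)

Section sobolev_space.
Context {R : realType} {n : nat} (Omega : set 'rV[R]_n) (q : R).
Local Notation mu := (@leb R n).
Local Notation L := (lebesgue_rV R n).
Hypothesis oO : open Omega.
Hypothesis bO : bounded_set Omega.
Hypothesis q1 : 1 <= q.
Implicit Types (v w phi psi : 'rV[R]_n -> R) (G H : 'rV[R]_n -> 'rV[R]_n).

Lemma measurable_open_rV : measurable (Omega : set L).
Proof. by apply: measurable_lebesgue_rV; exact: open_measurable_rV. Qed.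

Let mO := measurable_open_rV.

Lemma leb_open_lty : (mu Omega < +oo)%E.
Proof. exact: leb_bounded_lty. Qed.

Let Ooo := leb_open_lty.

Lemma continuous_measurable_on phi : continuous phi ->
  measurable_fun (Omega : set L) phi.
Proof.
move=> cphi; apply: measurable_funTS; apply: measurable_fun_lebesgue_rV.
exact: continuous_measurable_rV.
Qed.

Lemma C1c_in_Lq phi : C1c phi -> in_Lq Omega q phi.
Proof.
move=> phi1; have cphi := C1c_continuous phi1.
have [B B0 phiB] := compact_support_bounded cphi phi1.2 (@support_outside _ _ phi).
apply: (@Lq_on_bounded _ L R mu Omega q mO Ooo q1 phi B (ltW B0)) => //.
exact: continuous_measurable_on.
Qed.

Lemma partial_in_Lq phi i : C1c phi -> in_Lq Omega q (partial i phi).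
Proof.
move=> phi1; have cphi := C1c_partial_continuous (i := i) phi1.
have [B B0 phiB] := compact_support_bounded cphi phi1.2 (@partial_outside _ _ phi i).
apply: (@Lq_on_bounded _ L R mu Omega q mO Ooo q1 _ B (ltW B0)) => //.
exact: continuous_measurable_on.
Qed.

Lemma norm_Lq_le_W1q v G : (norm_Lq Omega q v <= norm_W1q Omega q v G)%E.
Proof. by rewrite leeDl// sume_ge0// => i _; exact: Lnorm_ge0. Qed.

Lemma norm_grad_le_W1q v G i :
  (norm_Lq Omega q (fun x => G x ord0 i) <= norm_W1q Omega q v G)%E.
Proof.
rewrite /norm_W1q (bigD1 i)//= addeCA leeDl// adde_ge0 ?Lnorm_ge0//.
by rewrite sume_ge0// => k _; exact: Lnorm_ge0.
Qed.

Lemma test_outside phi x : test_function Omega phi -> ~ Omega x -> phi x = 0.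
Proof. by move=> [_ _ sphi] Ox; apply: support_outside => /sphi. Qed.

Lemma test_partial_outside phi i x :
  test_function Omega phi -> ~ Omega x -> partial i phi x = 0.
Proof. by move=> [_ _ sphi] Ox; apply: partial_outside => /sphi. Qed.

Lemma integral_in_setT (g : 'rV[R]_n -> \bar R) : (forall x, ~ Omega x -> g x = 0%E) ->
  (\int[mu]_(x in Omega) g x = \int[mu]_x g x)%E.
Proof.
move=> g0; rewrite integral_mkcond; apply: eq_integral => x _.
by rewrite patchE; case: ifPn => // /negP; rewrite inE => /g0.
Qed.

Lemma weak_gradient_test phi : test_function Omega phi ->
  weak_gradient Omega phi (fun x => \row_i partial i phi x).
Proof.
move=> tphi psi tpsi i.
rewrite !integral_in_setT; last 2 first.
- by move=> x Ox; rewrite (test_outside tpsi Ox) mulr0.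
- by move=> x Ox; rewrite (test_outside tphi Ox) mul0r.
rewrite (integral_partialM i (test_C1c tphi) (test_C1c tpsi)).
by congr (- _)%E; apply: eq_integral => x _; rewrite mxE.
Qed.

(** Approximability by test functions brings the rest of the definition along: [L^q] membership
    because the error and the test function both have finite norm, the weak gradient because its
    identity holds for test functions and is stable under [L^q] limits. *)
Lemma in_W1q0_closure v G :
  measurable_fun (Omega : set L) v ->
  (forall i, measurable_fun (Omega : set L) (fun x => G x ord0 i)) ->
  (forall e : R, 0 < e -> exists2 phi, test_function Omega phi &
    (norm_W1q Omega q (fun x => v x - phi x)%R
      (fun x => G x - \row_i partial i phi x)%R < e%:E)%E) ->
  in_W1q0 Omega q v G.
Proof.
move=> mv mG H; split=> //.
have part phi x i : (G x - \row_i partial i phi x) ord0 i = G x ord0 i - partial i phi x.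
  by rewrite !mxE.
have normG phi i : norm_Lq Omega q (fun x => (G x - \row_i partial i phi x) ord0 i) =
    norm_Lq Omega q (fun x => G x ord0 i - partial i phi x).
  by congr norm_Lq; apply/funext => x; rewrite part.
have Lv phi : test_function Omega phi -> forall e : R,
    (norm_W1q Omega q (fun x => v x - phi x)%R
      (fun x => G x - \row_i partial i phi x)%R < e%:E)%E ->
    in_Lq Omega q (fun x => v x - phi x) /\
    forall i, in_Lq Omega q (fun x => G x ord0 i - partial i phi x).
  move=> tphi e He; have phi1 := test_C1c tphi; split=> [|i]; split.
  - by apply: measurable_funB => //; exact: (C1c_in_Lq phi1).1.
  - exact: (le_lt_trans (norm_Lq_le_W1q _ _) (lt_trans He (ltry _))).
  - by apply: measurable_funB => //; exact: (partial_in_Lq i phi1).1.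
  - rewrite -normG; apply: (le_lt_trans _ (lt_trans He (ltry e))).
    exact: norm_grad_le_W1q.
have [phi tphi He] := H 1 ltr01.
have [Lvp LGp] := Lv _ tphi _ He.
have LV : in_Lq Omega q v.
  have := Lq_onD mO q1 Lvp (C1c_in_Lq (test_C1c tphi)).
  rewrite /Lq_on (_ : (fun x => v x - phi x + phi x) = v)//.
  by apply/funext => x; rewrite subrK.
have LG i : in_Lq Omega q (fun x => G x ord0 i).
  have := Lq_onD mO q1 (LGp i) (partial_in_Lq i (test_C1c tphi)).
  rewrite /Lq_on (_ : (fun x => G x ord0 i - partial i phi x + partial i phi x) =
    (fun x => G x ord0 i))//.
  by apply/funext => x; rewrite subrK.
split=> // psi tpsi i.
have psi1 := test_C1c tpsi.
have [B B0 psiB] := compact_support_bounded (C1c_continuous psi1) psi1.2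
  (@support_outside _ _ psi).
have [B' B'0 dpsiB] := compact_support_bounded
  (C1c_partial_continuous (i := i) psi1) psi1.2 (@partial_outside _ _ psi i).
have mpsi := (C1c_in_Lq psi1).1; have mdpsi := (partial_in_Lq i psi1).1.
have [iA _] := integral_mul_le mO Ooo q1 (ltW B'0) LV mdpsi dpsiB.
have [iB _] := integral_mul_le mO Ooo q1 (ltW B0) (LG i) mpsi psiB.
have fA := integrable_fin_num mO iA; have fB := integrable_fin_num mO iB.
pose X := fine (\int[mu]_(x in Omega) (v x * partial i psi x)%:E)%E.
pose Y := fine (\int[mu]_(x in Omega) (G x ord0 i * psi x)%:E)%E.
rewrite -(fineK fA) -(fineK fB) -EFinN; congr (_%:E); rewrite -/X -/Y.
(* The approximant satisfies the identity exactly, so the defect [X + Y] equals that of the error,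
   at most [(B' + B) c e']; the [+ 1] in [e'] only guards against a zero denominator. *)
apply/eqP; rewrite -addr_eq0 -normr_le0; apply/ler_addgt0Pl => e e0; rewrite addr0.
pose c := fine (mu Omega) `^ (1 - q^-1).
have c0 : 0 <= c by exact: powR_ge0.
pose e' := e / ((B' + B) * c + 1).
have den : 0 < (B' + B) * c + 1 by rewrite ltr_wpDl// mulr_ge0// addr_ge0// ltW.
have e'0 : 0 < e' by rewrite divr_gt0.
have [eta teta Heta] := H e' e'0.
have [Lve LGe] := Lv _ teta _ Heta.
have [i1 b1] := integral_mul_le mO Ooo q1 (ltW B'0) Lve mdpsi dpsiB.
have [i2 b2] := integral_mul_le mO Ooo q1 (ltW B0) (LGe i) mpsi psiB.
have [i3 _] := integral_mul_le mO Ooo q1 (ltW B'0) (C1c_in_Lq (test_C1c teta)) mdpsi dpsiB.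
have [i4 _] := integral_mul_le mO Ooo q1 (ltW B0) (partial_in_Lq i (test_C1c teta)) mpsi psiB.
have Eeta := weak_gradient_test teta tpsi i.
have eq1 : (\int[mu]_(x in Omega) (v x * partial i psi x)%:E =
    \int[mu]_(x in Omega) ((v x - eta x) * partial i psi x)%:E +
    \int[mu]_(x in Omega) (eta x * partial i psi x)%:E)%E.
  rewrite -integralD//; apply: eq_integral => x _; rewrite -EFinD; congr (_%:E); ring.
have eq2 : (\int[mu]_(x in Omega) (G x ord0 i * psi x)%:E =
    \int[mu]_(x in Omega) ((G x ord0 i - partial i eta x) * psi x)%:E +
    \int[mu]_(x in Omega) (partial i eta x * psi x)%:E)%E.
  rewrite -integralD//; apply: eq_integral => x _; rewrite -EFinD; congr (_%:E); ring.
have Eeta' : (\int[mu]_(x in Omega) (eta x * partial i psi x)%:E =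
    - \int[mu]_(x in Omega) (partial i eta x * psi x)%:E)%E.
  by rewrite Eeta; congr (- _)%E; apply: eq_integral => x _; rewrite mxE.
move: eq1 eq2 Eeta' b1 b2; rewrite -(fineK fA) -(fineK fB).
rewrite -(fineK (integrable_fin_num mO i1)) -(fineK (integrable_fin_num mO i2)).
rewrite -(fineK (integrable_fin_num mO i3)) -(fineK (integrable_fin_num mO i4)).
rewrite -/X -/Y; set a1 := fine _; set a2 := fine _; set a3 := fine _; set a4 := fine _.
rewrite -!EFinD -EFinN => -[XE] [YE] [E3] b1 b2.
have n1 : (norm_Lq Omega q (fun x => v x - eta x)%R <= e'%:E)%E.
  exact: (le_trans (norm_Lq_le_W1q _ _) (ltW Heta)).
have n2 : (norm_Lq Omega q (fun x => G x ord0 i - partial i eta x)%R <= e'%:E)%E.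
  by rewrite -normG; apply: (le_trans _ (ltW Heta)); exact: norm_grad_le_W1q.
have {}b1 : `|a1| <= B' * c * e'.
  rewrite -lee_fin EFinM (le_trans b1)//; apply: lee_wpmul2l => //.
  by rewrite lee_fin mulr_ge0// ltW.
have {}b2 : `|a3| <= B * c * e'.
  rewrite -lee_fin EFinM (le_trans b2)//; apply: lee_wpmul2l => //.
  by rewrite lee_fin mulr_ge0// ltW.
have -> : X + Y = a1 + a3 by rewrite XE YE E3; ring.
rewrite (le_trans (ler_normD _ _))// (le_trans (lerD b1 b2))//.
rewrite (_ : e = ((B' + B) * c + 1) * e'); last first.
  by rewrite /e' mulrC divfK// gt_eqF.
by rewrite -mulrDl -mulrDl ler_wpM2r ?(ltW e'0)// lerDl.
Qed.

End sobolev_space.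

(** * Truncation maps [W_0^{1,q}] into itself *)

Section truncation_Lq.
Context {R : realType}.

Definition below (k s : R) : R := if `|s| <= k then 1 else 0.

Lemma below_ge0 k s : 0 <= below k s.
Proof. by rewrite /below; case: ifP. Qed.

Lemma below_le1 k s : below k s <= 1.
Proof. by rewrite /below; case: ifP. Qed.

Lemma measurable_below d (T : measurableType d) (D : set T) (f : T -> R) k :
  measurable D -> measurable_fun D f -> measurable_fun D (fun x => below k (f x)).
Proof.
move=> mD mf.
have mb : measurable_fun setT (below k : measurableTypeR R -> R).
  by apply: measurable_fun_ifT => //; apply: measurable_fun_ler.
exact: measurableT_comp mb mf.
Qed.

Lemma measurable_trunc d (T : measurableType d) (D : set T) (f : T -> R) k :
  measurable D -> measurable_fun D f -> measurable_fun D (fun x => trunc k (f x)).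
Proof.
move=> mD mf; apply: measurable_maxr => //.
by apply: measurable_minr.
Qed.

Lemma continuous_trunc_reg k d : 0 < d -> continuous (@trunc_reg R k d).
Proof.
move=> d0 s; apply/differentiable_continuous/derivable1_diffP.
by case: (is_derive_trunc_reg k s d0).
Qed.

Lemma continuous_dtrunc_reg k d : 0 < d -> continuous (@dtrunc_reg R k d).
Proof.
move=> d0 s; have [l l0 lip] := dtrunc_reg_lip k d0.
apply/cvgrPdist_lt => e e0.
have el : 0 < e / l by rewrite divr_gt0.
have st : \forall t \near nbhs (s : R), `|s - t| < e / l.
  by move: (e / l) el => c c0; exact: (@cvgr_dist_lt _ R R (nbhs s) _ id s (@cvg_id _ _)).
apply: filterS st => t st; apply: (le_lt_trans (lip s t)).
by rewrite mulrC -ltr_pdivlMr.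
Qed.

Section approximation.
Context d (T : measurableType d) (mu : {measure set T -> \bar R}).
Context (O : set T) (q : R).
Hypothesis mO : measurable O.
Hypothesis Ooo : (mu O < +oo)%E.
Hypothesis q1 : 1 <= q.
Implicit Types v phi g h : T -> R.
Local Notation nrm := (Lq_norm_on mu O q).

Let D (N : nat) : R := N.+1%:R^-1.

Let D0 N : 0 < D N. Proof. by rewrite invr_gt0 ltr0n. Qed.

Let D1 N : D N <= 1. Proof. by rewrite invf_le1 ?ler1n// ltr0n. Qed.

Let DN : D @ \oo --> (0 : R). Proof. exact: cvg_harmonic. Qed.

Lemma measurable_trunc_reg k (c : R) v : 0 < c -> measurable_fun O v ->
  measurable_fun O (fun x => trunc_reg k c (v x)).
Proof.
move=> c0 mv; apply: measurableT_comp mv.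
by apply: continuous_measurable_fun; exact: continuous_trunc_reg.
Qed.

Lemma measurable_dtrunc_reg k (c : R) v : 0 < c -> measurable_fun O v ->
  measurable_fun O (fun x => dtrunc_reg k c (v x)).
Proof.
move=> c0 mv; apply: measurableT_comp mv.
by apply: continuous_measurable_fun; exact: continuous_dtrunc_reg.
Qed.

Lemma trunc_reg_Lq_cvg k v (e : R) : 0 <= k -> measurable_fun O v -> 0 < e ->
  \forall N \near \oo, (nrm (fun x => trunc k (v x) - trunc_reg k (D N) (v x))%R < e%:E)%E.
Proof.
move=> k0 mv e0; apply: (Lq_norm_on_cvg0 mO q1 (w := fun=> 2)) => //.
- move=> N; apply: measurable_funB; first exact: measurable_trunc.
  exact: measurable_trunc_reg.
- by apply: (Lq_on_bounded mO Ooo q1 (B := 2)) => // x _; rewrite ger0_norm.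
- move=> N x _; rewrite (ger0_norm (_ : 0 <= 2))//.
  by rewrite (le_trans (trunc_reg_approx _ _ _ _))// ler_piMr.
- move=> x _; apply/cvgr0Pnorm_lt => c c0.
  have c2 : 0 < c / 2 by rewrite divr_gt0.
  near=> N; apply: (le_lt_trans (trunc_reg_approx _ k0 (D0 N) (D1 N))).
  rewrite mulrC -ltr_pdivlMr// (le_lt_trans (ler_norm _))//.
  by near: N; exact: cvgr0_norm_lt.
Unshelve. all: by end_near. Qed.

(** Dominated convergence with majorant [2 |g|]. Each point eventually leaves the window excluded in
    [dtrunc_reg_approx], which gives the pointwise limit. *)
Lemma dtrunc_reg_Lq_cvg k v g (e : R) : 0 <= k -> measurable_fun O v ->
  Lq_on mu O q g -> 0 < e ->
  \forall N \near \oo,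
    (nrm (fun x => (below k (v x) - dtrunc_reg k (D N) (v x)) * g x)%R < e%:E)%E.
Proof.
move=> k0 mv [mg goo] e0.
apply: (Lq_norm_on_cvg0 mO q1 (w := fun x => 2 * g x)) => //.
- move=> N; apply: measurable_funM => //; apply: measurable_funB.
    exact: measurable_below.
  exact: measurable_dtrunc_reg.
- split; first exact: measurable_funM.
  by rewrite (Lq_norm_onZ mu mO q1)// lte_mul_pinfty.
- move=> N x _; rewrite !normrM ler_wpM2r// (ger0_norm (_ : 0 <= 2))//.
  rewrite (le_trans (ler_normB _ _))// (_ : 2 = 1 + 1)// lerD ?norm_dtrunc_reg//.
  by rewrite ger0_norm ?below_ge0// below_le1.
- move=> x _; rewrite -(mul0r (g x)); apply: cvgMl.
  apply/cvgr0Pnorm_lt => c c0.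
  have cond : \forall N \near \oo, `|v x| <= k \/ k + 2 * D N <= `|v x|.
    have [vk|vk] := leP `|v x| k; first by apply: nearW => N; left.
    have vk2 : 0 < (`|v x| - k) / 2 by rewrite divr_gt0// subr_gt0.
    near=> N; right.
    have : `|D N| < (`|v x| - k) / 2 by near: N; exact: cvgr0_norm_lt.
    have := ler_norm (D N); lra.
  near=> N; apply: (@le_lt_trans _ _ (D N)).
    by apply: dtrunc_reg_approx => //; near: N.
  by rewrite (le_lt_trans (ler_norm _))//; near: N; exact: cvgr0_norm_lt.
Unshelve. all: by end_near. Qed.

(** The factor [2] is the trivial bound on a difference of two values of [dtrunc_reg], the only one
    used where [g] is large. *)
Lemma tail_Lq_cvg g (e : R) : Lq_on mu O q g -> 0 < e ->
  \forall M \near \oo, (nrm (fun x => 2 * ((1 - below M%:R (g x)) * g x))%R < e%:E)%E.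
Proof.
move=> [mg goo] e0.
apply: (Lq_norm_on_cvg0 mO q1 (w := fun x => 2 * g x)) => //.
- move=> M; apply: measurable_funM => //; apply: measurable_funM => //.
  by apply: measurable_funB => //; exact: measurable_below.
- split; first exact: measurable_funM.
  by rewrite (Lq_norm_onZ mu mO q1)// lte_mul_pinfty.
- move=> M x _; rewrite !normrM ler_wpM2l// ler_piMl// ler_norml.
  have := below_ge0 M%:R (g x); have := below_le1 M%:R (g x); lra.
- move=> x _; apply: cvg_near_cst; near=> M.
  rewrite /below ifT ?subrr ?mul0r ?mulr0//.
  near: M; exact: nbhs_infty_ger.
Unshelve. all: by end_near. Qed.

Lemma trunc_reg_Lq_le k c v phi (e : R) : 0 < c -> measurable_fun O v ->
  measurable_fun O phi ->
  (nrm (fun x => trunc k (v x) - trunc_reg k c (v x))%R < e%:E)%E ->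
  (nrm (fun x => v x - phi x)%R <= e%:E)%E ->
  (nrm (fun x => trunc k (v x) - trunc_reg k c (phi x))%R < (e + e)%:E)%E.
Proof.
move=> c0 mv mphi H1 H2.
rewrite (eq_Lq_norm_on mu q1 (w := fun x => (trunc k (v x) - trunc_reg k c (v x)) +
  (trunc_reg k c (v x) - trunc_reg k c (phi x)))); last by move=> x _; ring.
have m1 : measurable_fun O (fun x => trunc k (v x) - trunc_reg k c (v x)).
  by apply: measurable_funB; [exact: measurable_trunc|exact: measurable_trunc_reg].
have m2 : measurable_fun O (fun x => trunc_reg k c (v x) - trunc_reg k c (phi x)).
  by apply: measurable_funB; exact: measurable_trunc_reg.
apply: (le_lt_trans (Lq_norm_onD mu mO q1 m1 m2)).
have b2 : (nrm (fun x => trunc_reg k c (v x) - trunc_reg k c (phi x))%R <= e%:E)%E.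
  apply: le_trans _ H2.
  apply: (le_Lq_norm_on mu mO q1) => //; first exact: measurable_funB.
  by move=> x _; exact: trunc_reg_lip.
rewrite EFinD; apply: lte_leD => //.
by rewrite ge0_fin_numE ?Lq_norm_on_ge0// (le_lt_trans b2)// ltry.
Qed.

(** The difficulty is the product [(dtrunc_reg (v) - dtrunc_reg (phi)) g]: closeness of [phi] to [v]
    in [L^q] does not control it for unbounded [g]. It is therefore cut at [|g| = M]. Above, [f2] is
    a tail of [g]; below, [f3] is at most [l M |v - phi|]. The terms [f1] and [f4] are the errors of
    regularisation and of the gradient. *)
Lemma dtrunc_reg_Lq_le k c l (M : nat) v phi g h (e e' : R) : 0 < c -> 0 < l ->
  (forall s t, `|dtrunc_reg k c s - dtrunc_reg k c t| <= l * `|s - t|) ->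
  measurable_fun O v -> measurable_fun O phi -> measurable_fun O g ->
  measurable_fun O h ->
  (nrm (fun x => (below k (v x) - dtrunc_reg k c (v x)) * g x)%R <= e%:E)%E ->
  (nrm (fun x => 2 * ((1 - below M%:R (g x)) * g x))%R <= e%:E)%E ->
  (nrm (fun x => v x - phi x)%R <= e'%:E)%E ->
  (nrm (fun x => g x - h x)%R <= e'%:E)%E ->
  l * M%:R * e' <= e -> e' <= e ->
  (nrm (fun x => below k (v x) * g x - dtrunc_reg k c (phi x) * h x)%R <= (4 * e)%:E)%E.
Proof.
move=> c0 l0 lip mv mphi mg mh H1 H2 H3 H4 le1 le2.
pose f1 x := (below k (v x) - dtrunc_reg k c (v x)) * g x.
pose del x := dtrunc_reg k c (v x) - dtrunc_reg k c (phi x).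
pose f2 x := del x * ((1 - below M%:R (g x)) * g x).
pose f3 x := del x * (below M%:R (g x) * g x).
pose f4 x := dtrunc_reg k c (phi x) * (g x - h x).
have mdv := measurable_dtrunc_reg k c0 mv.
have mdphi := measurable_dtrunc_reg k c0 mphi.
have mdel : measurable_fun O del by exact: measurable_funB.
have mbG : measurable_fun O (fun x => below M%:R (g x)) by exact: measurable_below.
have mbv : measurable_fun O (fun x => below k (v x)) by exact: measurable_below.
have m1 : measurable_fun O f1.
  by apply: measurable_funM => //; exact: measurable_funB.
have mt : measurable_fun O (fun x => (1 - below M%:R (g x)) * g x).
  by apply: measurable_funM => //; exact: measurable_funB.
have m2 : measurable_fun O f2 by exact: measurable_funM.
have m3 : measurable_fun O f3.
  by apply: measurable_funM => //; exact: measurable_funM.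
have m4 : measurable_fun O f4.
  by apply: measurable_funM => //; exact: measurable_funB.
rewrite (eq_Lq_norm_on mu q1 (w := fun x => f1 x + (f2 x + (f3 x + f4 x)))); last first.
  by move=> x _; rewrite /f1 /f2 /f3 /f4 /del; ring.
have -> : 4 * e = e + (e + (e + e)) by ring.
have m34 : measurable_fun O (fun x => f3 x + f4 x) by exact: measurable_funD.
have m234 : measurable_fun O (fun x => f2 x + (f3 x + f4 x)) by exact: measurable_funD.
apply: (le_trans (Lq_norm_onD mu mO q1 m1 m234)); rewrite EFinD; apply: leeD => //.
apply: (le_trans (Lq_norm_onD mu mO q1 m2 m34)); rewrite EFinD; apply: leeD.
  apply: le_trans _ H2; apply: (le_Lq_norm_on mu mO q1) => //.
    exact: measurable_funM.
  move=> x _; rewrite normrM [leRHS]normrM ler_wpM2r// (ger0_norm (_ : 0 <= 2))//.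
  by rewrite (le_trans (ler_normB _ _))// (_ : 2 = 1 + 1)// lerD// norm_dtrunc_reg.
apply: (le_trans (Lq_norm_onD mu mO q1 m3 m4)); rewrite EFinD; apply: leeD.
  apply: (@le_trans _ _ (nrm (fun x => (l * M%:R) * (v x - phi x)))).
    apply: (le_Lq_norm_on mu mO q1) => //.
      by apply: measurable_funM => //; exact: measurable_funB.
    move=> x _; rewrite normrM [leRHS]normrM (ger0_norm (mulr_ge0 (ltW l0) (ler0n _ _))).
    rewrite mulrAC; apply: ler_pM => //; first exact: lip.
    rewrite /below; case: ifPn => GM; last by rewrite mul0r normr0.
    by rewrite mul1r.
  rewrite (Lq_norm_onZ mu mO q1); last exact: measurable_funB.
  rewrite ger0_norm ?mulr_ge0 ?(ltW l0)//.
  apply: (@le_trans _ _ ((l * M%:R) * e')%:E); last by rewrite lee_fin.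
  rewrite [leRHS]EFinM; apply: lee_wpmul2l => //.
  by rewrite lee_fin mulr_ge0// ltW.
apply: (@le_trans _ _ e'%:E); last by rewrite lee_fin.
apply: le_trans _ H4; apply: (le_Lq_norm_on mu mO q1) => //.
  exact: measurable_funB.
by move=> x _; rewrite normrM ler_piMl// norm_dtrunc_reg.
Qed.

End approximation.
End truncation_Lq.

Section truncation_W1q0.
Context {R : realType} {n : nat} (Omega : set 'rV[R]_n) (q : R).
Local Notation mu := (@leb R n).
Local Notation L := (lebesgue_rV R n).
Hypothesis oO : open Omega.
Hypothesis bO : bounded_set Omega.
Hypothesis q1 : 1 <= q.
Implicit Types (v w phi psi : 'rV[R]_n -> R) (G H : 'rV[R]_n -> 'rV[R]_n).

Let mO := measurable_open_rV oO.
Let Ooo := leb_open_lty oO bO.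

(** The order of choices matters. The regularisation index [N] and the gradient cut [M] are fixed
    first; they determine the Lipschitz constant [l], large when [N] is; only then is [phi] taken
    within [d / (1 + l M)] of [v]. *)
Lemma in_W1q0_trunc k v G : 0 <= k -> in_W1q0 Omega q v G ->
  in_W1q0 Omega q (fun x => trunc k (v x)) (fun x => below k (v x) *: G x).
Proof.
move=> k0 [[Lv LG _] approx].
have mv := Lv.1; have mG i := (LG i).1.
have mtv : measurable_fun (Omega : set L) (fun x => trunc k (v x)).
  exact: measurable_trunc mO mv.
have mbv : measurable_fun (Omega : set L) (fun x => below k (v x)).
  exact: measurable_below mO mv.
apply: (in_W1q0_closure oO bO q1 mtv).
  move=> i; rewrite (_ : (fun _ => _) = (fun x => below k (v x) * G x ord0 i)).
    exact: (measurable_funM mbv (mG i)).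
  by apply/funext => x; rewrite mxE.
(* An error [2 d] for the function and [4 d] for each of the [n] components add up to at most
   [4 (n + 1) d = e]. *)
move=> e e0; pose d := e / (4 * n.+1%:R).
have n0 : 0 < 4 * n.+1%:R :> R by rewrite mulr_gt0// ltr0n.
have d0 : 0 < d by rewrite divr_gt0.
have S1 := trunc_reg_Lq_cvg mO Ooo q1 k0 mv d0.
have S2 := filter_forall _ (fun i => dtrunc_reg_Lq_cvg mO q1 k0 mv (LG i) d0).
have S3 := filter_forall _ (fun i => tail_Lq_cvg mO q1 (LG i) d0).
have [N [HN1 HN2]] := filter_ex (filterI S1 (S2 _)).
have [M HM] := filter_ex (S3 _).
have c0 : 0 < N.+1%:R^-1 :> R by rewrite invr_gt0 ltr0n.
have [l l0 lip] := dtrunc_reg_lip k c0.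
pose b := 1 + l * M%:R.
have b1 : 1 <= b by rewrite lerDl mulr_ge0// ltW.
have b0 : 0 < b by rewrite (lt_le_trans ltr01).
pose d' := d / b.
have d'0 : 0 < d' by rewrite divr_gt0.
have d'd : d' <= d by rewrite ler_pdivrMr// ler_peMr// ltW.
have cd : l * M%:R * d' <= d.
  by rewrite /d' mulrA ler_pdivrMr// mulrC ler_wpM2l ?(ltW d0)// lerDr.
have [phi tphi Hphi] := approx d' d'0.
have phi1 := test_C1c tphi.
have mphi := (C1c_in_Lq oO bO q1 phi1).1.
have mdphi i := (partial_in_Lq oO bO q1 i phi1).1.
have Hv : (norm_Lq Omega q (fun x => v x - phi x)%R <= d'%:E)%E.
  by apply: le_trans (ltW Hphi); exact: norm_Lq_le_W1q.
have HG i : (norm_Lq Omega q (fun x => G x ord0 i - partial i phi x)%R <= d'%:E)%E.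
  apply: (le_trans _ (ltW Hphi)).
  rewrite (_ : (fun x => _) =
      (fun x => (G x - \row_i0 partial i0 phi x) ord0 i)); last first.
    by apply/funext => x; rewrite !mxE.
  exact: (norm_grad_le_W1q _ _ _ _ i).
exists (fun x => trunc_reg k N.+1%:R^-1 (phi x)); first exact: test_trunc_reg.
have Hv' : (norm_Lq Omega q (fun x => v x - phi x)%R <= d%:E)%E.
  by apply: le_trans Hv _; rewrite lee_fin.
have B1 : (norm_Lq Omega q
    (fun x => trunc k (v x) - trunc_reg k N.+1%:R^-1 (phi x))%R < (d + d)%:E)%E.
  exact: (trunc_reg_Lq_le mO q1 c0 mv mphi HN1 Hv').
have B2 i : (norm_Lq Omega q (fun x => (below k (v x) *: G x -
    \row_i0 partial i0 (fun y => trunc_reg k N.+1%:R^-1 (phi y)) x) ord0 i)%R <=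
    (4 * d)%:E)%E.
  have := dtrunc_reg_Lq_le mO q1 c0 l0 lip mv mphi (mG i) (mdphi i)
    (ltW (HN2 i)) (ltW (HM i)) Hv (HG i) cd d'd.
  apply: le_trans; rewrite le_eqVlt; apply/orP; left; apply/eqP.
  congr norm_Lq; apply/funext => x.
  by rewrite !mxE (partial_trunc_reg k i x c0 tphi).
apply: (@lt_le_trans _ _ ((d + d)%:E + \sum_(i < n) (4 * d)%:E)%E).
  have B3 : (\sum_(i < n) norm_Lq Omega q (fun x => (below k (v x) *: G x -
      \row_i0 partial i0 (fun y => trunc_reg k N.+1%:R^-1 (phi y)) x) ord0 i)%R <=
      \sum_(i < n) (4 * d)%:E)%E.
    by apply: lee_sum => i _; exact: B2.
  apply: lte_leD => //; rewrite ge0_fin_numE.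
    by rewrite (le_lt_trans B3)// sumEFin ltry.
  by apply: sume_ge0 => i _; exact: Lnorm_ge0.
rewrite sumEFin -EFinD lee_fin sumr_const card_ord.
rewrite -mulr_natr (_ : e = 4 * n.+1%:R * d); last by rewrite /d mulrC divfK// gt_eqF.
rewrite -natr1; nra.
Qed.

Lemma in_W1q0_zero : in_W1q0 Omega q (fun=> 0) (fun=> 0).
Proof.
apply: (in_W1q0_closure oO bO q1) => [|i|e e0].
- exact: measurable_cst.
- exact: measurable_cst.
exists (fun=> 0).
  have s0 : [set x : 'rV[R]_n | (0 : R) != 0] = set0.
    by apply/seteqP; split=> x //=; rewrite eqxx.
  split; first by move=> k; exact: Ck_cst.
  - by rewrite s0 closure0; exact: compact0.
  - by rewrite s0 closure0.
have z : norm_Lq Omega q (fun=> 0) = 0%E.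
  rewrite /norm_Lq (_ : EFin \o _ = cst 0%E) ?Lnorm0//; last first.
    by apply/funext => x /=; rewrite patchE; case: ifP.
  by rewrite eqe gt_eqF// (lt_le_trans ltr01).
rewrite /norm_W1q big1 => [|i _].
  rewrite adde0 (_ : (fun=> _) = (fun=> 0)) ?z ?lte_fin//.
  by apply/funext => x; rewrite subrr.
rewrite (_ : (fun x => _) = (fun=> 0))//.
by apply/funext => x; rewrite !mxE /partial derive_cst subrr.
Qed.

End truncation_W1q0.

(** * Passing an [L^s] bound to an [L^q] limit *)

Section capped_power.
Context {R : realType}.

(** The cap makes the power globally Lipschitz, with constant [s M ^ (s - 1)], so that its integral
    is stable under [L^1] perturbations. *)
Definition cap (M s y : R) : R := Num.min `|y| M `^ s.

Lemma cap_ge0 M s y : 0 <= cap M s y. Proof. exact: powR_ge0. Qed.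

Lemma powR_lip (s M a b : R) : 1 <= s -> 0 <= b -> b <= a -> a <= M ->
  a `^ s - b `^ s <= s * M `^ (s - 1) * (a - b).
Proof.
move=> s1 b0 ba aM.
have s0 : 0 < s by rewrite (lt_le_trans ltr01).
move: s1; rewrite le_eqVlt => /predU1P[<-|s1].
  by rewrite subrr powRr0 !mul1r !powRr1// (le_trans b0).
move: ba; rewrite le_eqVlt => /predU1P[->|ba]; first by rewrite !subrr mulr0.
have dg (t : R) : is_derive t (1 : R) (fun y => `|y| `^ s) (s * spow (s - 1) t).
  exact: is_derive_norm_powR.
have [|c] := MVT ba (fun x _ => dg x).
  apply: continuous_subspaceT => x.
  by apply/differentiable_continuous/derivable1_diffP; case: (dg x).
have a0 : 0 <= a by rewrite (le_trans b0 (ltW ba)).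
rewrite in_itv/= => /andP[bc ca]; rewrite !ger0_norm// => ->.
have c0 : 0 < c by rewrite (le_lt_trans b0).
rewrite ler_wpM2r ?subr_ge0 ?(ltW ba)// ler_wpM2l ?(ltW s0)// spow_gt0//.
apply: ge0_ler_powR; rewrite ?nnegrE ?subr_ge0 ?(ltW s1) ?(ltW c0)//.
  by rewrite (le_trans a0).
by rewrite (le_trans (ltW ca)).
Qed.

Lemma cap_le_add (s M y z : R) : 1 <= s -> 0 <= M ->
  cap M s y <= cap M s z + s * M `^ (s - 1) * `|y - z|.
Proof.
move=> s1 M0; have s0 : 0 < s by rewrite (lt_le_trans ltr01).
have m0 (t : R) : 0 <= Num.min `|t| M by rewrite le_min normr_ge0.
have [yz|zy] := leP (Num.min `|y| M) (Num.min `|z| M).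
  rewrite -[leLHS]addr0 lerD ?mulr_ge0 ?powR_ge0 ?(ltW s0)//.
  by apply: ge0_ler_powR; rewrite ?nnegrE ?(ltW s0).
have yM : Num.min `|y| M <= M by rewrite ge_min lexx orbT.
rewrite -lerBlDl; apply: (le_trans (powR_lip s1 (m0 z) (ltW zy) yM)).
rewrite ler_wpM2l ?mulr_ge0 ?powR_ge0 ?(ltW s0)//.
have zM : `|z| < M.
  rewrite ltNge; apply/negP => Mz.
  by move: zy; rewrite [X in X < _](min_r Mz) ltNge yM.
rewrite [Num.min `|z| M]min_l ?(ltW zM)//.
rewrite (le_trans _ (lerB_dist y z))// lerB//.
by rewrite ge_min lexx.
Qed.

End capped_power.

Section Fatou_power.
Context d (T : measurableType d) (R : realType) (mu : {measure set T -> \bar R}).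
Context (O : set T) (q s : R).
Hypothesis mO : measurable O.
Hypothesis Ooo : (mu O < +oo)%E.
Hypothesis q1 : 1 <= q.
Hypothesis s1 : 1 <= s.

Let s0 : 0 < s. Proof. exact: lt_le_trans s1. Qed.

Let mcap M (v : T -> R) : measurable_fun O v ->
  measurable_fun O (fun x => (cap M s (v x))%:E).
Proof.
move=> mv; apply/measurable_EFinP; apply: (measurableT_comp (measurable_powR s)).
by apply: measurable_minr => //; exact: measurableT_comp.
Qed.

(** A substitute for Fatou along an almost everywhere convergent subsequence: at a fixed cap [M] the
    bound passes to the limit by Lipschitz continuity, then [M] tends to infinity by monotone
    convergence. *)
Lemma integral_powR_closure (w : T -> R) (C K : R) : 0 <= C -> 0 <= K ->
  measurable_fun O w ->
  (forall e, 0 < e -> exists phi : T -> R, [/\ measurable_fun O phi,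
    (Lq_norm_on mu O q (fun x => w x - phi x)%R <= e%:E)%E &
    (\int[mu]_(x in O) (`|phi x| `^ s)%:E <= ((C * (K + e)) `^ s)%:E)%E]) ->
  (\int[mu]_(x in O) (`|w x| `^ s)%:E <= ((C * K) `^ s)%:E)%E.
Proof.
move=> C0 K0 mw H.
have bound M : 0 <= M ->
    (\int[mu]_(x in O) (cap M s (w x))%:E <= ((C * K) `^ s)%:E)%E.
  move=> M0; apply/lee_addgt0Pr => e e0.
  pose b := fine (mu O) `^ (1 - q^-1).
  (* The total cost of replacing [w] by an approximant at distance [e'] is [A e']: the first summand
     comes from the capped power, the second from [(C (K + e')) ^ s] with [e' <= 1]. *)
  pose A := s * M `^ (s - 1) * b + s * (C * (K + 1)) `^ (s - 1) * C.
  have b0 : 0 <= b by exact: powR_ge0.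
  have cM : 0 <= s * M `^ (s - 1) by rewrite mulr_ge0 ?powR_ge0 ?(ltW s0).
  have A0 : 0 <= A.
    by rewrite addr_ge0// mulr_ge0// mulr_ge0 ?powR_ge0 ?(ltW s0).
  pose e' := Num.min 1 (e / (A + 1)).
  have A1 : 0 < A + 1 by rewrite ltr_wpDl.
  have e'0 : 0 < e' by rewrite lt_min ltr01 divr_gt0.
  have e'1 : e' <= 1 by rewrite ge_min lexx.
  have e'e : A * e' <= e.
    apply: (@le_trans _ _ ((A + 1) * e')).
      by rewrite ler_wpM2r ?(ltW e'0)// lerDl.
    by rewrite mulrC -ler_pdivlMr// ge_min lexx orbT.
  have [phi [mphi Hphi Sphi]] := H e' e'0.
  have mwp : measurable_fun O (fun x => w x - phi x) by exact: measurable_funB.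
  have mn : measurable_fun O (fun x => `|w x - phi x|%:E).
    by apply/measurable_EFinP; exact: measurableT_comp.
  have mcM : measurable_fun O (fun x => (s * M `^ (s - 1))%:E * `|w x - phi x|%:E)%E.
    exact: emeasurable_funM.
  apply: (@le_trans _ _ (\int[mu]_(x in O) ((cap M s (phi x))%:E +
      (s * M `^ (s - 1))%:E * `|w x - phi x|%:E))%E).
    apply: ge0_le_integral => //.
    - by move=> x _; rewrite lee_fin cap_ge0.
    - exact: mcap.
    - by apply: emeasurable_funD => //; exact: mcap.
    - by move=> x _; rewrite -EFinM -EFinD lee_fin cap_le_add.
  rewrite ge0_integralD//; last 3 first.
  - by move=> x _; rewrite lee_fin cap_ge0.
  - exact: mcap.
  - by move=> x _; rewrite -EFinM lee_fin mulr_ge0.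
  rewrite ge0_integralZl//.
  apply: (@le_trans _ _ (((C * (K + e')) `^ s)%:E + (s * M `^ (s - 1))%:E * (b * e')%:E)%E).
    apply: leeD.
      apply: (le_trans _ Sphi); apply: ge0_le_integral => //.
      - by move=> x _; rewrite lee_fin cap_ge0.
      - exact: mcap.
      - apply/measurable_EFinP; apply: (measurableT_comp (measurable_powR s)).
        exact: measurableT_comp.
      - move=> x _; rewrite lee_fin; apply: ge0_ler_powR; rewrite ?nnegrE ?(ltW s0)//.
          by rewrite le_min normr_ge0.
        by rewrite ge_min lexx.
    apply: lee_wpmul2l => //; apply: (le_trans (integral_norm_le mO Ooo q1 mwp)).
    by rewrite EFinM; apply: lee_wpmul2l.
  rewrite -EFinM -!EFinD lee_fin.
  have CK : C * K <= C * (K + e') by rewrite ler_wpM2l// lerDl ltW.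
  have CK1 : C * (K + e') <= C * (K + 1) by rewrite ler_wpM2l// lerD2l.
  have := powR_lip s1 (mulr_ge0 C0 K0) CK CK1.
  rewrite -mulrBr (addrC K e') addrK => HL.
  have : A * e' = s * M `^ (s - 1) * (b * e') + s * (C * (K + 1)) `^ (s - 1) * (C * e').
    by rewrite /A; ring.
  lra.
pose g M x := (cap M%:R s (w x))%:E.
have mg (M : nat) : measurable_fun O (g M) by exact: mcap.
have g0 (M : nat) x : O x -> (0 <= g M x)%E by move=> _; rewrite lee_fin cap_ge0.
have nd x : O x -> {homo g ^~ x : M N / (M <= N)%N >-> (M <= N)%E}.
  move=> _ M N MN; rewrite lee_fin; apply: ge0_ler_powR; rewrite ?nnegrE ?(ltW s0)//.
  - by rewrite le_min !ge_min lexx/= ler_nat MN orbT.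
have lim x : limn (g ^~ x) = (`|w x| `^ s)%:E.
  apply/cvg_lim => //; apply: cvg_near_cst; near=> M.
  rewrite /g /cap min_l//; near: M; exact: nbhs_infty_ger.
rewrite (eq_integral (fun x => limn (g ^~ x))); last by move=> x _; rewrite lim.
rewrite monotone_convergence//; apply: lime_le.
  apply: ereal_nondecreasing_is_cvgn => M N MN; apply: ge0_le_integral => //.
  - by move=> x Ox; exact: g0.
  - by move=> x Ox; exact: nd.
by apply: nearW => M; exact: bound.
Unshelve. all: by end_near. Qed.

End Fatou_power.

(** * Differences and the Sobolev inequality in [W_0^{1,q}] *)

Section W1q0_sobolev.
Context {R : realType} {n : nat}.

Lemma test_functionB (Omega : set 'rV[R]_n) phi psi :
  test_function Omega phi -> test_function Omega psi ->
  test_function Omega (fun x => phi x - psi x).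
Proof.
move=> [kphi cphi sphi] [kpsi cpsi spsi].
have sub : closed_support (fun x => phi x - psi x) `<=`
    closed_support phi `|` closed_support psi.
  rewrite /closed_support -closureU; apply: closure_subset => x /= H.
  have [phi0|] := eqVneq (phi x) 0; last by left.
  by right; apply: contra H => /eqP ->; rewrite phi0 subrr.
split=> [k||].
- rewrite (_ : (fun _ => _) = (fun x => phi x + -1 * psi x)).
    by apply: Ck_add => //; apply: Ck_mul => //; exact: Ck_cst.
  by apply/funext => x; rewrite mulN1r.
- apply: (@subclosed_compact _ _ (closed_support phi `|` closed_support psi)) => //.
    exact: closed_closure.
  exact: compactU.
- by apply: (subset_trans sub) => x [/sphi|/spsi].
Qed.

Lemma partialB phi psi i x : C1c phi -> C1c psi ->
  partial i (fun x : 'rV[R]_n => phi x - psi x) x = partial i phi x - partial i psi x.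
Proof. by move=> p1 p2; rewrite /partial deriveB//; exact: C1c_derivable. Qed.

Section open_bounded.
Context (Omega : set 'rV[R]_n) (q : R).
Local Notation mu := (@leb R n).
Local Notation L := (lebesgue_rV R n).
Hypothesis oO : open Omega.
Hypothesis bO : bounded_set Omega.
Hypothesis q1 : 1 <= q.

Let mO := measurable_open_rV oO.

Let norm_LqB (v w phi psi : 'rV[R]_n -> R) :
  measurable_fun (Omega : set L) v -> measurable_fun (Omega : set L) w ->
  measurable_fun (Omega : set L) phi -> measurable_fun (Omega : set L) psi ->
  (norm_Lq Omega q (fun x => v x - w x - (phi x - psi x))%R <=
   norm_Lq Omega q (fun x => v x - phi x)%R + norm_Lq Omega q (fun x => w x - psi x)%R)%E.
Proof.
move=> mv mw mphi mpsi.
have := Lq_norm_onN mu Omega q1 (fun x => w x - psi x).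
rewrite -[norm_Lq Omega q (fun x => w x - psi x)]/(Lq_norm_on mu Omega q _) => <-.
rewrite (_ : (fun x => _) = (fun x => (v x - phi x) + - (w x - psi x))); last first.
  by apply/funext => x; ring.
apply: (Lq_norm_onD mu mO q1); first exact: measurable_funB.
exact: (measurable_funN (measurable_funB mw mpsi)).
Qed.

Lemma in_W1q0B v w G H : in_W1q0 Omega q v G -> in_W1q0 Omega q w H ->
  in_W1q0 Omega q (fun x => v x - w x) (fun x => G x - H x).
Proof.
move=> [[Lv LG _] av] [[Lw LH _] aw].
apply: (in_W1q0_closure oO bO q1).
- exact: (measurable_funB Lv.1 Lw.1).
- move=> i; rewrite (_ : (fun _ => _) = (fun x => G x ord0 i - H x ord0 i)).
    exact: (measurable_funB (LG i).1 (LH i).1).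
  by apply/funext => x; rewrite !mxE.
move=> e e0; have e20 : 0 < e / 2 by rewrite divr_gt0.
have [phi tphi Hphi] := av _ e20; have [psi tpsi Hpsi] := aw _ e20.
have phi1 := test_C1c tphi; have psi1 := test_C1c tpsi.
exists (fun x => phi x - psi x); first exact: test_functionB.
apply: (@le_lt_trans _ _ (norm_W1q Omega q (fun x => v x - phi x)%R
      (fun x => G x - \row_i partial i phi x)%R +
    norm_W1q Omega q (fun x => w x - psi x)%R
      (fun x => H x - \row_i partial i psi x)%R)%E); last first.
  rewrite (splitr e) EFinD; exact: (lteD Hphi Hpsi).
rewrite /norm_W1q addeACA -big_split/=; apply: leeD.
  exact: (norm_LqB Lv.1 Lw.1 (C1c_in_Lq oO bO q1 phi1).1 (C1c_in_Lq oO bO q1 psi1).1).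
apply: lee_sum => i _.
have := norm_LqB (LG i).1 (LH i).1 (partial_in_Lq oO bO q1 i phi1).1
  (partial_in_Lq oO bO q1 i psi1).1.
congr (_ <= _ + _)%E; congr norm_Lq; apply/funext => x; rewrite !mxE//.
by rewrite partialB.
Qed.

End open_bounded.

End W1q0_sobolev.

Section sobolev_embedding.
Context {R : realType} {n : nat} (Omega : set 'rV[R]_n.+1) (q : R).
Local Notation mu := (@leb R n.+1).
Local Notation L := (lebesgue_rV R n.+1).
Local Notation N := (n.+1%:R : R).

(** A test function within [e] of [w] has gradient components of norm at most [K + e], and vanishes
    off [Omega], so [sobolev_C1c] on the whole space applies to it; [integral_powR_closure] lets [e]
    go to zero. *)
Lemma sobolev_W1q0 w H K : open Omega -> bounded_set Omega -> (0 < n)%N ->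
  1 < q -> q < N -> in_W1q0 Omega q w H -> 0 <= K ->
  (forall i, norm_Lq Omega q (fun x => H x ord0 i) <= K%:E)%E ->
  (\int[mu]_(x in Omega) (`|w x| `^ (q * N / (N - q)))%:E <=
    ((q * n%:R / (N - q) * K) `^ (q * N / (N - q)))%:E)%E.
Proof.
move=> oO bO n0 q1 qN [[Lw LH _] aw] K0 HK.
have mO := measurable_open_rV oO; have q1' := ltW q1.
have Nq : 0 < N - q by rewrite subr_gt0.
have s1 : 1 <= q * N / (N - q).
  by rewrite ler_pdivlMr// mul1r; have := ler0n R n.+1; nra.
have C0 : 0 <= q * n%:R / (N - q).
  by rewrite divr_ge0 ?(ltW Nq)// mulr_ge0 ?ler0n// (le_trans ler01).
apply: (integral_powR_closure mO (leb_open_lty oO bO) q1' s1 C0 K0 Lw.1) => e e0.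
have [phi tphi Hphi] := aw e e0; have phi1 := test_C1c tphi.
exists phi; split.
- exact: (C1c_in_Lq oO bO q1' phi1).1.
- exact: (le_trans (norm_Lq_le_W1q _ _ _ _) (ltW Hphi)).
have Ke0 : 0 <= K + e by rewrite addr_ge0// ltW.
rewrite integral_in_setT; last first.
  by move=> x Ox; rewrite (test_outside tphi Ox) normr0 powR0// gt_eqF// (lt_le_trans ltr01).
apply: (sobolev_C1c n0 q1 qN phi1 Ke0) => i.
rewrite -(@integral_in_setT _ _ Omega); last first.
  move=> x Ox; rewrite (test_partial_outside i tphi Ox) normr0 powR0// gt_eqF//.
  by rewrite (lt_trans ltr01).
rewrite (integral_Lq_norm_onE mu Omega q1') -poweR_EFin.
apply: (lee_poweR (le_trans ler01 q1') (Lq_norm_on_ge0 mu Omega q _)).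
have mH := (LH i).1; have mp := (partial_in_Lq oO bO q1' i phi1).1.
rewrite (_ : partial i phi =
    (fun x => H x ord0 i + - (H x ord0 i - partial i phi x))); last first.
  by apply/funext => x; rewrite opprB addrC subrK.
have mHp := measurable_funB mH mp.
apply: (le_trans (Lq_norm_onD mu mO q1' mH (measurable_funN mHp))).
rewrite EFinD; apply: leeD; first exact: HK.
rewrite (Lq_norm_onN mu Omega q1').
apply: (le_trans _ (ltW Hphi)).
rewrite [X in (X <= _)%E](_ : _ = norm_Lq Omega q
    (fun x => (H x - \row_i0 partial i0 phi x) ord0 i)).
  exact: (norm_grad_le_W1q _ _ _ _ i).
by congr norm_Lq; apply/funext => x; rewrite !mxE.
Qed.

End sobolev_embedding.
Import HBNNSimple.

(** * Integrals of nonnegative functions that may fail to be measurable *)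

Section lower_integral.
Context d (T : measurableType d) (R : realType) (mu : {measure set T -> \bar R}).
Local Open Scope ereal_scope.
Implicit Types F g D : T -> \bar R.

Lemma ge0_integral_leP F C : (forall x, 0 <= F x) ->
  (forall h : {nnsfun T >-> R}, (forall x, (h x)%:E <= F x) ->
    \int[mu]_x (h x)%:E <= C) ->
  \int[mu]_x F x <= C.
Proof.
move=> F0 H; rewrite ge0_integralTE//; apply: ge_ereal_sup => _ [h hF <-].
by rewrite -integralT_nnsfun; exact: H.
Qed.

Lemma le_lower_integral F1 F2 : (forall x, 0 <= F1 x) ->
  (forall x, F1 x <= F2 x) -> \int[mu]_x F1 x <= \int[mu]_x F2 x.
Proof.
move=> F10 F12; have F20 x : 0 <= F2 x by exact: le_trans (F12 x).
apply: ge0_integral_leP => // h hF; rewrite integralT_nnsfun [leRHS]ge0_integralTE//.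
by apply: ereal_sup_ubound; exists h => // x; exact: le_trans (F12 x).
Qed.

Lemma le_lower_integral_ae F1 F2 N : measurable N -> mu N = 0 ->
  (forall x, 0 <= F1 x) -> (forall x, 0 <= F2 x) ->
  (forall x, ~ N x -> F1 x <= F2 x) -> \int[mu]_x F1 x <= \int[mu]_x F2 x.
Proof.
move=> mN N0 F10 F20 F12; apply: ge0_integral_leP => // h hF.
rewrite (ge0_negligible_integral mN)//; last first.
- by move=> x _; rewrite lee_fin.
- by apply/measurable_EFinP.
rewrite integral_mkcond; apply: le_lower_integral => x; rewrite patchE.
  by case: ifP => // _; rewrite lee_fin.
case: ifPn => [|_]; last exact: F20.
by rewrite inE => -[_ Nx]; exact: le_trans (F12 _ Nx).
Qed.

(** If [h] is simple and below [F1], then [h + g] is measurable and below [F] off the null set, so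
    its integral splits; the supremum over [h] concludes. Subtracting the integral of [g] requires
    it finite, and if it is infinite so is that of [F]. *)
Lemma lower_integral_superadditive F1 g F N : measurable N -> mu N = 0 ->
  measurable_fun setT g ->
  (forall x, 0 <= F1 x) -> (forall x, 0 <= g x) -> (forall x, 0 <= F x) ->
  (forall x, ~ N x -> F1 x + g x <= F x) ->
  \int[mu]_x F1 x + \int[mu]_x g x <= \int[mu]_x F x.
Proof.
move=> mN N0 mg F10 g0 F0 H.
have gF : \int[mu]_x g x <= \int[mu]_x F x.
  apply: (le_lower_integral_ae mN) => // x Nx.
  by apply: le_trans (H _ Nx); rewrite leeDr.
have [goo|goo] := eqVneq (\int[mu]_x g x) +oo.
  by move: gF; rewrite goo leye_eq => /eqP ->; rewrite leey.
have gfin : \int[mu]_x g x \is a fin_num.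
  by rewrite ge0_fin_numE ?lt_neqAle ?goo ?leey// integral_ge0.
rewrite -leeBrDr//; apply: ge0_integral_leP => // h hF; rewrite leeBrDr//.
rewrite -ge0_integralD//; first last.
- by apply/measurable_EFinP.
- by move=> x _; rewrite lee_fin.
apply: (le_lower_integral_ae mN) => // [x|x Nx].
  by rewrite adde_ge0// lee_fin.
by apply: le_trans (H _ Nx); rewrite leeD2r.
Qed.

(** The integral is a difference of two suprema; almost everywhere nonnegativity annihilates the one
    for the negative part. *)
Lemma ae_ge0_integralE D S N : measurable N -> mu N = 0 ->
  (forall x, S x -> ~ N x -> 0 <= D x) ->
  \int[mu]_(x in S) D x = \int[mu]_x (D \_ S)^\+ x.
Proof.
move=> mN N0 D0; rewrite integral_mkcond integralE [X in _ - X](_ : _ = 0) ?sube0//.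
apply/eqP; rewrite eq_le integral_ge0// andbT -(integral0 mu setT).
apply: (le_lower_integral_ae mN) => // x Nx; rewrite funenegE ge_max lexx andbT.
rewrite patchE; case: ifPn => [|_]; last by rewrite oppe0.
by rewrite inE oppe_le0 => Sx; exact: D0.
Qed.

(* [D] need not be measurable: its integral is the supremum of the integrals of
   the simple functions below it, which is only superadditive. *)
Lemma lower_integral_split D g (O A N : set T) :
  measurable A -> A `<=` O -> measurable N -> mu N = 0 ->
  (forall x, O x -> ~ N x -> 0 <= D x) ->
  measurable_fun A g -> (forall x, A x -> 0 <= g x) ->
  (forall x, A x -> ~ N x -> g x <= D x) ->
  \int[mu]_(x in O) D x \is a fin_num ->
  \int[mu]_(x in O `\` A) D x \is a fin_num /\
  \int[mu]_(x in O `\` A) D x + \int[mu]_(x in A) g x <= \int[mu]_(x in O) D x.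
Proof.
move=> mA AO mN N0 D0 mg g0 gD.
have D0' x : (O `\` A) x -> ~ N x -> 0 <= D x by move=> [Ox _]; exact: D0.
rewrite (ae_ge0_integralE mN N0 D0) (ae_ge0_integralE mN N0 D0') => fin.
have key : \int[mu]_x (D \_ (O `\` A))^\+ x + \int[mu]_x (g \_ A) x <=
    \int[mu]_x (D \_ O)^\+ x.
  apply: (lower_integral_superadditive mN) => //.
  - exact/(measurable_restrictT g mA).
  - by move=> x; rewrite erestrict_ge0.
  move=> x Nx; rewrite !funeposE !patchE.
  have [Ax|Ax] := boolP (x \in A).
    have Ax' : A x by rewrite inE in Ax.
    rewrite memNset; last by case.
    rewrite mem_set; last exact: AO.
    by rewrite maxxx add0e le_max gD.
  rewrite adde0; have [Ox|Ox] := boolP (x \in O `\` A).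
    by rewrite mem_set//; move: Ox; rewrite inE => -[].
  by rewrite maxxx le_max lexx orbT.
split; last by rewrite [X in _ + X <= _]integral_mkcond.
rewrite ge0_fin_numE ?integral_ge0//.
apply: (@le_lt_trans _ _ (\int[mu]_x (D \_ O)^\+ x)); last first.
  by rewrite -ge0_fin_numE// integral_ge0.
apply: le_trans key; rewrite leeDl// integral_ge0// => x _.
by rewrite erestrict_ge0.
Qed.

End lower_integral.
(** A difference of extended reals is finite only if both terms are, so a finite integral already
    controls the positive and negative parts. This is how finiteness of the functional yields
    integrability of [f u]. *)
Lemma integrable_fin_num_integral d (T : measurableType d) (R : realType)
    (mu : {measure set T -> \bar R}) (D : set T) (g : T -> \bar R) :
  measurable D -> measurable_fun D g ->
  (\int[mu]_(x in D) g x)%E \is a fin_num -> mu.-integrable D g.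
Proof.
move=> mD mg; rewrite integralE fin_numB => /andP[gp gn].
apply/integrableP; split=> //.
have mgp := measurable_funepos mg; have mgn := measurable_funeneg mg.
rewrite (eq_integral (fun x => g^\+ x + g^\- x)%E); last first.
  by move=> x _; rewrite -/((abse \o g) x) fune_abse.
by rewrite ge0_integralD// lte_add_pinfty// -ge0_fin_numE// integral_ge0.
Qed.

Lemma trunc_id {R : realType} (k s : R) : 0 <= k -> `|s| <= k -> trunc k s = s.
Proof.
move=> k0; rewrite ler_norml => /andP[ks sk].
by rewrite /trunc min_l// max_r.
Qed.

Lemma norm_sub_trunc {R : realType} (k s : R) : 0 <= k -> k < `|s| ->
  `|s - trunc k s| = `|s| - k.
Proof.
move=> k0; rewrite /trunc; have [s0|s0] := leP 0 s.
  rewrite ger0_norm// => ks; rewrite min_r ?(ltW ks)// max_r.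
    by rewrite ger0_norm// subr_ge0 ltW.
  by lra.
rewrite ltr0_norm// => ks; rewrite min_l; last by lra.
rewrite max_l; last by lra.
by rewrite opprK ltr0_norm; lra.
Qed.

Lemma norm_trunc_le {R : realType} (k s : R) : 0 <= k -> `|trunc k s| <= `|s|.
Proof.
move=> k0; have [sk|sk] := leP `|s| k; first by rewrite trunc_id.
have kk : - k <= k by lra.
apply: (@le_trans _ _ k); last exact: ltW.
by rewrite ler_norml /trunc le_max lexx/= ge_max kk ge_min lexx orbT.
Qed.

Lemma coord_le_enorm {R : realType} {n} (x : 'rV[R]_n) i : `|x ord0 i| <= enorm x.
Proof.
rewrite /enorm -sqrtr_sqr ler_wsqrtr// (bigD1 i)//= lerDl.
by apply: sumr_ge0 => k _; exact: sqr_ge0.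
Qed.

(** * The energy estimate on superlevel sets *)

Section minimum_energy.
Context {R : realType} {n : nat} (Omega : set 'rV[R]_n) (q p m : R).
Context (b1 b2 b3 b4 : R) (b : 'rV[R]_n -> R) (a : 'rV[R]_n -> R -> R).
Context (j f : 'rV[R]_n -> R) (u : W1q0 Omega q).
Local Notation mu := (@leb R n).
Local Notation L := (lebesgue_rV R n).
Hypotheses (oO : open Omega) (bO : bounded_set Omega) (q1 : 1 <= q).
Hypotheses (p0 : 0 <= p) (m0 : 0 <= m).
Hypotheses (b1_gt0 : 0 < b1) (b2_gt0 : 0 < b2) (b4_gt0 : 0 < b4).
Hypothesis b23 : {ae mu, forall x, Omega x -> b2 <= b x <= b3}.
Hypothesis aE : {ae mu, forall x, Omega x ->
  forall s : R, a x s = b1 / (b x + `|s|) `^ m}.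
Hypothesis j00 : j 0 = 0.
Hypothesis j_ge : forall xi, b4 * enorm xi `^ p <= j xi.
Hypothesis mf : measurable_fun (Omega : set L) f.
Hypothesis umin : forall v : W1q0 Omega q,
  (I_functional a j f u <= I_functional a j f v)%E.

Let mO := measurable_open_rV oO.

Lemma J_functional_min_fin : J_functional a j f u \is a fin_num.
Proof.
pose v := MkW1q0 (in_W1q0_zero oO bO q1).
have Jv : J_functional a j f v = 0%E.
  rewrite /J_functional !integral0_eq ?sube0// => x _ /=; first by rewrite mulr0.
  by rewrite j00 mulr0.
by have := umin v; rewrite /I_functional Jv /=; case: ifP => // _; rewrite leye_eq.
Qed.

(** The integrand on the left is a measurable minorant of the energy density: [b <= b3] bounds the
    weight from below, and the growth of [j] is used through a single component of the gradient. *)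
Lemma truncation_energy k i : 0 <= k ->
  (\int[mu]_(x in Omega `&` [set x | (k < `|u x|)%R])
     (b1 * b4 * `|grad u x ord0 i| `^ p / (b3 + `|u x|) `^ m)%:E <=
   \int[mu]_(x in Omega) (`|f x| * `|u x - trunc k (u x)|)%:E)%E.
Proof.
move=> k0.
have [[Lu Lg _] _] := W1q0P u.
have mu_ := Lu.1; have mg := (Lg i).1.
pose A := Omega `&` [set x | (k < `|u x|)%R].
have mnu : measurable_fun (Omega : set L) (fun x => `|u x|) by exact: measurableT_comp.
have mA : measurable (A : set L).
  rewrite (_ : A = Omega `&` (fun x => `|u x|) @^-1` `]k, +oo[%classic).
    exact: mnu.
  by apply/seteqP; split=> x /= [Ox]; rewrite in_itv/= andbT.
have [N1 [mN1 N10 HN1]] := b23; have [N2 [mN2 N20 HN2]] := aE.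
pose N := N1 `|` N2; have mN : measurable (N : set L) by exact: measurableU.
have N0 : mu N = 0%E by exact: null_set_setU.
have Nb x : ~ N x -> Omega x -> b2 <= b x <= b3.
  by move=> Nx; apply: contrapT => H; apply: Nx; left; exact: HN1.
have Na x : ~ N x -> Omega x -> forall s, a x s = b1 / (b x + `|s|) `^ m.
  by move=> Nx; apply: contrapT => H; apply: Nx; right; exact: HN2.
pose D x := (a x (u x) * j (grad u x))%:E.
pose g x := (b1 * b4 * `|grad u x ord0 i| `^ p / (b3 + `|u x|) `^ m)%:E.
have D_ge x : Omega x -> ~ N x -> (g x <= D x)%E.
  move=> Ox Nx; rewrite lee_fin (Na x Nx Ox); have /andP[bx1 bx2] := Nb x Nx Ox.
  have bu : 0 < b x + `|u x| by rewrite ltr_wpDr// (lt_le_trans b2_gt0).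
  have bu3 : b x + `|u x| <= b3 + `|u x| by rewrite lerD2r.
  have bu3' : 0 < b3 + `|u x| by rewrite (lt_le_trans bu).
  have -> : b1 * b4 * `|grad u x ord0 i| `^ p / (b3 + `|u x|) `^ m =
    b1 / (b3 + `|u x|) `^ m * (b4 * `|grad u x ord0 i| `^ p) by ring.
  apply: ler_pM.
  - by rewrite divr_ge0 ?powR_ge0 ?(ltW b1_gt0).
  - by rewrite mulr_ge0 ?powR_ge0 ?(ltW b4_gt0).
  - rewrite ler_wpM2l ?(ltW b1_gt0)// lef_pV2 ?posrE ?powR_gt0//.
    by apply: ge0_ler_powR; rewrite ?nnegrE ?(ltW bu) ?(ltW bu3').
  - apply: le_trans (j_ge _); rewrite ler_wpM2l ?(ltW b4_gt0)//.
    by apply: ge0_ler_powR; rewrite ?nnegrE ?sqrtr_ge0// coord_le_enorm.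
have b3_gt0 x : ~ N x -> Omega x -> 0 < b3.
  by move=> Nx Ox; have /andP[h1 h2] := Nb x Nx Ox; rewrite (lt_le_trans b2_gt0)// (le_trans h1).
have g_ge0 x : (0 <= g x)%E.
  by rewrite lee_fin divr_ge0 ?powR_ge0// mulr_ge0 ?powR_ge0// mulr_ge0 ?ltW.
have mgO : measurable_fun (Omega : set L) g.
  apply/measurable_EFinP; apply: measurable_funM.
    apply: measurable_funM; first exact: measurable_cst.
    apply: (measurableT_comp (measurable_powR p)); exact: measurableT_comp.
  under eq_fun do rewrite -powRN.
  apply: (measurableT_comp (measurable_powR (- m))).
  by apply: measurable_funD => //; exact: measurable_cst.
have Jfin := J_functional_min_fin.
move: (Jfin); rewrite /J_functional fin_numB => /andP[Dfin fufin].
pose v := MkW1q0 (in_W1q0_trunc oO bO q1 k0 (W1q0P u)).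
have := lower_integral_split mA (@subIsetl _ _ _) mN N0
  (fun x Ox Nx => le_trans (g_ge0 x) (D_ge x Ox Nx))
  (measurable_funS mO (@subIsetl _ _ _) mgO) (fun x _ => g_ge0 x)
  (fun x (Ax : A x) Nx => D_ge x Ax.1 Nx) Dfin.
have DvE : (\int[mu]_(x in Omega) (a x (v x) * j (grad v x))%:E =
    \int[mu]_(x in Omega `\` A) D x)%E.
  rewrite integral_mkcond [RHS]integral_mkcond; apply: eq_integral => x _.
  rewrite !patchE; have [Ox|Ox] := boolP (x \in Omega); last first.
    by rewrite memNset// => -[]; rewrite -in_setE (negbTE Ox).
  have Ox' : Omega x by rewrite inE in Ox.
  rewrite /D /v /=; have [uk|uk] := leP `|u x| k.
    rewrite mem_set; last by split=> // -[_ /=]; rewrite ltNge uk.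
    by rewrite trunc_id// /below uk scale1r.
  rewrite memNset; last by move=> -[_]; apply; split.
  by rewrite /below leNgt uk/= scale0r j00 mulr0.
rewrite -DvE => -[vfin Dle].
have mfu : measurable_fun (Omega : set L) (fun x => f x * u x) by exact: measurable_funM.
have mtr := measurable_trunc k mO mu_.
have mfv : measurable_fun (Omega : set L) (fun x => f x * trunc k (u x)).
  exact: measurable_funM.
have ifu : mu.-integrable Omega (fun x => (f x * u x)%:E).
  by apply: (integrable_fin_num_integral mO _ fufin); exact/measurable_EFinP.
have ifv : mu.-integrable Omega (fun x => (f x * trunc k (u x))%:E).
  apply: (le_integrable mO _ _ ifu); first by apply/measurable_EFinP.
  by move=> x _; rewrite /= lee_fin !normrM ler_wpM2l// norm_trunc_le.
have fvfin := integrable_fin_num mO ifv.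
(* Finite energy of the truncation comes from the splitting, the other term from
   [|trunc k u| <= |u|]. Without finiteness the competitor would have value [+oo] and minimality
   would say nothing. *)
have Jv : J_functional a j f v \is a fin_num.
  by rewrite /J_functional fin_numB vfin fvfin.
have := umin v; rewrite /I_functional Jfin Jv /J_functional => Jle.
apply: (@le_trans _ _ (\int[mu]_(x in Omega) (f x * u x)%:E -
    \int[mu]_(x in Omega) (f x * trunc k (u x))%:E)%E).
  move: Jle Dle vfin Dfin fufin fvfin.
  rewrite -/A -/D -/g.
  have : (0 <= \int[mu]_(x in A) g x)%E by exact: integral_ge0.
  rewrite -[fun x => (f x * v x)%:E]/(fun x => (f x * trunc k (u x))%:E).
  move: (\int[mu]_(x in A) g x)%E (\int[mu]_(x in Omega) (a x (v x) * j (grad v x))%:E)%E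
    (\int[mu]_(x in Omega) D x)%E (\int[mu]_(x in Omega) (f x * u x)%:E)%E
    (\int[mu]_(x in Omega) (f x * trunc k (u x))%:E)%E.
  move=> [x| |] [y| |] [z| |] [s| |] [t| |] //=; rewrite -?EFinB -?EFinD ?lee_fin => *; lra.
rewrite -integralB//; apply: (le_trans (lee_abs _)).
have mfuv : measurable_fun (Omega : set L) (fun x => ((f x * u x)%:E - (f x * trunc k (u x))%:E)%E).
  by apply/measurable_EFinP; exact: measurable_funB.
apply: (le_trans (le_abse_integral mu mO mfuv)).
rewrite le_eqVlt; apply/orP; left; apply/eqP; apply: eq_integral => x _.
by rewrite -EFinB abse_EFin -mulrBr normrM.
Qed.

End minimum_energy.
Lemma powR_expR {R : realType} (x e : R) : 0 < x -> x `^ e = expR (e * ln x).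
Proof. by move=> x0; rewrite /powR gt_eqF. Qed.

Lemma gt0_powR_lt1 {R : realType} (x e : R) : 1 < x -> e < 0 -> x `^ e < 1.
Proof.
move=> x1 e0; rewrite powR_expR ?(lt_trans ltr01)// -expR0 ltr_expR.
by rewrite nmulr_rlt0// ln_gt0.
Qed.

Lemma measurable_gt d (T : measurableType d) (R : realType) (E : set T) (h : T -> R) y :
  measurable E -> measurable_fun E h -> measurable (E `&` [set x | y < h x]).
Proof.
move=> mE mh; rewrite (_ : _ `&` _ = E `&` h @^-1` `]y, +oo[%classic); first exact: mh.
by apply/seteqP; split=> x /= [Ex]; rewrite in_itv/= andbT.
Qed.

(** * Layer sums and integrals of Marcinkiewicz functions *)

Section layers.
Context d (T : measurableType d) (R : realType) (mu : {measure set T -> \bar R}).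
Local Open Scope ereal_scope.

Lemma nneseries_geometric_le (a : nat -> \bar R) (C rho : R) :
  (0 <= C)%R -> (0 <= rho)%R -> (rho < 1)%R ->
  (forall j, 0 <= a j) -> (forall j, a j <= (C * rho ^+ j)%:E) ->
  \sum_(j <oo) a j <= (C / (1 - rho))%:E.
Proof.
move=> C0 rho0 rho1 a0 aC; have r1 : (0 < 1 - rho)%R by rewrite subr_gt0.
apply: lime_le; first exact: is_cvg_nneseries.
apply: nearW => N; apply: (@le_trans _ _ (\sum_(0 <= j < N) (C * rho ^+ j)%:E)).
  by apply: lee_sum => j _; exact: aC.
rewrite sumEFin lee_fin -mulr_sumr ler_wpM2l// -[leRHS]mul1r ler_pdivlMr// mulrC.
rewrite big_mkord -opprB mulNr -subrX1 opprB lerBlDr lerDl.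
exact: exprn_ge0.
Qed.

(** At a point [x] take the least [j] with [h x <= t j]. If it is [0], the constant term dominates;
    otherwise [t (j - 1) < h x] and the single layer [j - 1] does. *)
Lemma integral_layers_le (E : set T) (h : T -> R) (phi : R -> R) (t : nat -> R) :
  measurable E -> measurable_fun E h -> measurable_fun setT phi ->
  (forall x, E x -> 0 <= h x)%R -> (forall y, 0 <= phi y)%R ->
  (forall y z, 0 <= y -> y <= z -> phi y <= phi z)%R ->
  (forall y, exists j, y <= t j)%R ->
  \int[mu]_(x in E) (phi (h x))%:E <= (phi (t 0))%:E * mu E +
    \sum_(j <oo) (phi (t j.+1))%:E * mu (E `&` [set x | t j < h x]%R).
Proof.
move=> mE mh mphi h0 phi0 phi_nd tub.
pose S j := E `&` [set x | t j < h x]%R.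
have mS j : measurable (S j) by exact: measurable_gt.
pose g j x := (phi (t j.+1))%:E * (\1_(S j) x)%:E.
have g0 j x : 0 <= g j x by rewrite mule_ge0// lee_fin// indicE.
have mg j : measurable_fun E (g j).
  by apply: emeasurable_funM => //; apply/measurable_EFinP.
apply: (@le_trans _ _ (\int[mu]_(x in E) ((phi (t 0))%:E + \sum_(j <oo) g j x))).
  apply: ge0_le_integral => //.
  - by move=> x _; rewrite lee_fin.
  - by apply/measurable_EFinP; exact: measurableT_comp.
  - by apply: emeasurable_funD => //; exact: ge0_emeasurable_sum.
  move=> x Ex; have [j0 hj0] := tub (h x).
  pose P j := (h x <= t j)%R; have exP : exists j, P j by exists j0.
  case: (ex_minnP exP) => -[|j] hj jmin.
    rewrite (@le_trans _ _ (phi (t 0))%:E)//; first by rewrite lee_fin phi_nd// h0.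
    by rewrite leeDl// nneseries_ge0.
  have jh : (t j < h x)%R by rewrite ltNge; apply/negP => /jmin; rewrite ltnn.
  apply: (@le_trans _ _ (g j x)).
    by rewrite /g indicE mem_set//= mule1 lee_fin phi_nd// h0.
  rewrite (@le_trans _ _ (\sum_(k <oo) g k x))//; last by rewrite leeDr// lee_fin.
  rewrite (nneseriesD1 (n := j))//.
  by rewrite leeDl// nneseries_ge0.
rewrite ge0_integralD//; last 3 first.
- by move=> x _; rewrite lee_fin.
- by move=> x _; exact: nneseries_ge0.
- exact: ge0_emeasurable_sum.
rewrite integral_cst// leeD2l// integral_nneseries//.
apply: lee_nneseries => [j _ _|j _]; first by apply: integral_ge0.
rewrite ge0_integralZl//; last 2 first.
- by apply/measurable_EFinP.
- by rewrite lee_fin.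
by rewrite integral_indic// setIC setIA setIid.
Qed.

End layers.

Section marcinkiewicz_integral.
Context d (T : measurableType d) (R : realType) (mu : {measure set T -> \bar R}).
Context (O : set T) (f : T -> R) (c r sigma : R).
Hypothesis mO : measurable O.
Hypothesis Ooo : (mu O < +oo)%E.
Hypothesis mf : measurable_fun O f.
Hypotheses (c0 : 0 < c) (sigma0 : 0 < sigma) (sr : sigma < r).
Hypothesis fM : forall t, 0 < t ->
  (mu (O `&` [set x | (t < `|f x|)%R]) <= (c / t `^ r)%:E)%E.

(* The layers are cut at the levels [2 ^ j * t] with [c / t ^ r = mu E], where
   the Marcinkiewicz bound overtakes the trivial one. *)
Lemma marcinkiewicz_integral_le : exists2 C : R, 0 <= C &
  forall E, measurable E -> E `<=` O ->
  (\int[mu]_(x in E) (`|f x| `^ sigma)%:E <=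
   (C * fine (mu E) `^ (1 - sigma / r))%:E)%E.
Proof.
have r0 : 0 < r by exact: lt_trans sr.
have rho1 : 2 `^ (sigma - r) < 1 :> R by rewrite gt0_powR_lt1 ?ltr1n ?subr_lt0.
(* The [1] accounts for values below [t 0], the fraction for the geometric series of the layers,
   whose ratio [2 ^ (sigma - r)] is below one because [sigma < r]. *)
pose C := c `^ (sigma / r) * (1 + 2 `^ sigma / (1 - 2 `^ (sigma - r))).
have C0 : 0 <= C.
  by rewrite mulr_ge0 ?powR_ge0// addr_ge0// divr_ge0 ?powR_ge0// subr_ge0 ltW.
exists C => // E mE EO.
have Eoo : (mu E < +oo)%E by apply: le_lt_trans Ooo; rewrite le_measure ?inE.
have Efin : mu E \is a fin_num by rewrite ge0_fin_numE.
have [E0|E0] := eqVneq (mu E) 0%E.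
  rewrite (@null_set_integral _ _ _ mu)//.
    by rewrite lee_fin mulr_ge0// powR_ge0.
  apply/measurable_EFinP; apply: (measurableT_comp (measurable_powR sigma)).
  by apply: measurableT_comp => //; exact: measurable_funS mf.
pose m := fine (mu E); have mE' : mu E = m%:E by rewrite fineK.
have m0 : 0 < m.
  by rewrite lt_neqAle -eqe -mE' eq_sym E0 -lee_fin -mE' measure_ge0.
pose t0 := (c / m) `^ r^-1; have t00 : 0 < t0 by rewrite powR_gt0// divr_gt0.
have mc0 : 0 < c / m by rewrite divr_gt0.
have lnt0 : ln t0 = (ln c - ln m) / r.
  by rewrite /t0 powR_expR// expRK ln_div ?posrE// mulrC.
pose t j := 2 ^+ j * t0; have tj0 j : 0 < t j by rewrite mulr_gt0// exprn_gt0.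
have lnt j : ln (t j) = j%:R * ln 2 + ln t0.
  by rewrite /t lnM ?posrE ?exprn_gt0// lnXn// mulr_natl.
have t0E : t 0%N `^ sigma * m = c `^ (sigma / r) * m `^ (1 - sigma / r).
  rewrite -[X in _ * X = _](lnK m0) !powR_expR// lnt mul0r add0r lnt0 -!expRD.
  by congr expR; field; rewrite gt_eqF.
have tjE j : t j.+1 `^ sigma * (c / t j `^ r) =
    2 `^ sigma * (c `^ (sigma / r) * m `^ (1 - sigma / r)) * (2 `^ (sigma - r)) ^+ j.
  rewrite -[X in _ * (X / _) = _](lnK c0) !powR_expR// !lnt lnt0 -expRN.
  rewrite -expRM_natl -!expRD.
  by congr expR; rewrite -natr1; field; rewrite gt_eqF.
have := @integral_layers_le _ T R mu E (fun x => `|f x|) (fun y => y `^ sigma) t mE.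
move=> H; apply: (le_trans (H _ _ _ _ _ _)) => {H} //.
- by apply: measurableT_comp => //; exact: measurable_funS mf.
- by move=> y; exact: powR_ge0.
- move=> y z y0 yz; apply: ge0_ler_powR; rewrite ?nnegrE ?(ltW sigma0)//.
  exact: le_trans yz.
- move=> y; exists (Num.bound `|y / t0|); rewrite -ler_pdivrMr//.
  rewrite (le_trans (ler_norm _))// (le_trans (ltW (archi_boundP _)))//.
  by rewrite -natrX ler_nat ltnW// ltn_expl.
rewrite -/m mE' -EFinM t0E.
pose Q := c `^ (sigma / r) * m `^ (1 - sigma / r).
have Q0 : 0 <= Q by rewrite mulr_ge0 ?powR_ge0.
rewrite -/m (_ : C * m `^ (1 - sigma / r) = Q + 2 `^ sigma * Q / (1 - 2 `^ (sigma - r))); last first.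
  by rewrite /C /Q; ring.
rewrite EFinD leeD2l//; apply: nneseries_geometric_le => //.
- by rewrite mulr_ge0// powR_ge0.
- by move=> j; rewrite mule_ge0// lee_fin powR_ge0.
move=> j; rewrite -tjE EFinM; apply: lee_wpmul2l; first by rewrite lee_fin powR_ge0.
apply: (le_trans _ (fM (tj0 j))); apply: le_measure; rewrite ?inE.
- by apply: measurable_gt => //; apply: measurableT_comp => //; exact: measurable_funS mf.
- by apply: measurable_gt => //; exact: measurableT_comp.
- by move=> x [/EO].
Qed.

End marcinkiewicz_integral.

(** * Weighted Hölder inequality and the inequality to be solved for the energy *)

Section hoelder_on.
Context d (T : measurableType d) (R : realType) (mu : {measure set T -> \bar R}).
Context (A : set T).
Hypothesis mA : measurable A.

Let mpow (g : T -> R) e : measurable_fun A g -> measurable_fun A (fun x => g x `^ e).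
Proof. by move=> mg; exact: (measurableT_comp (measurable_powR e) mg). Qed.

Lemma hoelder_on (f g : T -> R) (a b : R) :
  measurable_fun A f -> measurable_fun A g ->
  (forall x, A x -> 0 <= f x) -> (forall x, A x -> 0 <= g x) ->
  0 < a -> 0 < b -> a + b = 1 ->
  (\int[mu]_(x in A) (f x `^ a * g x `^ b)%:E <=
   (\int[mu]_(x in A) (f x)%:E) `^ a * (\int[mu]_(x in A) (g x)%:E) `^ b)%E.
Proof.
move=> mf mg f0 g0 a0 b0 ab.
have mr (h : T -> R) : measurable_fun A h -> measurable_fun setT ((EFin \o h) \_ A).
  by move=> mh; apply/(measurable_restrictT _ mA); exact/measurable_EFinP.
have r0 (h : T -> R) : (forall x, A x -> 0 <= h x) ->
    forall x, (0 <= ((EFin \o h) \_ A) x)%E.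
  by move=> h0 x; rewrite erestrict_ge0// => y Ay; rewrite lee_fin h0.
have := ge0_hoelder mu (mr _ mf) (mr _ mg) (r0 _ f0) (r0 _ g0) a0 b0 ab.
rewrite -!integral_mkcond; apply: le_trans.
rewrite integral_mkcond le_eqVlt; apply/orP; left; apply/eqP.
apply: eq_integral => x _; rewrite !patchE; case: ifP => // _.
by rewrite !poweR0r ?gt_eqF// mul0e.
Qed.

(** [|G| ^ q] is written as [(|G| ^ p / (c + U) ^ m) ^ (q / p) * ((c + U) ^ s) ^ (1 - q / p)]; the
    relation [m q = s (p - q)] is exactly the cancellation of the weights. *)
Lemma weighted_hoelder (G U : T -> R) (p q m s c : R) :
  measurable_fun A G -> measurable_fun A U -> (forall x, A x -> 0 <= U x) ->
  0 < c -> 0 < q -> q < p -> m * q = s * (p - q) ->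
  (\int[mu]_(x in A) (`|G x| `^ q)%:E <=
   (\int[mu]_(x in A) (`|G x| `^ p / (c + U x) `^ m)%:E) `^ (q / p) *
   (\int[mu]_(x in A) ((c + U x) `^ s)%:E) `^ (1 - q / p))%E.
Proof.
move=> mG mU U0 c0 q0 qp mqs; have p0 : 0 < p by exact: lt_trans qp.
have cU0 x : A x -> 0 < c + U x by move=> /U0 Ux; rewrite ltr_wpDr.
have mcU : measurable_fun A (fun x => c + U x).
  by apply: measurable_funD => //; exact: measurable_cst.
have mGp : measurable_fun A (fun x => `|G x| `^ p / (c + U x) `^ m).
  apply: measurable_funM; first by apply: mpow; exact: measurableT_comp.
  by under eq_fun do rewrite -powRN; exact: mpow.
have qp0 : 0 < q / p by rewrite divr_gt0.
have qp1 : 0 < 1 - q / p by rewrite subr_gt0 ltr_pdivrMr// mul1r.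
have := hoelder_on mGp (mpow s mcU) _ (fun x _ => powR_ge0 _ _) qp0 qp1.
move=> H; apply: le_trans (H _ _) => {H}; last 2 first.
- by move=> x Ax; rewrite divr_ge0// powR_ge0.
- by rewrite addrC subrK.
rewrite le_eqVlt; apply/orP; left; apply/eqP; apply: eq_integral => x.
rewrite inE => Ax; congr EFin; have cUx := cU0 x Ax.
rewrite powRM ?invr_ge0 ?powR_ge0// -!powRrM -powRN -!powRrM.
rewrite (_ : p * (q / p) = q); last by rewrite mulrCA divff ?mulr1// gt_eqF.
rewrite -mulrA -powRD; last by rewrite (gt_eqF cUx) implybT.
rewrite (_ : - m * (q / p) + s * (1 - q / p) = 0) ?powRr0 ?mulr1//.
rewrite (_ : _ + _ = (s * (p - q) - m * q) / p); last by field; rewrite gt_eqF.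
by rewrite mqs subrr mul0r.
Qed.

Lemma integral_powR_add_le (c s : R) (w : T -> R) : 0 <= c -> 0 < s ->
  measurable_fun A w ->
  (\int[mu]_(x in A) ((c + `|w x|) `^ s)%:E <=
   (2 `^ s)%:E * ((c `^ s)%:E * mu A + \int[mu]_(x in A) (`|w x| `^ s)%:E))%E.
Proof.
move=> c0 s0 mw.
have mws : measurable_fun A (fun x => `|w x| `^ s).
  by apply: mpow; exact: measurableT_comp.
rewrite -integral_cst// -ge0_integralD//; last 2 first.
- by move=> x _; rewrite lee_fin powR_ge0.
- by apply/measurable_EFinP.
rewrite -ge0_integralZl//; last 2 first.
- by apply: emeasurable_funD; [exact: measurable_cst|exact/measurable_EFinP].
- by move=> x _; rewrite -EFinD lee_fin addr_ge0// powR_ge0.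
apply: ge0_le_integral => //.
- by move=> x _; rewrite lee_fin powR_ge0.
- apply/measurable_EFinP; apply: mpow; apply: measurable_funD; first exact: measurable_cst.
  exact: measurableT_comp.
- apply/measurable_EFinP; apply: measurable_funM; first exact: measurable_cst.
  by apply: measurable_funD => //; exact: measurable_cst.
move=> x _; rewrite -EFinD -EFinM lee_fin.
have w0 := normr_ge0 (w x); have s0' := ltW s0.
have [cw|wc] := leP c `|w x|.
  apply: (@le_trans _ _ (2 `^ s * `|w x| `^ s)).
    rewrite -powRM//; apply: ge0_ler_powR; rewrite ?nnegrE ?addr_ge0 ?mulr_ge0//; lra.
  by rewrite ler_wpM2l ?powR_ge0// lerDr powR_ge0.
apply: (@le_trans _ _ (2 `^ s * c `^ s)).
  rewrite -powRM//; apply: ge0_ler_powR; rewrite ?nnegrE ?addr_ge0 ?mulr_ge0//; lra.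
by rewrite ler_wpM2l ?powR_ge0// lerDl powR_ge0.
Qed.

End hoelder_on.

(* In logarithms the hypothesis is linear: it is solved for [ln Y], replacing
   the sum by twice its larger term. *)
Lemma decay_of_energy {R : realType} (p m s a M c0 A : R) :
  0 < m -> m < p - 1 -> 0 < s -> 0 < a -> p - 1 - m <= a * s ->
  0 < M -> 0 < c0 -> 0 < A ->
  exists2 C : R, 0 < C & forall Y t c : R, 0 <= Y -> 0 <= t -> t <= M -> c0 <= c ->
    Y <= A * t `^ (a * s / p) * Y `^ p^-1 * (c `^ s * t + Y) `^ (m / p) ->
    Y <= C * c `^ (s * (m / (p - 1))) * t `^ ((a * s + m) / (p - 1)).
Proof.
move=> m0 mp s0 a0 ams M0 c00 A0.
have p1 : 0 < p - 1 by exact: lt_trans mp.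
have p0 : 0 < p by rewrite (lt_le_trans p1)// gerBl.
have pm : 0 < p - 1 - m by rewrite subr_gt0.
pose A' := A * 2 `^ (m / p); have A'0 : 0 < A' by rewrite mulr_gt0// powR_gt0.
(* The exponents of [t] found when [c ^ s * t], respectively [Y], is the larger term of the sum. The
   hypothesis [p - 1 - m <= a * s] is equivalent to [e1 <= e2]. *)
pose e1 := (a * s + m) / (p - 1); pose e2 := a * s / (p - 1 - m).
have e12 : e1 <= e2.
  by rewrite /e1 /e2 ler_pdivrMr// mulrAC ler_pdivlMr//; nra.
pose C1 := p * ln A' / (p - 1).
(* In the second case the surplus [t ^ (e2 - e1)] is bounded through [t <= M], and the missing power
   of [c] is supplied by [c0 <= c]. *)
pose C2 := p * ln A' / (p - 1 - m) + (e2 - e1) * ln M - s * (m / (p - 1)) * ln c0.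
exists (expR (Num.max C1 C2)); first exact: expR_gt0.
move=> Y t c; rewrite le_eqVlt => /predU1P[<- _ _ _ _|Y0].
  by rewrite !mulr_ge0 ?expR_ge0 ?powR_ge0.
rewrite le_eqVlt => /predU1P[<- _ _|t0 tM cc].
  rewrite [in X in X -> _]powR0 ?mulr0 ?mul0r ?leNgt ?Y0//.
  by rewrite mulf_neq0 ?invr_eq0 ?gt_eqF// mulr_gt0.
have c_gt0 : 0 < c by exact: lt_le_trans cc.
have lnc : ln c0 <= ln c by rewrite ler_ln ?posrE.
have lnt : ln t <= ln M by rewrite ler_ln ?posrE.
have mp0 : 0 <= m / p by rewrite divr_ge0 ?ltW.
pose Z := Num.max (c `^ s * t) Y.
have Z0 : 0 < Z by rewrite lt_max Y0 orbT.
have cst : 0 < c `^ s * t by rewrite mulr_gt0// powR_gt0.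
have ZE : (c `^ s * t + Y) `^ (m / p) <= (2 * Z) `^ (m / p).
  apply: (ge0_ler_powR mp0); rewrite ?nnegrE ?addr_ge0 ?(ltW Y0) ?(ltW cst)//.
    by rewrite mulr_ge0// ltW.
  by rewrite mulr_natl mulr2n lerD// /Z le_max lexx ?orbT.
move=> H; have {H} : Y <= A * t `^ (a * s / p) * Y `^ p^-1 * (2 * Z) `^ (m / p).
  by apply: (le_trans H); rewrite ler_wpM2l// !mulr_ge0 ?powR_ge0 ?ltW.
rewrite powRM ?(ltW Z0)// => H.
have {H} : ln Y <= ln A' + a * s / p * ln t + p^-1 * ln Y + m / p * ln Z.
  move: H; rewrite -{1}(lnK Y0) -{1}(lnK A0) !powR_expR// -!expRD ler_expR.
  rewrite /A' lnM ?posrE ?powR_gt0// ln_powR; lra.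
have -> : expR (Num.max C1 C2) * c `^ (s * (m / (p - 1))) * t `^ e1 =
  expR (Num.max C1 C2 + s * (m / (p - 1)) * ln c + e1 * ln t).
  by rewrite !powR_expR// !expRD.
move=> H; rewrite -[X in X <= _](lnK Y0) ler_expR.
have pne : p != 0 by rewrite gt_eqF.
have sm : 0 <= s * (m / (p - 1)) by rewrite mulr_ge0 ?divr_ge0 ?ltW.
have [Yc|cY] := leP Y (c `^ s * t).
  have ZE' : ln Z = s * ln c + ln t.
    by rewrite /Z max_l// lnM ?posrE ?powR_gt0// ln_powR.
  have : ln Y <= C1 + s * (m / (p - 1)) * ln c + e1 * ln t.
    rewrite (_ : _ + _ + _ = (p * ln A' + m * s * ln c + (a * s + m) * ln t) / (p - 1)).
      rewrite ler_pdivlMr//; move: H; rewrite ZE' -(ler_pM2l p0).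
      rewrite (_ : p * (ln A' + _ + _ + _) = p * ln A' + a * s * ln t + ln Y +
        m * (s * ln c + ln t)); last by field.
      lra.
    by rewrite /C1 /e1; field; rewrite gt_eqF.
  have : C1 <= Num.max C1 C2 by rewrite le_max lexx.
  lra.
have ZE' : ln Z = ln Y by rewrite /Z max_r// ltW.
have : ln Y <= p * ln A' / (p - 1 - m) + e2 * ln t.
  rewrite (_ : _ + _ = (p * ln A' + a * s * ln t) / (p - 1 - m)); last first.
    by rewrite /e2; field; rewrite gt_eqF.
  rewrite ler_pdivlMr//; move: H; rewrite ZE' -(ler_pM2l p0).
  rewrite (_ : p * (ln A' + _ + _ + _) = p * ln A' + a * s * ln t + ln Y +
    m * ln Y); last by field.
  lra.
have C2m : C2 <= Num.max C1 C2 by rewrite le_max lexx orbT.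
have h1 : (e2 - e1) * ln t <= (e2 - e1) * ln M by rewrite ler_wpM2l ?subr_ge0.
have h2 : s * (m / (p - 1)) * ln c0 <= s * (m / (p - 1)) * ln c by rewrite ler_wpM2l.
by move: C2m h1 h2; rewrite /C2; lra.
Qed.

(** * From the energy estimate to the gradient *)

Section gradient_estimate.
Context d (T : measurableType d) (R : realType) (mu : {measure set T -> \bar R}).
Context (O A : set T) (G U f w : T -> R) (p q m s sigma b c k t F Y : R).
Hypotheses (mO : measurable O) (mA : measurable A) (AO : A `<=` O).
Hypotheses (mG : measurable_fun O G) (mU : measurable_fun O U).
Hypotheses (mf : measurable_fun O f) (mw : measurable_fun O w).
Hypothesis U0 : forall x, 0 <= U x.
Hypothesis UE : forall x, A x -> U x = `|w x| + k.
Hypothesis w0 : forall x, O x -> ~ A x -> w x = 0.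
Hypotheses (q0 : 0 < q) (qp : q < p) (s1 : 1 < s) (mqs : m * q = s * (p - q)).
Hypotheses (b0 : 0 < b) (c0 : 0 < c) (k0 : 0 <= k).
Hypotheses (sigma_s : sigma^-1 = 1 - s^-1).
Hypothesis muA : mu A = t%:E.
Hypothesis YE : (\int[mu]_(x in O) (`|w x| `^ s)%:E = Y%:E)%E.
Hypothesis fF : (\int[mu]_(x in A) (`|f x| `^ sigma)%:E <= F%:E)%E.
Hypothesis energy : (\int[mu]_(x in A) (b * `|G x| `^ p / (c + U x) `^ m)%:E <=
  \int[mu]_(x in O) (`|f x| * `|w x|)%:E)%E.

Let s0 : 0 < s. Proof. exact: lt_trans s1. Qed.

Let in_A g : (forall x, O x -> ~ A x -> g x = 0%E) ->
  (\int[mu]_(x in O) g x = \int[mu]_(x in A) g x)%E.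
Proof.
move=> g0; rewrite integral_mkcond [RHS]integral_mkcond; apply: eq_integral => x _.
rewrite !patchE; have [Ax|Ax] := boolP (x \in A).
  by rewrite mem_set//; apply: AO; rewrite inE in Ax.
case: ifPn => //; rewrite inE => Ox; apply: g0 => // Ax'.
by rewrite mem_set in Ax.
Qed.

(** To be read with [A] the superlevel set [|u| > k], [U = |u|], [w] the excess over [k], [t] the
    measure of [A]. Hölder with the conjugate exponents [sigma] and [s] bounds the energy by the
    norms of [f] and [w]; [weighted_hoelder] then removes the weight, with [c + U = c + k + |w|] on
    [A]. *)
Lemma gradient_estimate : (\int[mu]_(x in A) (`|G x| `^ q)%:E <=
  ((b^-1 * (F `^ sigma^-1 * Y `^ s^-1)) `^ (q / p) *
   (2 `^ s * ((c + k) `^ s * t + Y)) `^ (1 - q / p))%:E)%E.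
Proof.
have mGA := measurable_funS mO AO mG; have mUA := measurable_funS mO AO mU.
have mfA := measurable_funS mO AO mf; have mwA := measurable_funS mO AO mw.
have mpow (g : T -> R) e : measurable_fun A g -> measurable_fun A (fun x => `|g x| `^ e).
  move=> mg; apply: (measurableT_comp (measurable_powR e)); exact: measurableT_comp.
have s10 : 0 < 1 - s^-1 by rewrite subr_gt0 invf_lt1.
have sigma0 : 0 < sigma by rewrite -invr_gt0 sigma_s.
have YA : (\int[mu]_(x in A) (`|w x| `^ s)%:E = Y%:E)%E.
  rewrite -YE in_A// => x Ox Ax.
  by rewrite w0// normr0 powR0// gt_eqF.
have p0 : 0 < p by exact: lt_trans qp.
have mcU : measurable_fun A (fun x => c + U x).
  by apply: measurable_funD => //; exact: measurable_cst.
have E1 : (\int[mu]_(x in A) (`|G x| `^ p / (c + U x) `^ m)%:E <=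
    (b^-1 * (F `^ sigma^-1 * Y `^ s^-1))%:E)%E.
  rewrite -(@lee_pmul2l _ b%:E)// -[leRHS]EFinM mulrA divff ?gt_eqF// mul1r.
  rewrite -ge0_integralZl//; last 3 first.
  - apply/measurable_EFinP; apply: measurable_funM; first exact: mpow.
    under eq_fun do rewrite -powRN.
    exact: (measurableT_comp (measurable_powR (- m)) mcU).
  - by move=> x _; rewrite lee_fin divr_ge0// powR_ge0.
  - by rewrite lee_fin ltW.
  under eq_integral do rewrite -EFinM mulrA.
  apply: (le_trans energy); rewrite in_A; last first.
    by move=> x Ox Ax; rewrite w0// normr0 mulr0.
  have := hoelder_on (f := fun x => `|f x| `^ sigma) (g := fun x => `|w x| `^ s)
    mu mA (mpow _ _ mfA) (mpow _ _ mwA) (fun x _ => powR_ge0 _ _)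
    (fun x _ => powR_ge0 _ _) s10 _ _.
  move=> /(_ s^-1); rewrite invr_gt0 s0 subrK => /(_ isT erefl).
  under eq_integral do rewrite -sigma_s -!powRrM !divff ?gt_eqF// !powRr1//.
  move=> /le_trans; apply; rewrite YA poweR_EFin [leRHS]EFinM.
  apply: lee_wpmul2r; first by rewrite lee_fin powR_ge0.
  rewrite -sigma_s -poweR_EFin; apply: lee_poweR => //.
    by rewrite invr_ge0 ltW.
  by apply: integral_ge0 => x _; rewrite lee_fin powR_ge0.
have E2 : (\int[mu]_(x in A) ((c + U x) `^ s)%:E <=
    (2 `^ s * ((c + k) `^ s * t + Y))%:E)%E.
  rewrite (eq_integral (fun x => ((c + k + `|w x|) `^ s)%:E)); last first.
    by move=> x; rewrite inE => /UE ->; rewrite addrA addrAC.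
  have ck : 0 <= c + k by rewrite addr_ge0// ltW.
  apply: (le_trans (integral_powR_add_le mu mA ck s0 mwA)).
  by rewrite muA YA; exact: lexx.
apply: (le_trans (weighted_hoelder mu mA mGA mUA (fun x _ => U0 x) c0 q0 qp mqs)).
rewrite EFinM -!poweR_EFin.
have qp1 : 0 <= 1 - q / p by rewrite subr_ge0 ler_pdivrMr// mul1r ltW.
apply: lee_pmul; rewrite ?poweR_ge0//; apply: lee_poweR => //.
- by rewrite divr_ge0 ?ltW.
- by apply: integral_ge0 => x _; rewrite lee_fin divr_ge0 ?powR_ge0.
- by apply: integral_ge0 => x _; rewrite lee_fin powR_ge0.
Qed.

End gradient_estimate.

(** The left side is the Sobolev bound for the excess once [gradient_estimate] and the Marcinkiewicz
    bound are inserted. The relation between [m], [q], [s] and [p] turns the exponents of [Y] and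
    [Z] into [1 / p] and [m / p], the form [decay_of_energy] solves. *)
Lemma energy_exponents {R : realType} (S B F t Y Z p q s r sigma m : R) :
  0 <= S -> 0 <= B -> 0 <= F -> 0 <= t -> 0 <= Y -> 0 <= Z ->
  0 < p -> 0 < q -> 0 < s -> 0 < r -> sigma^-1 = 1 - s^-1 -> 0 < sigma ->
  m * q = s * (p - q) ->
  (S * ((B * ((F * t `^ (1 - sigma / r)) `^ sigma^-1 * Y `^ s^-1)) `^ (q / p) *
   (2 `^ s * Z) `^ (1 - q / p)) `^ q^-1) `^ s =
  S `^ s * B `^ (s / p) * F `^ (sigma^-1 * (s / p)) * 2 `^ (s * (m / p)) *
    t `^ ((1 - s^-1 - r^-1) * s / p) * Y `^ p^-1 * Z `^ (m / p).
Proof.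
move=> S0 B0 F0 t0 Y0 Z0 p0 q0 s0 r0 sigma_s sigma0 mqs.
have h x e : 0 <= x `^ e :> R by exact: powR_ge0.
have FT0 : 0 <= F * t `^ (1 - sigma / r) by exact: mulr_ge0.
have FY0 := mulr_ge0 (h (F * t `^ (1 - sigma / r)) sigma^-1) (h Y s^-1).
rewrite (powRM _ S0 (h _ _)) -[X in _ * X = _]powRrM (powRM _ (h _ _) (h _ _)).
rewrite -[X in _ * (X * _) = _]powRrM -[X in _ * (_ * X) = _]powRrM.
rewrite (powRM _ B0 FY0) (powRM _ (h _ _) (h _ _)) -[X in _ * (_ * (X * _) * _) = _]powRrM.
rewrite (powRM _ F0 (h _ _)) -[X in _ * (_ * (_ * X) * _) = _]powRrM.
rewrite -[X in _ * (_ * (_ * X * _) * _) = _]powRrM (powRM _ (h _ _) Z0).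
rewrite -[X in _ * (_ * (X * _)) = _]powRrM.
have pne : p != 0 by rewrite gt_eqF. have qne : q != 0 by rewrite gt_eqF.
have sne : s != 0 by rewrite gt_eqF. have rne : r != 0 by rewrite gt_eqF.
have gne : sigma != 0 by rewrite gt_eqF.
have mE : m = s * (p - q) / q by rewrite -mqs mulfK.
rewrite (_ : q / p * (q^-1 * s) = s / p); last by field; rewrite pne qne.
rewrite (_ : (1 - q / p) * (q^-1 * s) = m / p); last first.
  by rewrite mE; field; rewrite pne qne.
rewrite (_ : s^-1 * (s / p) = p^-1); last by field; rewrite sne pne.
rewrite (_ : (1 - sigma / r) * (sigma^-1 * (s / p)) = (1 - s^-1 - r^-1) * s / p); last first.
  by rewrite -sigma_s; field; rewrite gne rne pne.
ring.
Qed.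

(** * Decay of the measure of superlevel sets *)

Section level_set_decay.
Context {R : realType} {n : nat} (Omega : set 'rV[R]_n.+1) (q p m s r : R).
Context (b1 b2 b3 b4 : R) (b : 'rV[R]_n.+1 -> R) (a : 'rV[R]_n.+1 -> R -> R).
Context (j f : 'rV[R]_n.+1 -> R) (u : W1q0 Omega q).
Local Notation mu := (@leb R n.+1).
Local Notation L := (lebesgue_rV R n.+1).
Local Notation N := (n.+1%:R : R).
Hypotheses (oO : open Omega) (bO : bounded_set Omega).
Hypotheses (n0 : (0 < n)%N) (q1 : 1 < q) (qN : q < N) (qp : q < p).
Hypotheses (sE : s = q * N / (N - q)) (mqs : m * q = s * (p - q)).
Hypotheses (m0 : 0 < m) (mp : m < p - 1) (r0 : 0 < r).
Hypotheses (e0 : 0 < 1 - s^-1 - r^-1) (es : p - 1 - m <= (1 - s^-1 - r^-1) * s).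
Hypotheses (b1_gt0 : 0 < b1) (b2_gt0 : 0 < b2) (b3_gt0 : 0 < b3) (b4_gt0 : 0 < b4).
Hypothesis b23 : {ae mu, forall x, Omega x -> b2 <= b x <= b3}.
Hypothesis aE : {ae mu, forall x, Omega x ->
  forall s : R, a x s = b1 / (b x + `|s|) `^ m}.
Hypothesis j00 : j 0 = 0.
Hypothesis j_ge : forall xi, b4 * enorm xi `^ p <= j xi.
Hypothesis fM : marcinkiewicz Omega r f.
Hypothesis umin : forall v : W1q0 Omega q,
  (I_functional a j f u <= I_functional a j f v)%E.

Definition superlevel k : set L := Omega `&` [set x | (k < `|u x|)%R].

Let mO := measurable_open_rV oO.
Let Ooo := leb_open_lty oO bO.
Let q1' := ltW q1.
Let mf := fM.1.
Let Lu : in_Lq Omega q u.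
Proof. by have [[H _ _] _] := W1q0P u. Qed.
Let Lg i : in_Lq Omega q (fun x => grad u x ord0 i).
Proof. by have [[_ H _] _] := W1q0P u. Qed.
Let mu_ : measurable_fun (Omega : set L) u := Lu.1.

Let mnu : measurable_fun (Omega : set L) (fun x => `|u x|).
Proof. exact: measurableT_comp. Qed.

Lemma measurable_superlevel k : measurable (superlevel k).
Proof. exact: (measurable_gt k mO mnu). Qed.

Lemma leb_superlevel_fin k : (mu (superlevel k) \is a fin_num).
Proof.
rewrite ge0_fin_numE//; apply: le_lt_trans Ooo.
apply: le_measure; rewrite ?inE; [exact: measurable_superlevel|exact: mO|exact: subIsetl].
Qed.

Let Nq : 0 < N - q. Proof. by rewrite subr_gt0. Qed.

Let s1 : 1 < s.
Proof.
rewrite sE ltr_pdivlMr// mul1r -subr_gt0.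
rewrite (_ : _ - _ = N * (q - 1) + q); last by ring.
by rewrite addr_gt0 ?mulr_gt0 ?ltr0n ?subr_gt0// (lt_trans ltr01).
Qed.

Let s0 : 0 < s. Proof. exact: lt_trans s1. Qed.

(** A signed version of the excess: its modulus is [(|u| - k)^+], and as a difference of two
    elements of [W_0^{1,q}] it stays in the space. *)
Let excess k x : R := u x - trunc k (u x).
Let excess_grad k x := grad u x - below k (u x) *: grad u x.

Let in_W1q0_excess k : 0 <= k -> in_W1q0 Omega q (excess k) (excess_grad k).
Proof.
by move=> k0; exact: (in_W1q0B oO bO q1' (W1q0P u) (in_W1q0_trunc oO bO q1' k0 (W1q0P u))).
Qed.

Let sobolev_excess k K : 0 <= k -> 0 <= K ->
  (forall i, norm_Lq Omega q (fun x => excess_grad k x ord0 i) <= K%:E)%E ->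
  (\int[mu]_(x in Omega) (`|excess k x| `^ s)%:E <=
    ((q * n%:R / (N - q) * K) `^ s)%:E)%E.
Proof.
move=> k0 K0 HK; rewrite sE.
exact: (sobolev_W1q0 oO bO n0 q1 qN (in_W1q0_excess k0) K0 HK).
Qed.

(** The energy inequality has this integral on both sides and would be void if it were infinite;
    Sobolev with the gradient norm of the excess, finite a priori, excludes that. *)
Let excess_fin k : 0 <= k -> exists2 Y : R, 0 <= Y &
  (\int[mu]_(x in Omega) (`|excess k x| `^ s)%:E = Y%:E)%E.
Proof.
move=> k0; have [[_ LH _] _] := in_W1q0_excess k0.
pose nrm i := norm_Lq Omega q (fun x => excess_grad k x ord0 i).
have nfin i : nrm i \is a fin_num by rewrite ge0_fin_numE ?Lnorm_ge0//; exact: (LH i).2.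
have n_ge0 i : 0 <= fine (nrm i) by rewrite fine_ge0// Lnorm_ge0.
pose K := \sum_i fine (nrm i).
have K0 : 0 <= K by apply: sumr_ge0.
have HK i : (nrm i <= K%:E)%E.
  rewrite -(fineK (nfin i)) lee_fin /K (bigD1 i)//= lerDl.
  by apply: sumr_ge0.
have I0 : (0 <= \int[mu]_(x in Omega) (`|excess k x| `^ s)%:E)%E.
  by apply: integral_ge0 => x _; rewrite lee_fin powR_ge0.
have Ifin : (\int[mu]_(x in Omega) (`|excess k x| `^ s)%:E)%E \is a fin_num.
  by rewrite ge0_fin_numE//; apply: (le_lt_trans (sobolev_excess k0 K0 HK)); rewrite ltry.
exists (fine (\int[mu]_(x in Omega) (`|excess k x| `^ s)%:E)).
  by rewrite fine_ge0.
by rewrite fineK.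
Qed.

Let level k := fine (mu (superlevel k)).

Let excess_energy : exists2 C : R, 0 < C & forall k Y : R, 0 <= k -> 0 <= Y ->
  (\int[mu]_(x in Omega) (`|excess k x| `^ s)%:E = Y%:E)%E ->
  Y <= C * level k `^ ((1 - s^-1 - r^-1) * s / p) * Y `^ p^-1 *
    ((b3 + k) `^ s * level k + Y) `^ (m / p).
Proof.
have s10 : 0 < 1 - s^-1 by rewrite subr_gt0 invf_lt1.
pose sigma := (1 - s^-1)^-1; have sigmaE : sigma^-1 = 1 - s^-1 by rewrite invrK.
have sigma0 : 0 < sigma by rewrite invr_gt0.
(* This is [1 - 1 / s - 1 / r > 0] rewritten: [f] has to be integrable to the power conjugate to
   [s]. *)
have sigma_r : sigma < r.
  by rewrite -ltf_pV2 ?posrE// sigmaE -subr_gt0.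
have [c c0 fMc] := fM.2.
have [F F0 HF] := marcinkiewicz_integral_le mO Ooo mf c0 sigma0 sigma_r fMc.
(* The constant [F] may be zero, whereas the final constant has to be positive for
   [decay_of_energy], which takes its logarithm. *)
pose F1 := F + 1; have F10 : 0 < F1 by rewrite ltr_wpDl.
pose S := q * n%:R / (N - q); pose B := (b1 * b4)^-1.
have B0 : 0 < B by rewrite invr_gt0 mulr_gt0.
have q0 : 0 < q by exact: lt_trans q1.
have p0 : 0 < p by exact: lt_trans qp.
have S0 : 0 < S by rewrite divr_gt0// mulr_gt0// ltr0n.
exists (S `^ s * B `^ (s / p) * F1 `^ (sigma^-1 * (s / p)) * 2 `^ (s * (m / p))).
  by rewrite !mulr_gt0// powR_gt0.
move=> k Y k0 Y0 YE; pose A := superlevel k; pose t := level k.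
have mA : measurable A by exact: measurable_superlevel.
have t0 : 0 <= t by rewrite fine_ge0.
have muA : mu A = t%:E by rewrite fineK// leb_superlevel_fin.
have Z0 : 0 <= (b3 + k) `^ s * t + Y by rewrite addr_ge0// mulr_ge0// powR_ge0.
rewrite -(energy_exponents (ltW S0) (ltW B0) (ltW F10) t0 Y0 Z0 p0 q0 s0 r0 sigmaE sigma0 mqs).
set K := (_ * _) `^ q^-1.
have K0 : 0 <= K by exact: powR_ge0.
rewrite -lee_fin -YE; apply: (sobolev_excess k0 K0) => i.
rewrite -[norm_Lq _ _ _]/(Lq_norm_on mu Omega q _) (Lq_norm_onE mu Omega q1').
rewrite -poweR_EFin; apply: lee_poweR.
- by rewrite invr_ge0 ltW.
- by apply: integral_ge0 => x _; rewrite lee_fin powR_ge0.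
have -> : (\int[mu]_(x in Omega) (`|excess_grad k x ord0 i| `^ q)%:E =
    \int[mu]_(x in A) (`|grad u x ord0 i| `^ q)%:E)%E.
  rewrite integral_mkcond [RHS]integral_mkcond; apply: eq_integral => x _.
  rewrite !patchE /excess_grad !mxE; have [Ox|Ox] := boolP (x \in Omega); last first.
    by rewrite memNset// => -[]; rewrite -in_setE (negbTE Ox).
  have Ox' : Omega x by rewrite inE in Ox.
  have [uk|uk] := leP `|u x| k.
    rewrite memNset; last by move=> -[_ /=]; rewrite ltNge uk.
    by rewrite /below uk mul1r subrr normr0 powR0// gt_eqF.
  by rewrite mem_set//= /below leNgt uk/= mul0r subr0.
have mtr := measurable_trunc k mO mu_.
have UE x : A x -> `|u x| = `|excess k x| + k.
  by move=> [_ /= ux]; rewrite /excess norm_sub_trunc// subrK.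
have w0 x : Omega x -> ~ A x -> excess k x = 0.
  move=> Ox Ax; rewrite /excess trunc_id ?subrr// leNgt.
  by apply/negP => ux; apply: Ax; split.
have b14 : 0 < b1 * b4 by rewrite mulr_gt0.
have HFA : (\int[mu]_(x in A) (`|f x| `^ sigma)%:E <=
    (F1 * t `^ (1 - sigma / r))%:E)%E.
  apply: (le_trans (HF A mA (@subIsetl _ _ _))); rewrite lee_fin.
  by rewrite ler_wpM2r ?powR_ge0// lerDl.
have en := truncation_energy oO bO q1' (ltW p0) (ltW m0) b1_gt0 b2_gt0 b4_gt0 b23 aE
  j00 j_ge mf umin i k0.
exact: (@gradient_estimate _ L R mu Omega A (fun x => grad u x ord0 i) (fun x => `|u x|)
  f (excess k) p q m s sigma (b1 * b4) b3 k t _ Y mO mA (@subIsetl _ _ _) (Lg i).1 mnu mf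
  (measurable_funB mu_ mtr) (fun x => normr_ge0 _) UE w0 q0 qp s1 mqs b14 b3_gt0 k0
  sigmaE muA YE HFA en).
Qed.

Let chebyshev k h Y : 0 <= k -> k < h ->
  (\int[mu]_(x in Omega) (`|excess k x| `^ s)%:E = Y%:E)%E ->
  (h - k) `^ s * level h <= Y.
Proof.
move=> k0 kh YE; have mA := measurable_superlevel h.
have AO : superlevel h `<=` Omega by exact: subIsetl.
have hk : 0 <= h - k by rewrite subr_ge0 ltW.
rewrite -lee_fin -YE EFinM fineK ?leb_superlevel_fin//.
rewrite -[leLHS](integral_cst mu mA ((h - k) `^ s)%:E).
have mw : measurable_fun (Omega : set L) (fun x => (`|excess k x| `^ s)%:E).
  apply/measurable_EFinP; apply: (measurableT_comp (measurable_powR s)).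
  apply: measurableT_comp => //; exact: (measurable_funB mu_ (measurable_trunc k mO mu_)).
apply: (@le_trans _ _ (\int[mu]_(x in superlevel h) (`|excess k x| `^ s)%:E)%E).
  apply: (ge0_le_integral mu mA).
  - by move=> x _; rewrite lee_fin powR_ge0.
  - exact: measurable_cst.
  - exact: (measurable_funS mO AO mw).
  - move=> x [_ /= ux]; rewrite lee_fin; apply: ge0_ler_powR; rewrite ?nnegrE ?(ltW s0)//.
    by rewrite /excess norm_sub_trunc ?(lt_trans kh)// lerD2r ltW.
exact: ge0_subset_integral.
Qed.

(** [decay_of_energy] with [c = b3 + k] and [c0 = b3] bounds the [s]-th moment of the excess over
    [k]; Chebyshev at height [h - k] turns this into a bound on the level [h]. *)
Lemma level_set_decay : exists2 C : R, 0 < C & forall k h : R, 0 <= k -> k < h ->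
  fine (mu (superlevel h)) <= C * (b3 + k) `^ (s * (m / (p - 1))) / (h - k) `^ s *
    fine (mu (superlevel k)) `^ (((1 - s^-1 - r^-1) * s + m) / (p - 1)).
Proof.
have [A A0 HA] := excess_energy.
have M0 : 0 < fine (mu Omega) + 1 by rewrite ltr_wpDl// fine_ge0.
have [C C0 HC] := decay_of_energy m0 mp s0 e0 es M0 b3_gt0 A0.
exists C => // k h k0 kh; have [Y Y0 YE] := excess_fin k0.
have hk : 0 < (h - k) `^ s by rewrite powR_gt0// subr_gt0.
rewrite mulrAC ler_pdivlMr// mulrC.
apply: (le_trans (chebyshev k0 kh YE)).
apply: (HC Y (level k)) => //.
- by rewrite fine_ge0.
- rewrite (@le_trans _ _ (fine (mu Omega)))// ?lerDl//.
  apply: fine_le; [exact: leb_superlevel_fin|by rewrite ge0_fin_numE|].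
  apply: le_measure; rewrite ?inE; [exact: measurable_superlevel|exact: mO|exact: subIsetl].
- by rewrite lerDl.
- exact: HA.
Qed.

End level_set_decay.

(** * Iteration over the levels *)

Section level_iteration.
Context {R : realType} (m : R -> R) (C c s theta e M : R).
Hypotheses (C0 : 0 < C) (c0 : 0 < c) (s0 : 0 < s) (M0 : 0 < M).
Hypotheses (theta0 : 0 < theta) (theta1 : theta < 1) (e1 : 1 <= e).
Hypothesis m_ge0 : forall k, 0 <= m k.
Hypothesis m_le : forall k, m k <= M.
Hypothesis m_decay : forall k h, 0 <= k -> k < h ->
  m h <= C * (c + k) `^ (s * theta) / (h - k) `^ s * m k `^ e.

Lemma levels_vanish : 1 < e -> (forall k h, k <= h -> m h <= m k) ->
  exists2 L : R, 0 < L & m (2 * L) = 0.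
Proof.
move=> e_gt1 m_nincr.
have e10 : 0 < e - 1 by rewrite subr_gt0.
have st0 : 0 < s * (1 - theta) by rewrite mulr_gt0// subr_gt0.
(* The solution of [rho ^ (e - 1) = 2 ^ (- s)]: the gain from the exponent [e > 1] exactly offsets
   the factor [2 ^ s] lost whenever the gap between levels is halved. *)
pose lrho := - (s / (e - 1) * ln 2); pose rho := expR lrho.
(* What then remains of the induction step is [C (3 L) ^ (s theta) 2 ^ s M ^ (e - 1) <= rho L ^ s].
   As [theta < 1], it holds for large [L], and [l] is the threshold for [ln L]. The [3] comes from
   [c + k <= 3 L]. *)
pose l := (ln C + s * theta * ln 3 + s * ln 2 + (e - 1) * ln M - lrho) / (s * (1 - theta)).
pose L := c + expR l; have L0 : 0 < L by rewrite addr_gt0 ?expR_gt0.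
have cL : c <= L by rewrite lerDl expR_ge0.
have lL : l <= ln L by rewrite -[l]expRK ler_ln ?posrE ?expR_gt0// lerDr ltW.
have ln2 : 0 < ln 2 :> R by rewrite ln_gt0// ltr1n.
have rho1 : rho < 1.
  by rewrite -expR0 ltr_expR oppr_lt0 mulr_gt0// divr_gt0.
pose x j := L / 2 ^+ j; have x0 j : 0 < x j by rewrite divr_gt0// exprn_gt0.
have xL j : x j <= L by rewrite ler_pdivrMr ?exprn_gt0// ler_peMr ?(ltW L0)// exprn_ege1// ler1n.
have xS j : x j.+1 = x j / 2 by rewrite /x exprSr invfM mulrA.
have bound j : m (2 * L - x j) <= M * rho ^+ j.
  elim: j => [|j IHj]; first by rewrite expr0 mulr1.
  have kj : 0 <= 2 * L - x j by have := xL j; lra.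
  have kS : 2 * L - x j < 2 * L - x j.+1 by rewrite xS; have := x0 j; lra.
  apply: (le_trans (m_decay kj kS)).
  rewrite (_ : 2 * L - x j.+1 - (2 * L - x j) = x j / 2); last by rewrite xS; field.
  have xj2 : 0 < x j / 2 by rewrite divr_gt0.
  apply: (@le_trans _ _ (C * (3 * L) `^ (s * theta) / (x j / 2) `^ s *
      (M * rho ^+ j) `^ e)).
    apply: ler_pM.
    - by rewrite divr_ge0 ?powR_ge0// mulr_ge0 ?powR_ge0 ?ltW.
    - exact: powR_ge0.
    - rewrite ler_wpM2r ?invr_ge0 ?powR_ge0// ler_wpM2l ?(ltW C0)//.
      apply: ge0_ler_powR; rewrite ?nnegrE ?mulr_ge0 ?(ltW s0) ?(ltW theta0) ?(ltW L0)//.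
        by rewrite addr_ge0// ltW.
      by have := x0 j; lra.
    - apply: ge0_ler_powR; rewrite ?nnegrE ?(le_trans ler01 e1)//.
      by rewrite mulr_ge0 ?exprn_ge0 ?expR_ge0 ?ltW.
  have rho0 k : 0 < rho ^+ k by rewrite exprn_gt0// expR_gt0.
  have lnx : ln (x j) = ln L - j%:R * ln 2.
    by rewrite ln_div ?posrE ?exprn_gt0// lnXn// mulr_natl.
  have lnx2 : ln (x j / 2) = ln L - j%:R * ln 2 - ln 2 by rewrite ln_div ?posrE// lnx.
  have lnrho k : ln (rho ^+ k) = k%:R * lrho.
    by rewrite lnXn ?expR_gt0// expRK mulr_natl.
  rewrite -ler_ln ?posrE ?mulr_gt0 ?invr_gt0 ?powR_gt0 ?mulr_gt0//.
  rewrite !lnM ?posrE ?mulr_gt0 ?invr_gt0 ?powR_gt0 ?mulr_gt0// lnV ?posrE ?powR_gt0//.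
  rewrite !ln_powR lnx2 lnrho !lnM ?posrE// lnrho -[j.+1%:R]natr1.
  have He : e * lrho = lrho - s * ln 2.
    by rewrite /lrho; field; rewrite gt_eqF.
  have Hl : ln C + s * theta * ln 3 + s * ln 2 + (e - 1) * ln M - lrho <=
      s * (1 - theta) * ln L.
    by rewrite [leRHS]mulrC -ler_pdivrMr.
  rewrite [e * (_ + _)]mulrDr [e * (_ * lrho)]mulrCA He; lra.
exists L => //; apply/eqP; rewrite eq_le m_ge0 andbT leNgt; apply/negP => m2L.
have : (fun j => M * rho ^+ j) @ \oo --> M * 0.
  by apply: cvgM; [exact: cvg_cst|apply: cvg_expr; rewrite ger0_norm// expR_ge0].
rewrite mulr0 => /cvgrPdist_lt/(_ _ m2L)[j _ /(_ j (leqnn j))].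
rewrite /= sub0r normrN ltNge => /negP; apply.
rewrite ger0_norm; last by rewrite mulr_ge0 ?exprn_ge0 ?expR_ge0 ?ltW.
by apply: le_trans (bound j); apply: m_nincr; have := x0 j; lra.
Qed.

Let nu := (1 - theta)^-1.

Let nu0 : 0 < nu. Proof. by rewrite invr_gt0 subr_gt0. Qed.
Let nu1 : 1 <= nu. Proof. by rewrite invf_ge1 ?subr_gt0// gerBl ltW. Qed.

(** Lower bound for the gap between consecutive levels: factor [y ^ nu = y * y ^ (nu - 1)] and use
    that the second factor is nondecreasing. *)
Let powR_succ_sub (x : R) : 0 <= x -> x `^ (nu - 1) <= (x + 1) `^ nu - x `^ nu.
Proof.
move=> x0; have x10 : 0 <= x + 1 by rewrite addr_ge0.
rewrite -(mulr_powRB1 x10 nu0) -(mulr_powRB1 x0 nu0) lerBrDr.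
have : x `^ (nu - 1) <= (x + 1) `^ (nu - 1).
  by apply: ge0_ler_powR; rewrite ?nnegrE ?subr_ge0// lerDl.
nra.
Qed.

(** The exponent [nu = 1 / (1 - theta)] satisfies [theta nu = nu - 1], so at the level
    [k = (j B) ^ nu] the weight [k ^ theta] and the gap to the next level both grow like
    [j ^ (nu - 1)]. Their ratio is at most of order [1 / B], uniformly in [j >= 1], and a large [B]
    makes every step contract by [e ^ (- s)]. *)
Lemma levels_exponential_decay : exists2 B : R, 0 < B & forall j : nat,
  m ((j%:R * B) `^ nu) <= M * expR s * expR (- s * j%:R).
Proof.
pose C' := C * M `^ (e - 1).
have C'0 : 0 < C' by rewrite mulr_gt0// powR_gt0.
(* The first term of the maximum ensures [C' 2 ^ (s theta) B ^ (- s) <= e ^ (- s)]; the second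
   [c <= B ^ nu], so that [c + k <= 2 k] at every level from [j = 1] on. *)
pose B := expR (Num.max ((ln C' + s * theta * ln 2 + s) / s) (ln c / nu)).
have B0 : 0 < B by exact: expR_gt0.
have HB1 : ln C' + s * theta * ln 2 + s <= s * ln B.
  by rewrite [leRHS]mulrC -ler_pdivrMr// expRK le_max lexx.
have HB2 : c <= B `^ nu.
  rewrite -ler_ln ?posrE ?powR_gt0// ln_powR mulrC -ler_pdivrMr//.
  by rewrite expRK le_max lexx orbT.
exists B => //; case=> [|j].
  (* The recursion starts only at [j = 1], since [c + k <= 2 k] fails at [k = 0]. The indices [0]
     and [1] use the bound [M], which is why the factor [e ^ s] stands in the conclusion. *)
  by rewrite mulr0 expR0 mulr1 (le_trans (m_le _))// ler_peMr ?(ltW M0)// -expR0 ler_expR ltW.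
elim: j => [|j IHj].
  rewrite mulr1 -mulrA -expRD subrr expR0 mulr1; exact: m_le.
pose x : R := j.+1%:R; have x0 : 0 < x by rewrite ltr0n.
have x1 : 1 <= x by rewrite ler1n.
have kE (y : R) : 0 <= y -> (y * B) `^ nu = y `^ nu * B `^ nu.
  by move=> y0; rewrite powRM// ltW.
rewrite -natr1 -/x kE ?addr_ge0 ?ler0n ?(ltW x0)// -/x.
rewrite -/x kE ?(ltW x0)// in IHj.
have k0 : 0 < x `^ nu * B `^ nu by rewrite mulr_gt0// powR_gt0.
have dk : x `^ (nu - 1) * B `^ nu <= (x + 1) `^ nu * B `^ nu - x `^ nu * B `^ nu.
  by rewrite -mulrBl ler_wpM2r ?powR_ge0// powR_succ_sub// ltW.
have dk0 : 0 < x `^ (nu - 1) * B `^ nu by rewrite mulr_gt0// powR_gt0.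
have kk : x `^ nu * B `^ nu < (x + 1) `^ nu * B `^ nu.
  by rewrite -subr_gt0 (lt_le_trans dk0).
apply: (le_trans (m_decay (ltW k0) kk)).
set k := x `^ nu * B `^ nu in k0 dk kk IHj *.
(* This makes the recursion linear in [m k]; the factor [M ^ (e - 1)] was put into [C']. *)
have me : m k `^ e <= M `^ (e - 1) * m k.
  have e0 : 0 < e by rewrite (lt_le_trans ltr01).
  rewrite -(mulr_powRB1 (m_ge0 k) e0) mulrC ler_wpM2r//.
  by apply: ge0_ler_powR; rewrite ?nnegrE ?subr_ge0 ?(ltW M0).
have ck : c + k <= 2 * k.
  rewrite mulr_natl mulr2n lerD2r (le_trans HB2)// ler_peMl ?powR_ge0//.
  by rewrite -(powRr0 x) ler_powR// ltW.
have main : C' * (c + k) `^ (s * theta) / ((x + 1) `^ nu * B `^ nu - k) `^ s <= expR (- s).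
  rewrite ler_pdivrMr ?powR_gt0 ?subr_gt0//.
  apply: (@le_trans _ _ (C' * (2 * k) `^ (s * theta))).
    rewrite ler_wpM2l ?(ltW C'0)//; apply: ge0_ler_powR; rewrite ?nnegrE//.
    - by rewrite mulr_ge0 ?ltW.
    - by rewrite addr_ge0 ?ltW.
    - by rewrite mulr_ge0// ltW.
  apply: (@le_trans _ _ (expR (- s) * (x `^ (nu - 1) * B `^ nu) `^ s)); last first.
    rewrite ler_wpM2l ?expR_ge0//; apply: ge0_ler_powR; rewrite ?nnegrE ?(ltW s0) ?(ltW dk0)//.
    by rewrite subr_ge0 ltW.
  have k20 : 0 < 2 * k by rewrite mulr_gt0.
  have k20' : 0 < (2 * k) `^ (s * theta) by exact: powR_gt0.
  have q0 : 0 < (x `^ (nu - 1) * B `^ nu) `^ s by exact: powR_gt0.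
  rewrite -ler_ln ?posrE; last 2 first.
  - exact: mulr_gt0.
  - by rewrite mulr_gt0// expR_gt0.
  have lk : ln k = nu * (ln x + ln B).
    by rewrite /k lnM ?posrE ?powR_gt0// !ln_powR mulrDr.
  have lq : ln (x `^ (nu - 1) * B `^ nu) = (nu - 1) * ln x + nu * ln B.
    by rewrite lnM ?posrE ?powR_gt0// !ln_powR.
  rewrite [ln (C' * _)]lnM ?posrE ?powR_gt0// ln_powR [ln (2 * k)]lnM ?posrE// lk.
  rewrite [ln (expR _ * _)]lnM ?posrE ?expR_gt0// expRK ln_powR lq.
  have Ht : theta * nu = nu - 1.
    by rewrite /nu; field; rewrite gt_eqF// subr_gt0.
  rewrite (_ : s * theta * (_ + _) = s * theta * ln 2 +
    s * (theta * nu) * (ln x + ln B)); last by ring.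
  rewrite Ht; move: HB1; lra.
apply: (@le_trans _ _ (expR (- s) * m k)).
  apply: (le_trans _ (ler_wpM2r (m_ge0 k) main)).
  have X0 : 0 <= C * (c + k) `^ (s * theta) / ((x + 1) `^ nu * B `^ nu - k) `^ s.
    by rewrite divr_ge0 ?powR_ge0// mulr_ge0 ?powR_ge0 ?ltW.
  apply: (le_trans (ler_wpM2l X0 me)).
  by rewrite le_eqVlt; apply/orP; left; apply/eqP; rewrite /C'; ring.
apply: (le_trans (ler_wpM2l (expR_ge0 _) IHj)).
rewrite mulrCA -expRD le_eqVlt; apply/orP; left; apply/eqP.
by congr (_ * expR _); rewrite -/x; ring.
Qed.

End level_iteration.

(** With [lambda = s / (2 B)] the integrand at the [j]-th level is [e ^ (s j / 2)], growing at half
    the rate at which the measures decay, so the layer sum is geometric of ratio [e ^ (- s / 2)]. *)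
Lemma expR_integrable_of_decay d (T : measurableType d) (R : realType)
    (mu : {measure set T -> \bar R}) (O : set T) (h : T -> R) (C s B theta : R) :
  measurable O -> (mu O < +oo)%E -> measurable_fun O h -> (forall x, 0 <= h x) ->
  0 <= C -> 0 < s -> 0 < B -> 0 < theta -> theta < 1 ->
  (forall j : nat, (mu (O `&` [set x | ((j%:R * B) `^ (1 - theta)^-1 < h x)%R]) <=
    (C * expR (- s * j%:R))%:E)%E) ->
  mu.-integrable O (fun x => (expR (s / (2 * B) * h x `^ (1 - theta)))%:E).
Proof.
move=> mO Ooo mh h0 C0 s0 B0 theta0 theta1 H.
have th0 : 0 < 1 - theta by rewrite subr_gt0.
pose lambda := s / (2 * B); have l0 : 0 < lambda by rewrite divr_gt0// mulr_gt0.
pose t (j : nat) := (j%:R * B) `^ (1 - theta)^-1.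
pose phi (y : R) := expR (lambda * y `^ (1 - theta)).
have phit j : phi (t j) = expR (s / 2 * j%:R).
  rewrite /phi /t -powRrM mulVf ?gt_eqF// powRr1; last by rewrite mulr_ge0// ltW.
  by congr expR; rewrite /lambda; field; rewrite gt_eqF.
have mphi : measurable_fun setT phi.
  apply: measurableT_comp => //; apply: measurable_funM; first exact: measurable_cst.
  exact: measurable_powR.
have mint : measurable_fun O (fun x => (expR (lambda * h x `^ (1 - theta)))%:E).
  by apply/measurable_EFinP; exact: (measurableT_comp mphi mh).
apply/integrableP; split => //.
under eq_integral do rewrite abse_EFin ger0_norm ?expR_ge0//.
have := @integral_layers_le _ T R mu O h phi t mO mh mphi (fun x _ => h0 x)
  (fun y => expR_ge0 _).
move=> /(_ _ _)/le_lt_trans; apply.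
- move=> y z y0 yz; rewrite ler_expR ler_wpM2l ?(ltW l0)//.
  by apply: ge0_ler_powR; rewrite ?nnegrE ?(ltW th0)// (le_trans y0).
(* The maximum with [1] ensures [J B >= 1], so that raising to the power [1 / (1 - theta) >= 1] does
   not fall below [J B >= y]. *)
- move=> y; pose J := Num.bound `|Num.max 1 y / B|; exists J.
  have J0 : Num.max 1 y <= J%:R * B.
    by rewrite -ler_pdivrMr// ltW// (le_lt_trans (ler_norm _))// archi_boundP.
  have yJ : y <= J%:R * B by apply: le_trans J0; rewrite le_max lexx orbT.
  have J1 : 1 <= J%:R * B by apply: le_trans J0; rewrite le_max lexx.
  apply: (le_trans yJ); rewrite -[leLHS]powRr1 ?(le_trans ler01)// ler_powR//.
  by rewrite invf_ge1// gerBl ltW.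
rewrite phit; apply: lte_add_pinfty.
  by rewrite mulr0 expR0 mul1e.
apply: (@le_lt_trans _ _ ((C * expR (s / 2)) / (1 - expR (- (s / 2))))%:E); last exact: ltry.
apply: nneseries_geometric_le.
- by rewrite mulr_ge0// expR_ge0.
- exact: expR_ge0.
- by rewrite -expR0 ltr_expR oppr_lt0 divr_gt0.
- by move=> j; rewrite mule_ge0// lee_fin expR_ge0.
move=> j; apply: (@le_trans _ _ ((expR (s / 2 * j.+1%:R))%:E * (C * expR (- s * j%:R))%:E)%E).
  by rewrite phit; apply: lee_wpmul2l; [rewrite lee_fin expR_ge0|exact: H].
rewrite -EFinM lee_fin le_eqVlt; apply/orP; left; apply/eqP.
rewrite -expRM_natl mulrCA -expRD -[RHS]mulrA -expRD; congr (_ * expR _).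
by rewrite -natr1; field.
Qed.

(** * Arithmetic of the exponents *)

Section exponents.
Context {R : realType} (N p alpha q s r : R).
Hypotheses (p1 : 1 < p) (pN : p < N) (alpha0 : 0 < alpha) (alphap : alpha * p < p - 1).
Hypotheses (qE : q = N * p * (1 - alpha) / (N - alpha * p)) (sE : s = q * N / (N - q)).
Hypothesis rN : N / p <= r.

Let p0 : 0 < p. Proof. exact: lt_trans p1. Qed.
Let N0 : 0 < N. Proof. exact: lt_trans pN. Qed.
Let D0 : 0 < N - alpha * p. Proof. move: alphap pN; lra. Qed.
Let Np0 : 0 < N - p. Proof. by rewrite subr_gt0. Qed.
Let pa1 : 1 < p * (1 - alpha). Proof. move: alphap; lra. Qed.
Let r0 : 0 < r. Proof. by apply: lt_le_trans rN; rewrite divr_gt0. Qed.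

Lemma exponent_q_gt1 : 1 < q.
Proof.
rewrite qE ltr_pdivlMr// mul1r; have := mulr_gt0 N0 p0.
(* The difference [N p (1 - alpha) - (N - alpha p)] to be shown positive is this product plus
   [p - 1]. *)
have : 0 < (N - 1) * (p - 1 - alpha * p).
  by rewrite mulr_gt0// subr_gt0// (lt_trans p1).
move: p1 pN alphap; nra.
Qed.

Lemma exponent_q_ltN : q < N.
Proof. by rewrite qE ltr_pdivrMr// -mulrA ltr_pM2l//; move: pN; lra. Qed.

Lemma exponent_q_ltp : q < p.
Proof.
rewrite qE ltr_pdivrMr// mulrAC mulrC ltr_pM2l//.
have : 0 < alpha * (N - p) by rewrite mulr_gt0.
lra.
Qed.

Lemma exponent_sE : s = N * p * (1 - alpha) / (N - p).
Proof.
have qN : N - q = N * (N - p) / (N - alpha * p).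
  by rewrite qE; field; rewrite gt_eqF.
by rewrite sE qN qE; field; rewrite !gt_eqF.
Qed.

Let s0 : 0 < s.
Proof. by rewrite exponent_sE divr_gt0// -mulrA mulr_gt0// (lt_trans ltr01). Qed.

Lemma exponent_qs : alpha * p * q = s * (p - q).
Proof. by rewrite exponent_sE qE; field; rewrite !gt_eqF. Qed.

Let sN : s * (1 - p / N) = p * (1 - alpha).
Proof. by rewrite exponent_sE; field; rewrite !gt_eqF. Qed.

(** This is where [r >= N / p] enters. The right side is [s (1 - 1 / r) - 1], nondecreasing in [r],
    and at [r = N / p] it equals [p (1 - alpha) - 1], the left side. It says that the exponent in
    the decay of levels is at least one. *)
Lemma exponent_decay : p - 1 - alpha * p <= (1 - s^-1 - r^-1) * s.
Proof.
have -> : (1 - s^-1 - r^-1) * s = s * (1 - r^-1) - 1.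
  by field; rewrite !gt_eqF.
have : s * (1 - p / N) <= s * (1 - r^-1).
  rewrite ler_wpM2l ?(ltW s0)// lerD2l lerN2 -[p / N]invrK lef_pV2 ?posrE ?invr_gt0 ?divr_gt0//.
  by rewrite invf_div.
rewrite sN; lra.
Qed.

Lemma exponent_decay_lt : N / p < r -> p - 1 - alpha * p < (1 - s^-1 - r^-1) * s.
Proof.
move=> rN'; have -> : (1 - s^-1 - r^-1) * s = s * (1 - r^-1) - 1.
  by field; rewrite !gt_eqF.
have : s * (1 - p / N) < s * (1 - r^-1).
  rewrite ltr_pM2l// ltrD2l ltrN2 -[p / N]invrK ltf_pV2 ?posrE ?invr_gt0 ?divr_gt0//.
  by rewrite invf_div.
rewrite sN; lra.
Qed.

Lemma exponent_gt0 : 0 < 1 - s^-1 - r^-1.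
Proof.
rewrite -(pmulr_lgt0 _ s0); apply: lt_le_trans exponent_decay.
by rewrite subr_gt0.
Qed.

End exponents.

(** * The critical and the supercritical Marcinkiewicz exponent *)

Unset Implicit Arguments.

Theorem theorem3p1 (R : realType) (n : nat) (Omega : set 'rV[R]_n)
  (p p' alpha q : R) (beta1 beta2 beta3 beta4 beta5 : R)
  (b : 'rV[R]_n -> R) (a : 'rV[R]_n -> R -> R) (j : 'rV[R]_n -> R)
  (f : 'rV[R]_n -> R) (r : R) (u : W1q0 Omega q) :
  (2 <= n)%N ->
  open Omega -> bounded_set Omega ->
  1 < p -> p < n%:R ->
  p' = p / (p - 1) ->
  0 < alpha -> alpha < p'^-1 ->
  q = n%:R * p * (1 - alpha) / (n%:R - alpha * p) ->
  0 < beta1 -> 0 < beta2 -> 0 < beta3 -> 0 < beta4 -> 0 < beta5 ->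
  measurable_fun (Omega : set (lebesgue_rV R n)) b ->
  {ae @leb R n, forall x, Omega x -> beta2 <= b x <= beta3} ->
  {ae @leb R n, forall x, Omega x ->
     forall s : R, a x s = beta1 / (b x + `|s|) `^ (alpha * p)} ->
  @convex_function R 'rV[R]_n setT j ->
  j 0 = 0 ->
  (forall xi : 'rV[R]_n,
     beta4 * enorm xi `^ p <= j xi <= beta5 * (1 + enorm xi `^ p)) ->
  marcinkiewicz Omega r f ->
  n%:R / p <= r ->
  (forall v : W1q0 Omega q,
     (I_functional a j f u <= I_functional a j f v)%E) ->
  (r = n%:R / p ->
     exists2 lambda : R, 0 < lambda &
       (@leb R n).-integrable Omega
         (fun x => (expR (lambda * `|u x| `^ (1 - p' * alpha)))%:E)) /\
  (n%:R / p < r ->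
     exists2 L : R, 0 < L &
       {ae @leb R n, forall x, Omega x -> `|u x| <= 2 * L}).
Proof.
(* The Sobolev inequality is stated in dimension [n.+1] with [0 < n]; a dimension of the form [n.+2]
   meets that form. *)
move: n Omega b a j f u => [|[|n]] Omega b a j f u //.
move=> _ oO bO p1 pN p'E alpha0 alphap' qE b10 b20 b30 b40 b50 mb b23 aE cj j00 jb fM rN umin.
pose N : R := n.+2%:R; pose m := alpha * p; pose s := q * N / (N - q).
have p0 : 0 < p by exact: lt_trans p1.
have p10 : 0 < p - 1 by rewrite subr_gt0.
have mp : m < p - 1.
  by move: alphap'; rewrite p'E invf_div ltr_pdivlMr.
have m0 : 0 < m by rewrite mulr_gt0.
have q1 : 1 < q by exact: (exponent_q_gt1 p1 pN mp qE).
have qN : q < N by exact: (exponent_q_ltN p1 pN mp qE).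
have qp : q < p by exact: (exponent_q_ltp p1 pN alpha0 mp qE).
have mqs : m * q = s * (p - q) by exact: (exponent_qs p1 pN mp qE (erefl s)).
have e0 := exponent_gt0 p1 pN mp qE (erefl s) rN.
have es := exponent_decay p1 pN mp qE (erefl s) rN.
have N0 : 0 < N by rewrite ltr0n.
have r0 : 0 < r by apply: lt_le_trans rN; rewrite divr_gt0.
have s0 : 0 < s by rewrite divr_gt0 ?subr_gt0// mulr_gt0// (lt_trans ltr01).
(* This is [p' alpha], the power of [b3 + k] in the decay, so [1 - theta] is the exponent required
   in the exponential. *)
pose theta := m / (p - 1).
have theta0 : 0 < theta by rewrite divr_gt0.
have theta1 : theta < 1 by rewrite ltr_pdivrMr// mul1r.
pose e := ((1 - s^-1 - r^-1) * s + m) / (p - 1).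
have j_ge xi : beta4 * enorm xi `^ p <= j xi by have /andP[] := jb xi.
have [C C0 decay] := level_set_decay oO bO (isT : (0 < n.+1)%N) q1 qN qp (erefl s) mqs
  m0 mp r0 e0 es b10 b20 b30 b40 b23 aE j00 j_ge fM umin.
pose lev k := fine (leb (superlevel u k)); pose M := fine (leb Omega) + 1.
have mO := measurable_open_rV oO; have Ooo := leb_open_lty oO bO.
have q1' := ltW q1.
have mu_ : measurable_fun (Omega : set (lebesgue_rV R n.+2)) u.
  by have [[[H _] _ _] _] := W1q0P u.
have mnu : measurable_fun (Omega : set (lebesgue_rV R n.+2)) (fun x => `|u x|).
  exact: measurableT_comp.
have mS k : measurable (superlevel u k) by exact: measurable_superlevel.
have Sfin k : leb (superlevel u k) \is a fin_num by exact: leb_superlevel_fin.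
have M0 : 0 < M by rewrite ltr_wpDl// fine_ge0.
have lev0 k : 0 <= lev k by exact: fine_ge0.
have levM k : lev k <= M.
  rewrite (@le_trans _ _ (fine (leb Omega)))// ?lerDl//.
  apply: fine_le; [exact: Sfin|by rewrite ge0_fin_numE|].
  apply: le_measure; rewrite ?inE; [exact: mS|exact: mO|exact: subIsetl].
split=> [rE|rN'].
  have e1 : 1 <= e by rewrite ler_pdivlMr// mul1r -lerBlDr.
  have [B B0 HB] := levels_exponential_decay C0 b30 s0 M0 theta0 theta1 e1 lev0 levM decay.
  exists (s / (2 * B)); first by rewrite divr_gt0// mulr_gt0.
  have -> : 1 - p' * alpha = 1 - theta by rewrite /theta /m p'E; field; rewrite gt_eqF.
  apply: (@expR_integrable_of_decay _ _ R leb Omega (fun x => `|u x|) (M * expR s) s B theta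
    mO Ooo mnu (fun x => normr_ge0 _) _ s0 B0 theta0 theta1).
    by rewrite mulr_ge0 ?expR_ge0 ?ltW.
  by move=> k; rewrite -(fineK (Sfin _)) lee_fin; exact: HB.
have es' := exponent_decay_lt p1 pN mp qE (erefl s) rN rN'.
have e1 : 1 < e by rewrite ltr_pdivlMr// mul1r -ltrBlDr.
have [L L0 HL] : exists2 L : R, 0 < L & lev (2 * L) = 0.
  apply: (levels_vanish C0 b30 s0 M0 theta0 theta1 (ltW e1) lev0 levM decay e1).
  move=> k h kh; apply: fine_le; [exact: Sfin|exact: Sfin|].
  apply: le_measure; rewrite ?inE; [exact: mS|exact: mS|].
  by move=> x [Ox /= hx]; split=> //=; exact: le_lt_trans hx.
(* The superlevel set itself is the exceptional null set. *)
exists L => //; exists (superlevel u (2 * L)); split; first exact: mS.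
  by rewrite -(fineK (Sfin _)) -[fine _]/(lev _) HL.
move=> x /= /not_implyP[Ox ux]; split=> //=.
by rewrite ltNge; apply/negP.
Qed.
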